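(* Let $m\ge4$, $n=1$, let $1<p_1,\dots,p_m<\infty$, and let $p$ be defined by $\frac1p=\sum_{i=1}^m\frac1{p_i}$. Then there is a constant $C>0$, independent of the functions, such that $$\|\mathfrak B^{\alpha}_{*}(f_1,\dots,f_m)\|_{L^p(\mathbb R)}\le C\prod_{i=1}^{m}\|f_i\|_{L^{p_i}(\mathbb R)}$$ in each of the following cases: (1) $p_i\ge2$ for all $i=1,\dots,m$ and $\alpha>\frac{m-2}{2}$. (2) For some enumeration $i_1,\dots,i_m$ of $\{1,\dots,m\}$ (pairwise distinct indices) and some $1\le l\le m-1$: $1<p_{i_1},\dots,p_{i_l}<2$, $2\le p_{i_{l+1}},\dots,p_{i_m}<\infty$, and $\alpha>\sum_{k=1}^{l}\frac1{p_{i_k}}+\frac{m-l-2}{2}$. (3) $1<p_i<2$ for all $i=1,\dots,m$ and $\alpha>\frac1p-1$.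
   Context: For Schwartz functions $f_1,\dots,f_m$ on $\mathbb R$, $\alpha\ge 0$ and $R>0$, the $m$-linear Bochner--Riesz means (in dimension $n=1$) are $$\mathfrak B^{\alpha}_{R}(f_1,\dots,f_m)(x)=\int_{\mathbb R^{m}}\Big(1-\frac{\sum_{i=1}^m|\xi_i|^2}{R^2}\Big)^{\alpha}_{+}\ \prod_{i=1}^{m}\hat f_i(\xi_i)\ e^{2\pi i x\sum_{i=1}^m\xi_i}\,d\xi_1\cdots d\xi_m,$$ where $r_+=\max\{r,0\}$, $\hat f$ is the Fourier transform with the inversion formula $f(x)=\int\hat f(\xi)e^{2\pi i x\xi}d\xi$, and the $m$-linear maximal operator is $\mathfrak B^{\alpha}_{*}(f_1,\dots,f_m)(x)=\sup_{R>0}|\mathfrak B^{\alpha}_{R}(f_1,\dots,f_m)(x)|$. Norm inequalities are understood for Schwartz functions $f_i$, with constants independent of the $f_i$. The exponent $p$ may be less than $1$, in which case $\|\cdot\|_{L^p}$ is the usual quasi-norm. *)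

(* Defs.v *)
From HB Require Import structures.
From mathcomp Require Import all_boot all_order all_algebra all_fingroup.
From mathcomp Require Import all_classical all_reals all_analysis.
From mathcomp Require Import complex.

Set Implicit Arguments.
Unset Strict Implicit.
Unset Printing Implicit Defensive.

Import Order.TTheory GRing.Theory Num.Theory.
Import numFieldNormedType.Exports.

Local Open Scope classical_set_scope.
Local Open Scope ring_scope.
Local Open Scope complex_scope.

Export Normc.

Section lebesgue_tuple.
Variable R : realType.
Local Notation mR := (measurableTypeR R).

Definition tuple_cons n (p : mR * n.-tuple mR) : n.+1.-tuple mR :=
  [tuple of p.1 :: p.2].

Definition tuple_uncons n (t : n.+1.-tuple mR) : mR * n.-tuple mR :=
  (thead t, [tuple of behead t]).

Lemma tuple_consK n : cancel (@tuple_cons n) (@tuple_uncons n).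
Proof.
by case=> x v; rewrite /tuple_uncons theadE; congr (_, _); exact/val_inj.
Qed.

Lemma measurable_tuple_cons n : measurable_fun setT (@tuple_cons n).
Proof. exact: measurable_cons. Qed.

Lemma measurable_tuple_uncons n : measurable_fun setT (@tuple_uncons n).
Proof.
apply: measurable_fun_pair; first exact: measurable_tnth.
exact: measurable_behead.
Qed.

Section step.
Variables (n : nat) (mu : {sigma_finite_measure set (n.-tuple mR) -> \bar R}).

Definition lebesgue_tuple_step : set (n.+1.-tuple mR) -> \bar R :=
  pushforward (lebesgue_measure \x mu)%E (@tuple_cons n).

HB.instance Definition _ := Measure.copy lebesgue_tuple_step
  (measure_function_pushforward__canonical__measure_function_Measure
     (lebesgue_measure \x mu)%E (@measurable_tuple_cons n)).

Lemma lebesgue_tuple_step_sigma_finite : sigma_finite setT lebesgue_tuple_step.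
Proof.
have /sigma_finiteP[F [FT ndF Foo]] := sigma_finiteT (@lebesgue_measure R).
have /sigma_finiteP[G [GT ndG Goo]] := sigma_finiteT mu.
exists (fun k => @tuple_uncons n @^-1` (F k `*` G k)).
  apply/seteqP; split=> // t _.
  have [a _ Fa] : (\bigcup_k F k) (thead t) by rewrite -FT.
  have [b _ Gb] : (\bigcup_k G k) [tuple of behead t] by rewrite -GT.
  exists (maxn a b) => //; split=> /=.
  - by apply: (subsetPset _ _ (ndF _ _ (leq_maxl a b))).
  - by apply: (subsetPset _ _ (ndG _ _ (leq_maxr a b))).
move=> k; have [mF Fk] := Foo k; have [mG Gk] := Goo k; split.
  rewrite -[X in measurable X]setTI; apply: measurable_tuple_uncons => //.
  exact: measurableX.
rewrite /lebesgue_tuple_step /pushforward -comp_preimage.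
rewrite (_ : _ \o _ = id) ?preimage_id.
  by rewrite product_measure1E// lte_mul_pinfty// ge0_fin_numE.
by apply/funext => p /=; rewrite tuple_consK.
Qed.

HB.instance Definition _ := Measure_isSigmaFinite.Build _ _ _
  lebesgue_tuple_step lebesgue_tuple_step_sigma_finite.
End step.

(* Lebesgue measure on R^n, carried by n-tuples with their product
   sigma-algebra: R^0 is one point of mass 1, and the measure on R^(n+1) is
   the image of the product measure on R * R^n under (x, v) |-> x :: v. *)
Fixpoint lebesgue_tuple n : {sigma_finite_measure set (n.-tuple mR) -> \bar R} :=
  if n is n'.+1 then lebesgue_tuple_step (lebesgue_tuple n')
  else \d_([tuple] : 0.-tuple mR).

End lebesgue_tuple.

Section bochner_riesz.
Variable R : realType.

Definition cintegral d (T : measurableType d) (mu : {measure set T -> \bar R})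
    (f : T -> R[i]) : R[i] :=
  (\int[mu]_x complex.Re (f x))%R +i* (\int[mu]_x complex.Im (f x))%R.

(* e^(2 pi i t) *)
Definition e2pi (t : R) : R[i] := cos (2 * pi * t) +i* sin (2 * pi * t).

(* R[i] has no normed R-module structure in the libraries, so smoothness and
   derivatives of R -> R[i] are taken componentwise. *)
Definition cderiv1n (k : nat) (f : R -> R[i]) (x : R) : R[i] :=
  (derive1n k (@complex.Re R \o f) x) +i* (derive1n k (@complex.Im R \o f) x).

Definition schwartz (f : R -> R[i]) : Prop :=
  (forall (k : nat) (x : R),
      derivable (derive1n k (@complex.Re R \o f)) x 1 /\
      derivable (derive1n k (@complex.Im R \o f)) x 1) /\
  (forall j k : nat, exists M : R,
      forall x : R, `|x| ^+ j * normc (cderiv1n k f x) <= M).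

Definition fourier (f : R -> R[i]) (xi : R) : R[i] :=
  cintegral (@lebesgue_measure R) (fun x => f x * e2pi (- (x * xi))).

(* (r_+)^a.  At a = 0 this is the indicator of r > 0, unlike powR, for which
   0 `^ 0 = 1; the two agree for a > 0. *)
Definition pos_powR (r a : R) : R := if 0 < r then r `^ a else 0.

Definition bochner_riesz (m : nat) (alpha r : R) (f : 'I_m -> R -> R[i])
    (x : R) : R[i] :=
  cintegral (lebesgue_tuple R m) (fun xi : m.-tuple R =>
    (pos_powR (1 - (\sum_(i < m) `|tnth xi i| ^+ 2) / r ^+ 2) alpha)%:C
    * (\prod_(i < m) fourier (f i) (tnth xi i))
    * e2pi (x * \sum_(i < m) tnth xi i)).

Definition max_bochner_riesz (m : nat) (alpha : R) (f : 'I_m -> R -> R[i])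
    (x : R) : \bar R :=
  ereal_sup [set (normc (bochner_riesz alpha r f x))%:E | r in [set r | 0 < r]].

End bochner_riesz.

(* Main.v *)
(* With g(v) = v_+^alpha e^(-v) one has (1 - u)_+^alpha = e^(1-u) g(1 - u), and
   the Fourier transform of g has modulus c (1 + t^2)^(-(alpha+1)/2).  Inverting
   it turns B_r f(x) into the integral over t of this transform times
   prod_i H_i(t), where H_i(t) is f_i convolved at x with the complex Gaussian
   whose multiplier is exp(-(1 + it) xi^2 / r^2): the multilinear operator
   factorizes.  For a fixed t, |H_i(t)| <= C (1 + t^2)^(1/4) M f_i(x).  In mean
   square over t the Gaussians oscillate, and for b > 2/q, 1 <= q <= 2,
     int (1 + t^2)^(-b/2) |H_i(t)|^2 dt <= C (M |f_i|^q (x))^(2/q).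
   Using the second bound for two indices i0, i1 and the first one for the other
   m - 2 gives, uniformly in r,
     |B_r f(x)| <= C prod_i (M |f_i|^(q_i) (x))^(1/q_i)
   as soon as alpha > m/2 - 2 + 1/q_i0 + 1/q_i1, with q_i = 1 for the others.
   In each of the three cases alpha > sum_i max(1/p_i, 1/2) - 1, which leaves
   room to choose q_i0 < p_i0 and q_i1 < p_i1; the Hardy-Littlewood theorem in
   L^(p_i/q_i) and Hoelder's inequality conclude. *)
Require Import Defs.
From HB Require Import structures.
From mathcomp Require Import all_boot all_order all_algebra all_fingroup.
From mathcomp Require Import all_classical all_reals all_analysis.
From mathcomp Require Import complex measurable_realfun ring lra.

Set Implicit Arguments.
Unset Strict Implicit.
Unset Printing Implicit Defensive.

Import Order.TTheory GRing.Theory Num.Theory.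
Import numFieldNormedType.Exports.

Local Open Scope classical_set_scope.
Local Open Scope ring_scope.

(** If all m factors were bounded pointwise in t, the integral over t would converge only for alpha
    > m/2. Cauchy-Schwarz in t lets two factors be measured in mean square, which at q = 2 lowers
    the threshold by a full unit, to (m - 2)/2. This gain is an oscillation effect: the square is
    expanded into a double integral over y and z, and t is integrated first. The resulting kernel
    decays in the size of the two rescaled distances and also in their difference; the second decay
    makes it integrable against ball averages.

    The hypothesis m >= 4 enters through alpha: each term max(1/p_i, 1/2) is at least 1/2, so alpha
    > m/2 - 1 >= 1, and alpha > 1 is what the inversion formula for g rests on.

    Uniformity in r is free: r acts as the dilation [pi * r] of the Gaussians, and the bound on ball
    averages holds at every radius. The closed forms of complex Gaussian integrals come from
    first-order linear equations in a real parameter, not from contour shifts. *)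

Definition expi (R : realType) (t : R) : R[i] := (cos t +i* sin t)%C.

(** * Complex-valued integrals *)

Section complex_basics.
Context {R : realType}.
Implicit Types (z w : R[i]) (t : R).

Lemma complexReM z w : complex.Re (z * w) =
  complex.Re z * complex.Re w - complex.Im z * complex.Im w.
Proof. by case: z w => [a b] [c d]. Qed.

Lemma complexImM z w : complex.Im (z * w) =
  complex.Re z * complex.Im w + complex.Im z * complex.Re w.
Proof. by case: z w => [a b] [c d]. Qed.

Lemma complexP z w : complex.Re z = complex.Re w -> complex.Im z = complex.Im w ->
  z = w.
Proof. by case: z w => [a b] [c d] /= -> ->. Qed.

Lemma normc_sqr z : normc z ^+ 2 = complex.Re z ^+ 2 + complex.Im z ^+ 2.
Proof. by case: z => a b /=; rewrite sqr_sqrtr// addr_ge0// sqr_ge0. Qed.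

Lemma normc_ge0 z : 0 <= normc z.
Proof. by case: z => a b /=; rewrite sqrtr_ge0. Qed.

Lemma normr_Re_le z : `|complex.Re z| <= normc z.
Proof.
by case: z => a b /=; rewrite -sqrtr_sqr ler_sqrt ?lerDl ?addr_ge0 ?sqr_ge0.
Qed.

Lemma normr_Im_le z : `|complex.Im z| <= normc z.
Proof.
by case: z => a b /=; rewrite -sqrtr_sqr ler_sqrt ?lerDr ?addr_ge0 ?sqr_ge0.
Qed.

Lemma normc_real t : normc (t%:C)%C = `|t|.
Proof. by rewrite /= expr0n/= addr0 sqrtr_sqr. Qed.

Lemma normc_expi t : normc (expi t) = 1.
Proof. by rewrite /= cos2Dsin2 sqrtr1. Qed.

Lemma expiD t1 t2 : expi (t1 + t2) = expi t1 * expi t2.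
Proof. by apply: complexP; rewrite ?complexReM ?complexImM /= ?cosD ?sinD// addrC mulrC. Qed.

Lemma expi0 : expi (0 : R) = 1.
Proof. by rewrite /expi cos0 sin0. Qed.

Lemma expi_sum (I : Type) (s : seq I) (P : pred I) (F : I -> R) :
  expi (\sum_(i <- s | P i) F i) = \prod_(i <- s | P i) expi (F i).
Proof. exact: (big_morph _ expiD expi0). Qed.

Lemma normc_prod (I : Type) (s : seq I) (P : pred I) (F : I -> R[i]) :
  normc (\prod_(i <- s | P i) F i) = \prod_(i <- s | P i) normc (F i).
Proof. exact: (big_morph _ (@normcM R) (@normc1 R)). Qed.

End complex_basics.

Section complex_integral.
Context {R : realType} {d} {T : measurableType d}.
Implicit Types (F G : T -> R[i]) (g : T -> R).

Definition cmeasurable F :=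
  measurable_fun setT (@complex.Re R \o F) /\ measurable_fun setT (@complex.Im R \o F).

Lemma cmeasurable_real g : measurable_fun setT g -> cmeasurable (fun x => (g x)%:C%C).
Proof. by move=> mg; split => //=; exact: measurable_cst. Qed.

Lemma cmeasurable_expi g : measurable_fun setT g -> cmeasurable (fun x => expi (g x)).
Proof.
by move=> mg; split => /=;
  [apply: (measurableT_comp (f := @cos R))|
   apply: (measurableT_comp (f := @sin R))] => //;
  apply: continuous_measurable_fun; [exact: continuous_cos|exact: continuous_sin].
Qed.

Lemma cmeasurableM F G : cmeasurable F -> cmeasurable G ->
  cmeasurable (fun x => F x * G x).
Proof.
move=> [mF1 mF2] [mG1 mG2]; split.
- rewrite (_ : _ \o _ = fun x => (@complex.Re R \o F) x * (@complex.Re R \o G) x -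
    (@complex.Im R \o F) x * (@complex.Im R \o G) x).
    by apply: measurable_funB; exact: measurable_funM.
  by apply/funext => x /=; rewrite complexReM.
- rewrite (_ : _ \o _ = fun x => (@complex.Re R \o F) x * (@complex.Im R \o G) x +
    (@complex.Im R \o F) x * (@complex.Re R \o G) x).
    by apply: measurable_funD; exact: measurable_funM.
  by apply/funext => x /=; rewrite complexImM.
Qed.

Lemma cmeasurable_cst z : cmeasurable (fun=> z).
Proof. by split; exact: measurable_cst. Qed.

Lemma cmeasurable_prod (I : Type) (s : seq I) (F : I -> T -> R[i]) :
  (forall i, cmeasurable (F i)) -> cmeasurable (fun x => \prod_(i <- s) F i x).
Proof.
move=> mF; elim: s => [|i s IH].
  by under eq_fun do rewrite big_nil; exact: cmeasurable_cst.
by under eq_fun do rewrite big_cons; exact: cmeasurableM.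
Qed.

Lemma measurable_normc F : cmeasurable F -> measurable_fun setT (fun x => normc (F x)).
Proof.
move=> [mF1 mF2]; rewrite (_ : (fun x => normc (F x)) = fun x =>
  Num.sqrt ((@complex.Re R \o F) x ^+ 2 + (@complex.Im R \o F) x ^+ 2)).
  apply: (measurableT_comp (f := @Num.sqrt R)).
    by apply: continuous_measurable_fun; exact: sqrt_continuous.
  by apply: measurable_funD; exact: measurable_funX.
by apply/funext => x /=; case: (F x).
Qed.

Variable mu : {measure set T -> \bar R}.

Definition cintegrable F := mu.-integrable setT (EFin \o (@complex.Re R \o F)) /\
  mu.-integrable setT (EFin \o (@complex.Im R \o F)).

Lemma integrable_le_real g1 g2 : measurable_fun setT g1 ->
  mu.-integrable setT (EFin \o g2) -> (forall x, `|g1 x| <= g2 x) ->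
  mu.-integrable setT (EFin \o g1).
Proof.
move=> mg ig le12; apply: (le_integrable measurableT _ _ ig).
  exact/measurable_EFinP.
move=> x _ /=; rewrite lee_fin (le_trans (le12 x))// ler_norm//.
Qed.

Lemma cintegrable_le F g : cmeasurable F -> mu.-integrable setT (EFin \o g) ->
  (forall x, normc (F x) <= g x) -> cintegrable F.
Proof.
move=> [mF1 mF2] ig leF; split; apply: (integrable_le_real _ ig) => // x /=;
  [exact: le_trans (normr_Re_le _) _|exact: le_trans (normr_Im_le _) _].
Qed.

Lemma cintegralZl z F : cintegrable F ->
  cintegral mu (fun x => z * F x) = z * cintegral mu F.
Proof.
move=> [i1 i2]; apply: complexP; rewrite ?complexReM ?complexImM /=.
- under eq_Rintegral do rewrite complexReM.
  rewrite RintegralB//; [|exact: (integrableZl measurableT _ i1)|exact: (integrableZl measurableT _ i2)].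
  by rewrite !RintegralZl.
- under eq_Rintegral do rewrite complexImM.
  rewrite RintegralD//; [|exact: (integrableZl measurableT _ i2)|exact: (integrableZl measurableT _ i1)].
  by rewrite !RintegralZl.
Qed.

Lemma cintegralD F G : cintegrable F -> cintegrable G ->
  cintegral mu (fun x => F x + G x) = cintegral mu F + cintegral mu G.
Proof.
move=> [i1 i2] [j1 j2].
have E1 x : complex.Re (F x + G x) = complex.Re (F x) + complex.Re (G x).
  by case: (F x) (G x) => ? ? [].
have E2 x : complex.Im (F x + G x) = complex.Im (F x) + complex.Im (G x).
  by case: (F x) (G x) => ? ? [].
rewrite /cintegral; under eq_Rintegral do rewrite E1.
under [X in (_ +i* X)%C]eq_Rintegral do rewrite E2.
by rewrite !RintegralD.
Qed.

Lemma eq_cintegral F G : F =1 G -> cintegral mu F = cintegral mu G.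
Proof. by move=> /funext ->. Qed.

(** With w the value of the integral, |w|^2 is the real part of the integral of conj(w) F, whose
    integrand is at most |w| g in modulus; so no constant is lost by working componentwise. *)
Lemma normc_cintegral_le F g : cmeasurable F -> mu.-integrable setT (EFin \o g) ->
  (forall x, normc (F x) <= g x) ->
  normc (cintegral mu F) <= \int[mu]_x g x.
Proof.
move=> mF ig leF; have iF := cintegrable_le mF ig leF.
set w := cintegral mu F.
have ige0 : 0 <= \int[mu]_x g x.
  by apply: Rintegral_ge0 => x _; exact: le_trans (normc_ge0 _) (leF x).
have [->|w0] := eqVneq (normc w) 0; first by [].
have nw : 0 < normc w by rewrite lt_neqAle eq_sym w0 normc_ge0.
rewrite -(ler_pM2l nw).
pose z : R[i] := (complex.Re w -i* complex.Im w)%C.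
have -> : normc w * normc w = complex.Re (z * w).
  by rewrite -expr2 normc_sqr complexReM /z /= mulNr opprK !expr2.
rewrite -cintegralZl//= -RintegralZl//.
apply: le_Rintegral => //.
- have iz : cintegrable (fun x => z * F x).
    apply: (@cintegrable_le _ (fun x => normc z * g x)).
    + exact: cmeasurableM (cmeasurable_cst _) mF.
    + exact: (integrableZl measurableT _ ig).
    + by move=> x; rewrite normcM ler_wpM2l// normc_ge0.
  by case: iz.
- exact: (integrableZl measurableT _ ig).
- move=> x _; apply: le_trans (ler_norm _) _; apply: le_trans (normr_Re_le _) _.
  rewrite normcM (_ : normc z = normc w); first by rewrite ler_wpM2l ?normc_ge0.
  by rewrite /z; case: (w) => a b /=; rewrite sqrrN.
Qed.

End complex_integral.

(** * Fubini's theorem under a product majorant *)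

Section dominated_fubini.
Context {R : realType} {d1 d2} {T1 : measurableType d1} {T2 : measurableType d2}.
Variables (m1 : {sigma_finite_measure set T1 -> \bar R})
          (m2 : {sigma_finite_measure set T2 -> \bar R}).
Variables (g : T1 -> R) (h : T2 -> R).
Hypotheses (ig : m1.-integrable setT (EFin \o g))
  (ih : m2.-integrable setT (EFin \o h)).
Hypotheses (g0 : forall x, 0 <= g x) (h0 : forall y, 0 <= h y).

Let integrable_fin_abs d (T : measurableType d) (m : {measure set T -> \bar R}) (k : T -> R) :
  m.-integrable setT (EFin \o k) -> (forall x, 0 <= k x) ->
  exists2 I : R, 0 <= I & (\int[m]_x (k x)%:E = I%:E)%E.
Proof.
move=> ik k0; exists (\int[m]_x k x); first exact: Rintegral_ge0.
by rewrite /Rintegral fineK//; exact: integrable_fin_num ik.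
Qed.

Lemma integrable_prod_dominated (F : T1 * T2 -> R) : measurable_fun setT F ->
  (forall x y, `|F (x, y)| <= g x * h y) ->
  (m1 \x m2)%E.-integrable setT (EFin \o F).
Proof.
move=> mF leF; apply/integrable12ltyP; first exact/measurable_EFinP.
have [I I0 IE] := integrable_fin_abs ig g0.
have [J J0 JE] := integrable_fin_abs ih h0.
apply: (@le_lt_trans _ _ (\int[m1]_x (g x * J)%:E)%E).
  apply: ge0_le_integral => //.
  - by move=> x _; apply: integral_ge0.
  - apply: (@measurable_fun_fubini_tonelli_F _ _ _ _ _ m2 (fun p => `|(EFin \o F) p|%E)) => //.
    by apply: measurableT_comp => //; exact/measurable_EFinP.
  - by apply/measurable_EFinP/measurable_funM => //; apply/measurable_EFinP; case/integrableP: ig.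
  - move=> x _; apply: (@le_trans _ _ (\int[m2]_y (g x * h y)%:E)%E).
      apply: ge0_le_integral => //.
      + apply/measurable_EFinP/measurableT_comp => //.
        exact: measurableT_comp mF (pair1_measurable x).
      + by apply/measurable_EFinP/measurable_funM => //; apply/measurable_EFinP; case/integrableP: ih.
      + by move=> y _; rewrite lee_fin.
    under eq_integral do rewrite EFinM.
    rewrite ge0_integralZl ?lee_fin//; [|by case/integrableP: ih|].
    - by rewrite JE -EFinM.
    - by move=> y _; rewrite lee_fin.
under eq_integral do rewrite EFinM.
rewrite ge0_integralZr ?lee_fin//; [|by case/integrableP: ig|].
- by rewrite IE -EFinM ltry.
- by move=> x _; rewrite lee_fin.
Qed.

Lemma Rfubini_dominated (F : T1 * T2 -> R) : measurable_fun setT F ->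
  (forall x y, `|F (x, y)| <= g x * h y) ->
  \int[m1]_x (\int[m2]_y F (x, y)) = \int[m2]_y (\int[m1]_x F (x, y)).
Proof.
move=> mF leF; have iF := integrable_prod_dominated mF leF.
rewrite /Rintegral; congr fine.
have E1 x : (fine (\int[m2]_y (F (x, y))%:E))%:E = (\int[m2]_y (F (x, y))%:E)%E.
  rewrite fineK//; apply: integrable_fin_num => //.
  apply: (@integrable_le_real _ _ _ _ _ (fun y => g x * h y)) => //.
  - exact: measurableT_comp mF (pair1_measurable x).
  - exact: (integrableZl measurableT _ ih).
have E2 y : (fine (\int[m1]_x (F (x, y))%:E))%:E = (\int[m1]_x (F (x, y))%:E)%E.
  rewrite fineK//; apply: integrable_fin_num => //.
  apply: (@integrable_le_real _ _ _ _ _ (fun x => g x * h y)) => //.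
  - exact: measurableT_comp mF (pair2_measurable y).
  - exact: (integrableZr measurableT _ ig).
under eq_integral do rewrite E1.
under [RHS]eq_integral do rewrite E2.
exact: (@Fubini _ _ _ _ _ m1 m2 (EFin \o F)).
Qed.

Lemma cfubini_dominated (F : T1 * T2 -> R[i]) : cmeasurable F ->
  (forall x y, normc (F (x, y)) <= g x * h y) ->
  cintegral m1 (fun x => cintegral m2 (fun y => F (x, y))) =
  cintegral m2 (fun y => cintegral m1 (fun x => F (x, y))).
Proof.
move=> [mF1 mF2] leF; rewrite /cintegral /=; apply: complexP => /=.
- apply: (Rfubini_dominated mF1) => x y.
  by rewrite (le_trans (normr_Re_le _)).
- apply: (Rfubini_dominated mF2) => x y.
  by rewrite (le_trans (normr_Im_le _)).
Qed.

Lemma measurable_Rintegral_dominated (F : T1 * T2 -> R) : measurable_fun setT F ->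
  (forall x y, `|F (x, y)| <= g x * h y) ->
  measurable_fun setT (fun x => \int[m2]_y F (x, y)).
Proof.
move=> mF leF; have iF := integrable_prod_dominated mF leF.
have := measurable_fubini_F iF => mm.
by apply: measurableT_comp mm => //; exact: measurable_fine.
Qed.

Lemma cmeasurable_cintegral_dominated (F : T1 * T2 -> R[i]) : cmeasurable F ->
  (forall x y, normc (F (x, y)) <= g x * h y) ->
  cmeasurable (fun x => cintegral m2 (fun y => F (x, y))).
Proof.
move=> [mF1 mF2] leF; split => /=.
- apply: (measurable_Rintegral_dominated mF1) => x y.
  by rewrite (le_trans (normr_Re_le _)).
- apply: (measurable_Rintegral_dominated mF2) => x y.
  by rewrite (le_trans (normr_Im_le _)).
Qed.

End dominated_fubini.

(** * Integrals of products over R^n *)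

Section tuple_integral.
Context {R : realType}.
Local Notation mR := (measurableTypeR R).
Local Notation mu := (@lebesgue_measure R).

Lemma Rintegral_prod_dominated d1 d2 (T1 : measurableType d1)
    (T2 : measurableType d2) (m1 : {sigma_finite_measure set T1 -> \bar R})
    (m2 : {sigma_finite_measure set T2 -> \bar R}) (g : T1 -> R) (h : T2 -> R)
    (F : T1 * T2 -> R) :
  m1.-integrable setT (EFin \o g) -> m2.-integrable setT (EFin \o h) ->
  (forall x, 0 <= g x) -> (forall y, 0 <= h y) -> measurable_fun setT F ->
  (forall x y, `|F (x, y)| <= g x * h y) ->
  \int[(m1 \x m2)%E]_p F p = \int[m1]_x \int[m2]_y F (x, y).
Proof.
move=> ig ih g0 h0 mF leF.
have iF := integrable_prod_dominated ig ih g0 h0 mF leF.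
rewrite /Rintegral -(integral12_prod_meas1 iF); congr fine.
apply: eq_integral => x _; rewrite /fubini_F fineK//; apply: integrable_fin_num => //.
apply: (@integrable_le_real _ _ _ _ _ (fun y => g x * h y)) => //.
- exact: measurableT_comp mF (pair1_measurable x).
- exact: (integrableZl measurableT _ ih).
Qed.

Lemma measurable_tuple_prod n (g : 'I_n -> R -> R) :
  (forall i, measurable_fun setT (g i : mR -> R)) ->
  measurable_fun setT (fun v : n.-tuple mR => \prod_i g i (tnth v i)).
Proof.
move=> mg.
rewrite (_ : (fun v => _) = fun v : n.-tuple mR => \prod_(i <- index_enum 'I_n) g i (tnth v i))//.
elim: (index_enum _) => [|i s IH].
  by under eq_fun do rewrite big_nil; exact: measurable_cst.
under eq_fun do rewrite big_cons.
apply: measurable_funM => //.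
exact: measurableT_comp (mg i) (measurable_tnth i).
Qed.

Lemma integrable_tuple_prod n (g : 'I_n -> R -> R) :
  (forall i, mu.-integrable setT (EFin \o g i)) -> (forall i x, 0 <= g i x) ->
  (lebesgue_tuple R n).-integrable setT
    (EFin \o (fun v : n.-tuple mR => \prod_i g i (tnth v i))).
Proof.
elim: n g => [|n IH] g ig g0.
  under eq_fun do rewrite big_ord0.
  apply/integrableP; split; first exact: measurable_cst.
  by rewrite /= integral_dirac//= diracT mul1e normr1 ltry.
have mg i : measurable_fun setT (g i : mR -> R).
  by apply/measurable_EFinP; case/integrableP: (ig i).
apply: (integrable_pushforward (@measurable_tuple_cons R n)) => //.
  by apply/measurable_EFinP; exact: measurable_tuple_prod.
rewrite preimage_setT (_ : _ \o _ = EFin \o (fun p : mR * n.-tuple mR =>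
    g ord0 p.1 * \prod_i g (lift ord0 i) (tnth p.2 i))); last first.
  apply/funext => -[x v] /=; rewrite big_ord_recl /tuple_cons/= tnth0.
  by congr (_ * _)%:E; apply: eq_bigr => i _; rewrite (tnthS x v).
have mP := @measurable_tuple_prod n (fun i => g (lift ord0 i)) (fun i => mg _).
apply: (@integrable_prod_dominated _ _ _ _ _ mu (lebesgue_tuple R n) (g ord0)
  (fun v => \prod_i g (lift ord0 i) (tnth v i))) => //.
- by apply: (IH (fun i => g (lift ord0 i))) => i *; [exact: ig|exact: g0].
- by move=> v; exact: prodr_ge0.
- apply: measurable_funM; first exact: measurableT_comp (mg _) measurable_fst.
  exact: measurableT_comp mP measurable_snd.
- by move=> x v /=; rewrite ger0_norm// mulr_ge0// prodr_ge0.
Qed.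

Lemma cmeasurable_tuple_prod n (F : 'I_n -> R -> R[i]) :
  (forall i, cmeasurable (F i : mR -> R[i])) ->
  cmeasurable (fun v : n.-tuple mR => \prod_i F i (tnth v i)).
Proof.
move=> mF; apply: (@cmeasurable_prod R _ _ _ _ (fun i v => F i (tnth v i))) => i.
case: (mF i) => m1 m2; split; [exact: (measurableT_comp m1 (measurable_tnth i))|
  exact: (measurableT_comp m2 (measurable_tnth i))].
Qed.

Lemma cintegral_tuple_prod n (F : 'I_n -> R -> R[i]) (g : 'I_n -> R -> R) :
  (forall i, mu.-integrable setT (EFin \o g i)) ->
  (forall i, cmeasurable (F i : mR -> R[i])) ->
  (forall i x, normc (F i x) <= g i x) ->
  cintegral (lebesgue_tuple R n) (fun v : n.-tuple mR => \prod_i F i (tnth v i)) =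
  \prod_i cintegral mu (F i).
Proof.
elim: n F g => [|n IH] F g ig mF leF.
  under eq_cintegral do rewrite big_ord0.
  rewrite big_ord0 /cintegral /Rintegral /= !integral_dirac//=.
  by rewrite indicT mul1r mulr0.
have mg i : measurable_fun setT (g i : mR -> R).
  by apply/measurable_EFinP; case/integrableP: (ig i).
have g0 i x : 0 <= g i x by apply: le_trans (normc_ge0 _) (leF i x).
pose F1 (v : n.-tuple mR) := \prod_i F (lift ord0 i) (tnth v i).
pose g1 (v : n.-tuple mR) := \prod_i g (lift ord0 i) (tnth v i).
have ig1 : (lebesgue_tuple R n).-integrable setT (EFin \o g1).
  exact: (@integrable_tuple_prod n (fun i => g (lift ord0 i))).
have mF1 : cmeasurable F1.
  exact: (@cmeasurable_tuple_prod n (fun i => F (lift ord0 i))).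
have leF1 v : normc (F1 v) <= g1 v.
  by rewrite normc_prod; apply: ler_prod => i _; rewrite leF normc_ge0.
have g10 v : 0 <= g1 v by exact: prodr_ge0.
pose H (p : mR * n.-tuple mR) := F ord0 p.1 * F1 p.2.
have mH : cmeasurable H.
  apply: cmeasurableM.
  - by case: (mF ord0) => m1 m2; split; [exact: (measurableT_comp m1 measurable_fst)|
      exact: (measurableT_comp m2 measurable_fst)].
  - by case: mF1 => m1 m2; split; [exact: (measurableT_comp m1 measurable_snd)|
      exact: (measurableT_comp m2 measurable_snd)].
have leH x v : normc (H (x, v)) <= g ord0 x * g1 v.
  by rewrite normcM ler_pM ?normc_ge0.
have HE p : \prod_i F i (tnth (tuple_cons p) i) = H p.
  case: p => x v; rewrite big_ord_recl /tuple_cons/= tnth0.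
  by congr (_ * _); apply: eq_bigr => i _; rewrite (tnthS x v).
have mFn := cmeasurable_tuple_prod mF.
(* [P] stands for the real or the imaginary part; the first coordinate is split off along the
   recursive definition of the measure. *)
have step (P : R[i] -> R) :
    measurable_fun setT (P \o (fun v : n.+1.-tuple mR => \prod_i F i (tnth v i))) ->
    measurable_fun setT (P \o H) -> (forall z, `|P z| <= normc z) ->
    \int[lebesgue_tuple R n.+1]_v P (\prod_i F i (tnth v i)) =
    \int[mu]_x \int[lebesgue_tuple R n]_v P (H (x, v)).
  move=> mPF mPH Ple.
  have leP x v : `|(P \o H) (x, v)| <= g ord0 x * g1 v.
    exact: le_trans (Ple _) (leH _ _).
  rewrite -(@Rintegral_prod_dominated _ _ _ _ mu (lebesgue_tuple R n) (g ord0) g1 (P \o H))//.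
  rewrite /Rintegral; congr fine.
  have iPH := @integrable_prod_dominated _ _ _ _ _ mu (lebesgue_tuple R n) (g ord0) g1
    (ig _) ig1 (g0 _) g10 (P \o H) mPH leP.
  have PHE : (EFin \o (fun v : n.+1.-tuple mR => P (\prod_i F i (tnth v i)))) \o
      @tuple_cons R n = EFin \o (P \o H).
    by apply/funext => p /=; rewrite HE.
  have := @integral_pushforward _ _ _ _ _ _ (@measurable_tuple_cons R n)
    (mu \x lebesgue_tuple R n)%E setT
    (EFin \o (fun v : n.+1.-tuple mR => P (\prod_i F i (tnth v i)))).
  rewrite preimage_setT PHE => -> //.
  exact/measurable_EFinP.
transitivity (cintegral mu (fun x => cintegral (lebesgue_tuple R n) (fun v => H (x, v)))).
  rewrite /cintegral; apply: complexP; case: mFn => ? ?; case: mH => ? ?.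
    exact: (step (@complex.Re R) _ _ (@normr_Re_le R)).
  exact: (step (@complex.Im R) _ _ (@normr_Im_le R)).
have iF1 := cintegrable_le mF1 ig1 leF1.
rewrite big_ord_recl -(IH _ (fun i => g (lift ord0 i)))//.
rewrite -/F1 mulrC -cintegralZl; last exact: cintegrable_le (mF _) (ig _) (leF _).
by apply: eq_cintegral => x; rewrite mulrC -cintegralZl.
Qed.

End tuple_integral.

(** * Powers and decaying weights *)

Section powR_bounds.
Context {R : realType}.
Implicit Types (x y k s : R).

Lemma gt0_powRD x k s : 0 < x -> x `^ (k + s) = x `^ k * x `^ s.
Proof. by move=> x0; rewrite powRD// (gt_eqF x0) implybT. Qed.

Lemma powR_homo x y s : 0 <= s -> 0 <= x -> x <= y -> x `^ s <= y `^ s.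
Proof.
by move=> s0 x0 xy; rewrite (ge0_ler_powR s0) ?nnegrE// (le_trans x0).
Qed.

Lemma gt0_powRN_anti x y s : 0 < x -> x <= y -> 0 <= s -> y `^ (- s) <= x `^ (- s).
Proof.
move=> x0 xy s0; have y0 := lt_le_trans x0 xy.
rewrite !powRN lef_pV2 ?posrE ?powR_gt0//.
by apply: powR_homo; rewrite // ltW.
Qed.

(** Raise x/k <= exp(x/k) to the power k. This trades exponential decay for any power of decay, at
    the price of a constant. *)
Lemma expRN_le_powR k x : 0 < k -> 0 < x -> expR (- x) <= k `^ k * x `^ (- k).
Proof.
move=> k0 x0.
have xk : (x / k) `^ k <= expR x.
  apply: (@le_trans _ _ (expR (x / k) `^ k)).
    apply: powR_homo; rewrite ?divr_ge0 ?ltW//.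
    by apply: lt_le_trans (expR_ge1Dx _); rewrite ltrDr.
  by rewrite /powR gt_eqF ?expR_gt0// expRK mulrC divfK// gt_eqF.
rewrite expRN powRN -[k `^ k]invrK -invfM lef_pV2 ?posrE ?expR_gt0//; last first.
  by rewrite mulr_gt0 ?invr_gt0 ?powR_gt0.
apply: le_trans xk; rewrite powRM ?invr_ge0 ?(ltW x0) ?(ltW k0)// mulrC ler_wpM2l ?powR_ge0//.
by rewrite -powRN -[k^-1]powR_inv1 ?(ltW k0)// -powRrM mulN1r.
Qed.

End powR_bounds.

Section measurable_inv.
Context {R : realType} {d} {T : measurableType d}.

Lemma measurable_fun_cos (f : T -> R) : measurable_fun setT f ->
  measurable_fun setT (fun x => cos (f x)).
Proof.
by apply: measurableT_comp; apply: continuous_measurable_fun; exact: continuous_cos.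
Qed.

Lemma measurable_fun_sin (f : T -> R) : measurable_fun setT f ->
  measurable_fun setT (fun x => sin (f x)).
Proof.
by apply: measurableT_comp; apply: continuous_measurable_fun; exact: continuous_sin.
Qed.

Lemma measurable_fun_expR (f : T -> R) : measurable_fun setT f ->
  measurable_fun setT (fun x => expR (f x)).
Proof. by move=> mf; exact: (measurableT_comp (@measurable_expR R) mf). Qed.

Lemma measurable_fun_powR (f : T -> R) (s : R) : measurable_fun setT f ->
  measurable_fun setT (fun x => f x `^ s).
Proof. by move=> mf; exact: (measurableT_comp (@measurable_powR R s) mf). Qed.

Lemma measurable_fun_normr (f : T -> R) : measurable_fun setT f ->
  measurable_fun setT (fun x => `|f x|).
Proof. by move=> mf; exact: (measurableT_comp (@normr_measurable R setT) mf). Qed.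

Lemma measurable_funN' (f : T -> R) : measurable_fun setT f ->
  measurable_fun setT (fun x => - f x).
Proof. exact: measurable_funN. Qed.

Lemma measurable_funV (f : T -> R) : measurable_fun setT f ->
  measurable_fun setT (fun x => (f x)^-1).
Proof.
move=> mf; rewrite (_ : (fun x => _) = fun x =>
  if 0 < f x then f x `^ (-1) else - ((- f x) `^ (-1))).
  apply: measurable_fun_ifT.
  - exact: measurable_fun_ltr.
  - exact: measurable_fun_powR.
  - by apply: measurable_funN'; apply: measurable_fun_powR; exact: measurable_funN'.
apply/funext => x; case: ltP => f0; first by rewrite powR_inv1// ltW.
by rewrite powR_inv1 ?oppr_ge0// invrN opprK.
Qed.

End measurable_inv.

Ltac meas := repeat first
  [ assumption | exact: measurable_id | exact: measurable_cst
  | exact: measurable_fst | exact: measurable_snd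
  | apply: measurable_fun_cos | apply: measurable_fun_sin
  | apply: measurable_fun_expR | apply: measurable_fun_powR
  | apply: measurable_fun_normr | apply: measurable_funV
  | apply: measurable_funX | apply: measurable_funM
  | apply: measurable_funN' | apply: measurable_funD ].

Section decay_weights.
Context {R : realType}.
Local Notation mR := (measurableTypeR R).
Local Notation mu := (@lebesgue_measure R).

Lemma dyadic_scale (z : R) : 0 <= z ->
  exists k : nat, z < 2 ^+ k /\ 2 ^+ k <= 2 * (1 + z).
Proof.
move=> z0; have ex : exists k : nat, z < 2 ^+ k.
  exists (Num.bound z); apply: lt_trans (archi_boundP z0) _.
  rewrite -natrX ltr_nat; exact: ltn_expl.
(* Minimality of [k] gives 2^(k-1) <= z when k > 0; for k = 0 the second bound reads 1 <= 2 (1 +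
   z). *)
case: (ex_minnP ex) => k zk kmin; exists k; split => //.
case: k zk kmin => [|k] zk kmin; first by rewrite expr0; lra.
have : ~~ (z < 2 ^+ k) by apply/negP => /kmin; rewrite ltnn.
by rewrite -leNgt exprS => ?; lra.
Qed.

(** Dyadic balls B_k of radius L 2^k around x: on the first one containing y the weight is at most c
    2^(-k(1+e)), where c = 2^(1+e) pays for the factor 2 of [dyadic_scale]. The ball bound
    contributes 2 L 2^k A, and the geometric series of ratio q = 2^(-e) remains. This is how bounds
    on balls of all radii become weighted integrals over the line. *)
Lemma ball_weight_le (e : R) : 0 < e -> exists2 C : R, 0 < C &
  forall (g : R -> R) (x A : R), measurable_fun setT (g : mR -> R) ->
  (forall y, 0 <= g y) -> 0 <= A ->
  (forall rho, 0 < rho -> (\int[mu]_(y in ball x rho) (g y)%:E <= (2 * rho * A)%:E)%E) ->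
  forall L, 0 < L ->
  (\int[mu]_y (g y * (1 + `|x - y| / L) `^ (- (1 + e)))%:E <= (C * L * A)%:E)%E.
Proof.
move=> e0; pose q : R := 2 `^ (- e).
have q0 : 0 < q by rewrite powR_gt0.
have q1 : q < 1.
  by rewrite /q /powR pnatr_eq0/= expR_lt1 mulNr oppr_lt0 mulr_gt0// ln_gt0// ltr1n.
pose c : R := 2 `^ (1 + e).
have c0 : 0 < c by rewrite powR_gt0.
exists (2 * c / (1 - q)); first by rewrite divr_gt0 ?mulr_gt0// subr_gt0.
move=> g x A mg g0 A0 ballA L L0.
pose B k := ball x (L * 2 ^+ k) : set R.
have mB k : measurable (B k) by exact: measurable_ball.
pose u k y : R := c * (2 ^+ k) `^ (- (1 + e)) * (g y * \1_(B k) y).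
have u0 k y : 0 <= u k y by rewrite !mulr_ge0// ?powR_ge0// ltW.
have mu_ k : measurable_fun setT (u k : mR -> R).
  apply: measurable_funM; first exact: measurable_cst.
  by apply: measurable_funM => //; exact: (@measurable_indic _ mR R setT (B k) (mB k)).
apply: (@le_trans _ _ (\int[mu]_y (\big[+%E/0%E]_(0 <= k <oo) (u k y)%:E))%E).
  apply: ge0_le_integral => //.
  - by move=> y _; rewrite lee_fin mulr_ge0// powR_ge0.
  - apply/measurable_EFinP; meas.
  - apply: ge0_emeasurable_sum => [k y _ _|k _]; first by rewrite lee_fin.
    exact/measurable_EFinP.
  - move=> y _; have z0 : 0 <= `|x - y| / L by rewrite divr_ge0// ltW.
    have [k [zk kz]] := dyadic_scale z0.
    apply: le_trans (nneseries_lim_ge k.+1 _); last by move=> n _ _; rewrite lee_fin.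
    rewrite big_nat_recr//= -[leLHS]add0e; apply: leeD.
      by apply: sume_ge0 => i _; rewrite lee_fin.
    rewrite lee_fin /u indicE mem_set ?mulr1; last first.
      by rewrite /B /ball/= -ltr_pdivrMl// mulrC.
    rewrite mulrC ler_wpM2r//.
    apply: le_trans (_ : (2 ^+ k / 2) `^ (- (1 + e)) <= _).
      apply: gt0_powRN_anti; rewrite ?divr_gt0 ?exprn_gt0//; last by lra.
      by rewrite ler_pdivrMr//; lra.
    rewrite powRM ?exprn_ge0// mulrC ler_wpM2r ?powR_ge0//.
    by rewrite /c -[2^-1]powR_inv1// -powRrM mulN1r opprK.
rewrite integral_nneseries//; last 2 first.
- by move=> k; exact/measurable_EFinP.
- by move=> k y _; rewrite lee_fin.
apply: (@le_trans _ _ (\big[+%E/0%E]_(0 <= k <oo) (2 * c * L * A * q ^+ k)%:E)%E).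
  apply: lee_nneseries => [k _ _|k _]; first by apply: integral_ge0 => y _; rewrite lee_fin.
  under eq_integral do rewrite EFinM.
  rewrite ge0_integralZl//; last 3 first.
  - by apply/measurable_EFinP/measurable_funM => //; exact: (@measurable_indic _ mR R setT (B k) (mB k)).
  - by move=> y _; rewrite lee_fin mulr_ge0.
  - by rewrite lee_fin mulr_ge0 ?powR_ge0// ltW.
  have -> : (\int[mu]_y (g y * \1_(B k) y)%:E = \int[mu]_(y in B k) (g y)%:E)%E.
    rewrite [RHS]integral_mkcond; apply: eq_integral => y _.
    by rewrite patchE indicE; case: ifPn => _; rewrite ?mulr1// mulr0.
  apply: (@le_trans _ _ ((c * (2 ^+ k) `^ (- (1 + e)))%:E * (2 * (L * 2 ^+ k) * A)%:E)%E).
    apply: lee_wpmul2l; first by rewrite lee_fin mulr_ge0 ?powR_ge0// ltW.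
    by apply: ballA; rewrite mulr_gt0// exprn_gt0.
  rewrite -EFinM lee_fin.
  have -> : (2 ^+ k : R) `^ (- (1 + e)) = q ^+ k / 2 ^+ k.
    rewrite opprD addrC gt0_powRD ?exprn_gt0// powR_inv1 ?exprn_ge0//; congr (_ * _).
    by rewrite -(powR_mulrn k (powR_ge0 2 (- e))) -[2 ^+ k](powR_mulrn k (ler0n R 2)) -!powRrM mulrC.
  rewrite le_eqVlt; apply/orP; left; apply/eqP; field.
  by rewrite expf_neq0.
apply: lime_le.
  by apply: is_cvg_nneseries => k _ _; rewrite lee_fin !mulr_ge0 ?exprn_ge0// ltW.
apply: nearW => n; rewrite sumEFin lee_fin.
have := @geometric_le_lim R n (2 * c * L * A) q.
rewrite /series/= => /(_ _ q0); rewrite ger0_norm ?(ltW q0)// => /(_ _ q1) h.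
apply: le_trans (h _) _; first by rewrite !mulr_ge0// ltW.
by rewrite le_eqVlt; apply/orP; left; apply/eqP; field; rewrite subr_eq0 gt_eqF.
Qed.

End decay_weights.

(** * Integrable decay and vanishing boundary terms *)

Section decay_integrable.
Context {R : realType}.
Local Notation mR := (measurableTypeR R).
Local Notation mu := (@lebesgue_measure R).

(** The case g = 1 of [ball_weight_le]: a ball of radius rho has measure 2 rho, so A = 1. *)
Lemma integrable_decay (e : R) : 0 < e ->
  mu.-integrable setT (EFin \o (fun z : R => (1 + `|z|) `^ (- (1 + e)))).
Proof.
move=> e0; have [C C0 HC] := ball_weight_le e0.
have m1 : measurable_fun setT (fun z : mR => (1 + `|z|) `^ (- (1 + e))) by meas.
apply/integrableP; split; first exact/measurable_EFinP.
apply: (@le_lt_trans _ _ (C * 1 * 1)%:E); last exact: ltry.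
apply: le_trans (HC (cst 1) 0 1 _ _ _ _ 1 ltr01) => //.
- rewrite le_eqVlt; apply/orP; left; apply/eqP/eq_integral => z _ /=.
  by rewrite ger0_norm ?powR_ge0// mul1r add0r normrN divr1.
- move=> rho rho0; rewrite [leLHS](_ : _ = (\int[mu]_(y in ball 0%R rho) (cst 1%:E y)))%E//.
  rewrite integral_cst; last exact: measurable_ball.
  have mb : mu (ball (0 : R) rho) = (rho *+ 2)%:E := lebesgue_measure_ball _ (ltW rho0).
  by rewrite mul1e [leLHS]mb mulr1 mulr2n mulrDl !mul1r.
Qed.

Lemma integrable_decay_bound (f : R -> R) (M e : R) : 0 < e ->
  measurable_fun setT (f : mR -> R) ->
  (forall z, `|f z| <= M * (1 + `|z|) `^ (- (1 + e))) ->
  mu.-integrable setT (EFin \o f).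
Proof.
move=> e0 mf fM; have iM : mu.-integrable setT (EFin \o (fun z => M * (1 + `|z|) `^ (- (1 + e)))).
  exact: (integrableZl measurableT M (integrable_decay e0)).
exact: (integrable_le_real mf iM fM).
Qed.

Lemma sqr_decay_le (c z : R) : 0 <= c ->
  (1 + z ^+ 2) `^ (- c) <= 2 `^ c * (1 + `|z|) `^ (- (2 * c)).
Proof.
move=> c0.
have h : (1 + `|z|) ^+ 2 / 2 <= 1 + z ^+ 2.
  by rewrite -[z ^+ 2]real_normK ?num_real//; have := sqr_ge0 (`|z| - 1); nra.
have p : 0 < 1 + `|z| by rewrite ltr_pwDl.
apply: le_trans (gt0_powRN_anti _ h c0) _; first by rewrite divr_gt0 ?exprn_gt0.
rewrite powRM ?exprn_ge0 ?(ltW p)// mulrC -[2^-1]powR_inv1// -powRrM mulN1r opprK.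
by rewrite ler_wpM2l ?powR_ge0// -powR_mulrn ?(ltW p)// -powRrM mulrN.
Qed.

Lemma integrable_sqr_decay (c : R) : 1 / 2 < c ->
  mu.-integrable setT (EFin \o (fun z : R => (1 + z ^+ 2) `^ (- c))).
Proof.
move=> c2; apply: (@integrable_decay_bound _ (2 `^ c) (2 * c - 1)); first by lra.
- by meas.
- move=> z; rewrite ger0_norm ?powR_ge0//.
  rewrite (_ : 1 + (2 * c - 1) = 2 * c); last by lra.
  by apply: sqr_decay_le; lra.
Qed.

Lemma cvg_powR_decay (k : R) : 0 < k ->
  (1 + n%:R) `^ (- k) @[n --> \oo] --> (0 : R).
Proof.
move=> k0; apply/cvgrPdist_lt => /= eps eps0; near=> n.
rewrite sub0r normrN ger0_norm ?powR_ge0//.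
have n0 : (0 : R) < 1 + n%:R by rewrite ltr_pwDl.
have : eps `^ (- k^-1) < 1 + n%:R.
  apply: lt_trans (_ : n%:R < _); last by rewrite ltrDr.
  by near: n; exact: nbhs_infty_gtr.
move=> h.
have : (eps `^ (- k^-1)) `^ k < (1 + n%:R) `^ k.
  by apply: gt0_ltr_powR; rewrite ?nnegrE ?powR_ge0 ?(ltW n0).
rewrite -powRrM mulNr mulVf ?gt_eqF// => h1.
rewrite powRN invf_plt ?posrE ?powR_gt0//.
by rewrite -powR_inv1// ltW.
Unshelve. all: by end_near. Qed.

(** The fundamental theorem on [-(1+n), 1+n], dominated convergence, and boundary terms that tend to
    0. Every integration by parts below exhibits a primitive [h] and applies this. *)
Lemma Rintegral_derive_eq0 (h h' : R -> R) (M k : R) : 0 < k ->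
  (forall x : R, is_derive x 1 h (h' x)) -> continuous h' ->
  mu.-integrable setT (EFin \o h') ->
  (forall x, `|h x| <= M * (1 + `|x|) `^ (- k)) ->
  \int[mu]_x h' x = 0.
Proof.
move=> k0 dh ch' ih' hM.
have mh' : measurable_fun setT (h' : mR -> R) by exact: continuous_measurable_fun.
pose I n := `[- (1 + n%:R), 1 + n%:R]%classic : set R.
pose f n : R -> \bar R := (EFin \o h') \_ (I n).
have mI n : measurable (I n : set mR) by exact: measurable_itv.
have mf n : measurable_fun setT (f n : mR -> \bar R).
  apply/(measurable_restrictT _ _).1 => //; apply: measurable_funTS.
  exact/measurable_EFinP.
have mh : measurable_fun setT (EFin \o h' : mR -> \bar R) by exact/measurable_EFinP.
have fcvg : \forall x \ae mu, setT x -> f n x @[n --> \oo] --> (EFin \o h') x.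
  apply: aeW => x _; apply: cvg_near_cst; near=> n.
  rewrite /f patchE mem_set// /I/= in_itv/= -ler_norml.
  apply: ltW; apply: lt_trans (_ : n%:R < _); last by rewrite ltrDr.
  by near: n; exact: nbhs_infty_gtr.
have fle : \forall x \ae mu, forall n, setT x -> (`|f n x| <= `|(EFin \o h') x|)%E.
  apply: aeW => x n _; rewrite /f patchE; case: ifPn => // _.
  by rewrite abse0.
have [_ _ cv] := dominated_convergence measurableT mf mh fcvg
  (integrable_abse ih') fle.
pose r n := h (1 + n%:R) - h (- (1 + n%:R)).
have E n : (\int[mu]_x f n x)%E = (r n)%:E.
  have ab : - (1 + n%:R) < 1 + n%:R :> R.
    by rewrite gtrN// ltr_pwDl.
  rewrite /f -integral_mkcond (@continuous_FTC2 R h' h)//.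
  - exact: continuous_subspaceT.
  - have ch : continuous h.
      by move=> x; apply/differentiable_continuous/derivable1_diffP; case: (dh x).
    split; [by move=> x _; case: (dh x)| |].
    + by apply: cvg_at_right_filter; exact: ch.
    + by apply: cvg_at_left_filter; exact: ch.
  - by move=> x _; rewrite derive1E; case: (dh x).
have rle n : `|r n| <= `|M| * 2 * (1 + n%:R) `^ (- k).
  have n0 : (0 : R) <= 1 + n%:R by rewrite addr_ge0.
  have Mb x : M * x `^ (- k) <= `|M| * x `^ (- k).
    by rewrite ler_wpM2r ?powR_ge0// ler_norm.
  have h1 := hM (1 + n%:R); have h2 := hM (- (1 + n%:R)).
  have := ler_normB (h (1 + n%:R)) (h (- (1 + n%:R))).
  have p0 : (1 : R) <= 1 + (1 + n%:R) by rewrite lerDl.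
  have := @gt0_powRN_anti R (1 + n%:R) (1 + (1 + n%:R)) k.
  rewrite (ger0_norm n0) in h1; rewrite normrN (ger0_norm n0) in h2.
  have := Mb (1 + (1 + n%:R)).
  have : 0 <= `|M| by [].
  rewrite -/(r n); set p := (1 + (1 + n%:R)) `^ (- k) in h1 h2 *; set q := (1 + n%:R) `^ (- k).
  move=> M0 hp hq hr; have pq : p <= q by apply: hq; rewrite ?ltr_pwDl ?lerDr// ltW.
  have := ler_wpM2l M0 pq; lra.
have r0 : r n @[n --> \oo] --> (0 : R).
  have K0 : (`|M| * 2 * (1 + n%:R) `^ (- k)) @[n --> \oo] --> (`|M| * 2 * 0).
    by apply: cvgMr; exact: cvg_powR_decay.
  rewrite mulr0 in K0.
  apply: (squeeze_cvgr _ _ K0); last by rewrite -[X in _ --> X]oppr0; exact: cvgN K0.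
  by apply: nearW => n; rewrite -ler_norml.
have cv2 : (fun n => \int[mu]_x f n x)%E @ \oo --> (0%:E).
  rewrite (_ : (fun n => _) = EFin \o r); last by apply/funext.
  by apply: cvg_EFin => //; exact: nearW.
by rewrite /Rintegral (cvg_unique _ cv cv2).
Unshelve. all: by end_near. Qed.

End decay_integrable.

(** * Oscillatory integrals and Gaussians *)

Section derivation_rules.
Context {R : realType}.
Implicit Types (f g : R -> R) (x : R).

Lemma dfun_cst (c x : R) : is_derive x 1 (fun=> c : R) 0.
Proof. exact: is_derive_cst. Qed.

Lemma dfun_id x : is_derive x 1 (fun y : R => y) 1.
Proof. exact: is_derive_id. Qed.

Lemma dfunD f g x a b : is_derive x 1 f a -> is_derive x 1 g b ->
  is_derive x 1 (fun y => f y + g y) (a + b).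
Proof. by move=> *; exact: is_deriveD. Qed.

Lemma dfunN f x a : is_derive x 1 f a -> is_derive x 1 (fun y => - f y) (- a).
Proof. by move=> *; exact: is_deriveN. Qed.

Lemma dfunM f g x a b : is_derive x 1 f a -> is_derive x 1 g b ->
  is_derive x 1 (fun y => f y * g y) (a * g x + f x * b).
Proof.
by move=> ? ?; apply: (is_derive_eq (is_deriveM _ _)); rewrite addrC mulrC.
Qed.

Lemma dfun_comp f g x a b : is_derive (g x) 1 f a -> is_derive x 1 g b ->
  is_derive x 1 (fun y => f (g y)) (a * b).
Proof. by move=> ? ?; exact: (@is_derive1_comp R f g). Qed.

Lemma dfun_expR f x a : is_derive x 1 f a ->
  is_derive x 1 (fun y => expR (f y)) (expR (f x) * a).
Proof. by apply: dfun_comp; exact: is_derive_expR. Qed.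

Lemma dfun_cos f x a : is_derive x 1 f a ->
  is_derive x 1 (fun y => cos (f y)) (- sin (f x) * a).
Proof. by apply: dfun_comp; exact: is_derive_cos. Qed.

Lemma dfun_sin f x a : is_derive x 1 f a ->
  is_derive x 1 (fun y => sin (f y)) (cos (f x) * a).
Proof. by apply: dfun_comp; exact: is_derive_sin. Qed.

Lemma dfun_powR f x a (s : R) : 0 < f x -> is_derive x 1 f a ->
  is_derive x 1 (fun y => f y `^ s) (s * f x `^ (s - 1) * a).
Proof.
by move=> fx; apply: (dfun_comp (f := fun y => y `^ s)); exact: is_derive1_powR.
Qed.

Lemma dfun_sqr x : is_derive x 1 (fun y : R => y ^+ 2) (2 * x).
Proof.
have := dfunM (dfun_id x) (dfun_id x); rewrite mul1r mulr1 => h.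
by apply: (is_derive_eq h); lra.
Qed.

Lemma is_derive_continuous (f f' : R -> R) :
  (forall x, is_derive x 1 f (f' x)) -> continuous f.
Proof.
by move=> df x; apply/differentiable_continuous/derivable1_diffP; case: (df x).
Qed.

(** For z = u + iv the hypotheses say z' = (p + iq) z, and k1 + i k2 is a primitive of p + iq. [U]
    and [V] are the real and imaginary parts of z exp(-(k1 + i k2)), hence constant. *)
Lemma complex_linear_ode (u v k1 k2 p q : R -> R) (x : R) :
  (forall x, is_derive x 1 u (p x * u x - q x * v x)) ->
  (forall x, is_derive x 1 v (p x * v x + q x * u x)) ->
  (forall x, is_derive x 1 k1 (p x)) -> (forall x, is_derive x 1 k2 (q x)) ->
  (u x +i* v x)%C = (u 0 +i* v 0)%C * ((expR (k1 x - k1 0))%:C)%C * expi (k2 x - k2 0).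
Proof.
move=> du dv dk1 dk2.
pose U y := expR (- k1 y) * (u y * cos (k2 y) + v y * sin (k2 y)).
pose V y := expR (- k1 y) * (v y * cos (k2 y) - u y * sin (k2 y)).
have dE (y : R) : is_derive y 1 (fun y => expR (- k1 y)) (expR (- k1 y) * (- p y)).
  by apply: dfun_expR; apply: dfunN; exact: dk1.
have dc (y : R) := dfun_cos (dk2 y); have ds (y : R) := dfun_sin (dk2 y).
have U0 : U x = U 0.
  apply: is_derive_0_is_cst => y.
  apply: (is_derive_eq (dfunM (dE y) (dfunD (dfunM (du y) (dc y)) (dfunM (dv y) (ds y))))).
  by ring.
have V0 : V x = V 0.
  apply: is_derive_0_is_cst => y.
  apply: (is_derive_eq (dfunM (dE y) (dfunD (dfunM (dv y) (dc y)) (dfunN (dfunM (du y) (ds y)))))).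
  by ring.
have cs : cos (k2 x) ^+ 2 + sin (k2 x) ^+ 2 = 1 := cos2Dsin2 _.
have e1 : expR (k1 x) * expR (- k1 x) = 1 by rewrite expRxMexpNx_1.
have ux : u x = expR (k1 x) * (cos (k2 x) * U x - sin (k2 x) * V x).
  transitivity (expR (k1 x) * expR (- k1 x) * (cos (k2 x) ^+ 2 + sin (k2 x) ^+ 2) * u x).
    by rewrite cs e1; ring.
  by rewrite /U /V; ring.
have vx : v x = expR (k1 x) * (sin (k2 x) * U x + cos (k2 x) * V x).
  transitivity (expR (k1 x) * expR (- k1 x) * (cos (k2 x) ^+ 2 + sin (k2 x) ^+ 2) * v x).
    by rewrite cs e1; ring.
  by rewrite /U /V; ring.
apply: complexP; rewrite !(complexReM, complexImM) /= ?(ux, vx) U0 V0 /U /V expRD cosB sinB; ring.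
Qed.

End derivation_rules.

Section parametric_integral.
Context {R : realType} {d} {T : measurableType d} (mu : {measure set T -> \bar R}).

Lemma is_derive_Rintegral (f f' : R -> T -> R) (g : T -> R) (t : R) :
  (forall t, mu.-integrable setT (EFin \o f t)) ->
  mu.-integrable setT (EFin \o g) ->
  (forall (t : R) y, is_derive t 1 (f ^~ y) (f' t y)) ->
  (forall t y, `|f' t y| <= g y) ->
  is_derive t 1 (fun s => \int[mu]_y f s y) (\int[mu]_y f' t y).
Proof.
move=> intf ig df f'g.
have g0 y : 0 <= g y by apply: le_trans (f'g 0 y).
have d1 s y : partial1of2 f s y = f' s y.
  by rewrite partial1of2E; case: (df s y).
have It : `]t - 1, t + 1[%classic t by rewrite /= in_itv/=; apply/andP; split; lra.
have intf' (x : R) : `]t - 1, t + 1[%classic x -> mu.-integrable setT (EFin \o f x) by [].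
have dff (x : R) y : `]t - 1, t + 1[%classic x -> [set: T] y -> derivable (f ^~ y) x 1.
  by move=> _ _; case: (df x y).
have ub (x : R) y : `]t - 1, t + 1[%classic x -> [set: T] y -> `|partial1of2 f x y| <= g y.
  by rewrite d1.
apply: DeriveDef.
  exact: (derivable_under_integral measurableT It intf' dff g0 ig ub).
rewrite -derive1E (differentiation_under_integral measurableT It intf' dff g0 ig ub).
by apply: eq_Rintegral => y _; rewrite d1.
Qed.

End parametric_integral.

Section oscillatory_decay.
Context {R : realType}.
Local Notation mR := (measurableTypeR R).
Local Notation mu := (@lebesgue_measure R).

Lemma continuous_funM (f g : R -> R) : continuous f -> continuous g ->
  continuous (fun x => f x * g x).
Proof. by move=> cf cg x; apply: cvgM; [exact: cf|exact: cg]. Qed.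

Lemma continuous_funB (f g : R -> R) : continuous f -> continuous g ->
  continuous (fun x => f x - g x).
Proof. by move=> cf cg x; apply: cvgB; [exact: cf|exact: cg]. Qed.

Lemma continuous_funD (f g : R -> R) : continuous f -> continuous g ->
  continuous (fun x => f x + g x).
Proof. by move=> cf cg x; apply: cvgD; [exact: cf|exact: cg]. Qed.

Lemma continuous_fun_cst (c : R) : continuous (fun _ : R => c).
Proof. by move=> x; exact: cvg_cst. Qed.

Lemma continuous_fun_id : continuous (fun x : R => x).
Proof. by move=> x; exact: cvg_id. Qed.

Lemma continuous_fun_comp (f g : R -> R) : continuous f -> continuous g ->
  continuous (fun x => f (g x)).
Proof. by move=> cf cg x; apply: continuous_comp; [exact: cg|exact: cf]. Qed.

Lemma integrable_bounded_mul (f b : R -> R) :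
  mu.-integrable setT (EFin \o f) -> measurable_fun setT (b : mR -> R) ->
  (forall x, `|b x| <= 1) -> mu.-integrable setT (EFin \o (fun x => f x * b x)).
Proof.
move=> intf mb b1.
have mf : measurable_fun setT (f : mR -> R).
  by apply/measurable_EFinP; case/integrableP: intf.
apply: (@integrable_le_real R _ mR mu _ (fun x => `|f x|)).
- by meas.
- exact: (integrable_abse intf).
- by move=> x; rewrite normrM ler_piMr.
Qed.

Lemma cos_abs_le1 (x : R) : `|cos x| <= 1.
Proof. by rewrite ler_norml cos_geN1 cos_le1. Qed.

Lemma sin_abs_le1 (x : R) : `|sin x| <= 1.
Proof. by rewrite ler_norml sin_geN1 sin_le1. Qed.

(** These hypotheses describe a Gamma integral of order k after the change of variable v = ph(w):
    formally v^(k-1) e^(-v) dv, whose transform is a constant times (1 + it)^(-k). They cover both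
    uses, ph(w) = w for the damped power (k = alpha + 1) and ph(w) = a w^2 for the Gaussian (k =
    1/2). [ch] plays the role of v^k e^(-v). *)
Variables (th ph ph' ch : R -> R) (k M e : R).
Hypotheses (e0 : 0 < e) (cth : continuous th) (cph : continuous ph)
  (ith : mu.-integrable setT (EFin \o th))
  (ithph : mu.-integrable setT (EFin \o (fun w => th w * ph w)))
  (dch : forall w : R, is_derive w 1 ch (k * th w - th w * ph w))
  (dph : forall w : R, is_derive w 1 ph (ph' w))
  (chph : forall w, ch w * ph' w = th w * ph w)
  (chM : forall w, `|ch w| <= M * (1 + `|w|) `^ (- e)).

Let mth : measurable_fun setT (th : mR -> R).
Proof. exact: continuous_measurable_fun. Qed.
Let mph : measurable_fun setT (ph : mR -> R).
Proof. exact: continuous_measurable_fun. Qed.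

Let u t := \int[mu]_w (th w * cos (t * ph w)).
Let v t := \int[mu]_w (- (th w * sin (t * ph w))).
Let C t := \int[mu]_w (th w * ph w * cos (t * ph w)).
Let S t := \int[mu]_w (th w * ph w * sin (t * ph w)).

Let icos (f : R -> R) t : mu.-integrable setT (EFin \o f) ->
  mu.-integrable setT (EFin \o (fun w => f w * cos (t * ph w))).
Proof.
move=> intf; apply: integrable_bounded_mul => //; first by meas.
by move=> x; exact: cos_abs_le1.
Qed.

Let isin (f : R -> R) t : mu.-integrable setT (EFin \o f) ->
  mu.-integrable setT (EFin \o (fun w => f w * sin (t * ph w))).
Proof.
move=> intf; apply: integrable_bounded_mul => //; first by meas.
by move=> x; exact: sin_abs_le1.
Qed.

Let vE t : v t = - \int[mu]_w (th w * sin (t * ph w)).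
Proof.
rewrite -mulN1r -RintegralZl//; last exact: isin.
by apply: eq_Rintegral => w _; rewrite mulN1r.
Qed.

Let du (t : R) : is_derive t 1 u (- S t).
Proof.
have -> : - S t = \int[mu]_w (th w * (- sin (t * ph w) * ph w)).
  rewrite -mulN1r -RintegralZl//; last exact: isin.
  by apply: eq_Rintegral => w _; ring.
apply: (@is_derive_Rintegral R _ mR mu (fun t w => th w * cos (t * ph w))
  (fun t w => th w * (- sin (t * ph w) * ph w)) (fun w => `|th w * ph w|)).
- by move=> s; exact: icos.
- exact: (integrable_abse ithph).
- move=> s w.
  have d := dfunM (dfun_cst (th w) s) (dfun_cos (dfunM (dfun_id s) (dfun_cst (ph w) s))).
  by apply: (is_derive_eq d); rewrite mul0r add0r mulr0 addr0 mul1r.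
- move=> s w; rewrite [X in `|X|](_ : _ = - sin (s * ph w) * (th w * ph w)); last by ring.
  by rewrite normrM normrN ler_piMl// sin_abs_le1.
Qed.

Let dv (t : R) : is_derive t 1 v (- C t).
Proof.
have -> : - C t = \int[mu]_w (- (th w * (cos (t * ph w) * ph w))).
  rewrite -mulN1r -RintegralZl//; last exact: icos.
  by apply: eq_Rintegral => w _; ring.
apply: (@is_derive_Rintegral R _ mR mu (fun t w => - (th w * sin (t * ph w)))
  (fun t w => - (th w * (cos (t * ph w) * ph w))) (fun w => `|th w * ph w|)).
- move=> s; rewrite (_ : EFin \o _ = EFin \o (fun w => -1 * (th w * sin (s * ph w)))).
    exact: (integrableZl measurableT (-1) (isin s ith)).
  by apply/funext => w /=; rewrite mulN1r.
- exact: (integrable_abse ithph).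
- move=> s w.
  have d := dfunN (dfunM (dfun_cst (th w) s) (dfun_sin (dfunM (dfun_id s) (dfun_cst (ph w) s)))).
  by apply: (is_derive_eq d); rewrite mul0r add0r mulr0 addr0 mul1r.
- move=> s w; rewrite normrN [X in `|X|](_ : _ = cos (s * ph w) * (th w * ph w)); last by ring.
  by rewrite normrM ler_piMl// cos_abs_le1.
Qed.

Let ccomp (f : R -> R) t : continuous f -> continuous (fun w => f (t * ph w)).
Proof.
move=> cf; apply: (continuous_fun_comp cf).
by apply: continuous_funM => //; exact: continuous_fun_cst.
Qed.

Let cthph : continuous (fun w => th w * ph w).
Proof. exact: continuous_funM. Qed.

Let ckth : continuous (fun w => k * th w).
Proof. by apply: continuous_funM => //; exact: continuous_fun_cst. Qed.

Let iM (F : R -> R) t (w : R) : (forall x, `|F x| <= 1) ->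
  `|ch w * F (t * ph w)| <= M * (1 + `|w|) `^ (- e).
Proof. by move=> F1; rewrite normrM; apply: le_trans (chM w); rewrite ler_piMr. Qed.

(** The derivative of ch(w) cos(t ph(w)) has integral 0. With the sine version this is the imaginary
    part of (1 + it) z' = -i k z, up to sign; [ibp_sin] is the real part. *)
Let ibp_cos t : k * u t - C t - t * S t = 0.
Proof.
pose h' w := (k * th w - th w * ph w) * cos (t * ph w) - t * (th w * ph w * sin (t * ph w)).
have ik : mu.-integrable setT (EFin \o (fun w => k * th w - th w * ph w)).
  exact: (integrableB measurableT (integrableZl measurableT k ith) ithph).
have i1 := icos t ik; have i2 := integrableZl measurableT t (isin t ithph).
transitivity (\int[mu]_w h' w); last apply: (@Rintegral_derive_eq0 R (fun w => ch w * cos (t * ph w)) h' M e e0).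
- rewrite /h' RintegralB// RintegralZl//; last exact: isin.
  congr (_ - _); rewrite /u /C -RintegralZl//; last exact: icos.
  rewrite -RintegralB//; last 2 first.
  - exact: (integrableZl measurableT k (icos t ith)).
  - exact: icos.
  by apply: eq_Rintegral => w _; ring.
- move=> w; have d := dfunM (dch w) (dfun_cos (dfunM (dfun_cst t w) (dph w))).
  apply: (is_derive_eq d); rewrite /h'; have := chph w.
  set a := ch w; set b := ph' w => hab.
  by rewrite -hab; ring.
- apply: continuous_funB; apply: continuous_funM.
  + exact: continuous_funB.
  + by apply: ccomp; exact: continuous_cos.
  + exact: continuous_fun_cst.
  + by apply: continuous_funM => //; apply: ccomp; exact: continuous_sin.
- exact: (integrableB measurableT i1 i2).
- by move=> w; apply: iM; exact: cos_abs_le1.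
Qed.

Let ibp_sin t : - k * v t - S t + t * C t = 0.
Proof.
pose h' w := (k * th w - th w * ph w) * sin (t * ph w) + t * (th w * ph w * cos (t * ph w)).
have ik : mu.-integrable setT (EFin \o (fun w => k * th w - th w * ph w)).
  exact: (integrableB measurableT (integrableZl measurableT k ith) ithph).
have i1 := isin t ik; have i2 := integrableZl measurableT t (icos t ithph).
transitivity (\int[mu]_w h' w); last apply: (@Rintegral_derive_eq0 R (fun w => ch w * sin (t * ph w)) h' M e e0).
- rewrite /h' RintegralD// RintegralZl//; last exact: icos.
  congr (_ + _); rewrite vE mulrNN /S -RintegralZl//; last exact: isin.
  rewrite -RintegralB//; last 2 first.
  - exact: (integrableZl measurableT k (isin t ith)).
  - exact: isin.
  by apply: eq_Rintegral => w _; ring.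
- move=> w; have d := dfunM (dch w) (dfun_sin (dfunM (dfun_cst t w) (dph w))).
  apply: (is_derive_eq d); rewrite /h'; have := chph w.
  set a := ch w; set b := ph' w => hab.
  by rewrite -hab; ring.
- apply: continuous_funD; apply: continuous_funM.
  + exact: continuous_funB.
  + by apply: ccomp; exact: continuous_sin.
  + exact: continuous_fun_cst.
  + by apply: continuous_funM => //; apply: ccomp; exact: continuous_cos.
- exact: (integrableD measurableT i1 i2).
- by move=> w; apply: iM; exact: sin_abs_le1.
Qed.

(* Integrating by parts against [ch], z(t) = int th e^(-i t ph) satisfies the
   linear equation (1 + it) z' = -i k z, so that |z|^2 (1 + t^2)^k is constant. *)
Lemma normc_oscillatory (t : R) :
  normc (cintegral mu (fun w => (th w)%:C%C * expi (- (t * ph w)))) =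
  normc (cintegral mu (fun w => (th w)%:C%C)) * (1 + t ^+ 2) `^ (- (k / 2)).
Proof.
have FE s : cintegral mu (fun w => (th w)%:C%C * expi (- (s * ph w))) = (u s +i* v s)%C.
  rewrite /cintegral; apply: complexP => /=; apply: eq_Rintegral => w _.
    by rewrite mul0r subr0 cosN.
  by rewrite mul0r addr0 sinN mulrN.
have F0 : cintegral mu (fun w => (th w)%:C%C) = (u 0 +i* v 0)%C.
  rewrite -FE; apply: eq_cintegral => w.
  by rewrite mul0r oppr0 expi0 mulr1.
have p0 (s : R) : 0 < 1 + s ^+ 2 by rewrite ltr_pwDl// sqr_ge0.
(* [p] + i [q] is -ik / (1 + is), with primitive -(k/2) ln(1 + s^2) - i k atan(s); only the first
   term changes the modulus. *)
pose p s : R := - k * s / (1 + s ^+ 2).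
pose q s : R := - k / (1 + s ^+ 2).
have sol s : S s = k * (s * u s - v s) / (1 + s ^+ 2) /\
             C s = k * (u s + s * v s) / (1 + s ^+ 2).
  have h1 := ibp_cos s; have h2 := ibp_sin s.
  have n0 := lt0r_neq0 (p0 s).
  split; apply: (mulIf n0); rewrite divfK//.
    by have := congr1 ( *%R s) h1; lra.
  by have := congr1 ( *%R s) h2; lra.
have du' (s : R) : is_derive s 1 u (p s * u s - q s * v s).
  by apply: (is_derive_eq (du s)); rewrite (sol s).1 /p /q; lra.
have dv' (s : R) : is_derive s 1 v (p s * v s + q s * u s).
  by apply: (is_derive_eq (dv s)); rewrite (sol s).2 /p /q; lra.
have dk1 (s : R) : is_derive s 1 (fun s => - (k / 2) * ln (1 + s ^+ 2)) (p s).
  have dl := dfun_comp (g := fun s => 1 + s ^+ 2) (is_derive1_ln (p0 s)) (dfunD (dfun_cst 1 s) (dfun_sqr s)).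
  apply: (is_derive_eq (dfunM (dfun_cst (- (k / 2)) s) dl)).
  by rewrite /p; field; exact: lt0r_neq0.
have dk2 (s : R) : is_derive s 1 (fun s => - k * atan s) (q s).
  apply: (is_derive_eq (dfunM (dfun_cst (- k) s) (is_derive1_atan s))).
  by rewrite /q mul0r add0r.
rewrite FE F0 (complex_linear_ode t du' dv' dk1 dk2).
rewrite !normcM normc_expi mulr1 normc_real ger0_norm ?expR_ge0//.
by rewrite expr0n/= addr0 ln1 mulr0 subr0 /powR gt_eqF.
Qed.

End oscillatory_decay.

(** * Complex Gaussian integrals *)

Section complex_gaussian.
Context {R : realType}.
Local Notation mR := (measurableTypeR R).
Local Notation mu := (@lebesgue_measure R).

Lemma gauss_decay (a s : R) : 0 < a -> 0 < s -> exists2 M, 0 < M &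
  forall x, expR (- (a * x ^+ 2)) <= M * (1 + `|x|) `^ (- s).
Proof.
move=> a0 s0; pose k := s / 2; have k0 : 0 < k by rewrite divr_gt0.
exists (expR a * k `^ k * a `^ (- k) * 2 `^ k).
  by rewrite !mulr_gt0 ?expR_gt0 ?powR_gt0.
move=> x; have p0 : 0 < 1 + x ^+ 2 by rewrite ltr_pwDl// sqr_ge0.
(* Replacing x^2 by 1 + x^2 keeps the argument of [expRN_le_powR] positive at x = 0. *)
have -> : expR (- (a * x ^+ 2)) = expR a * expR (- (a * (1 + x ^+ 2))).
  by rewrite -expRD; congr expR; ring.
rewrite -!mulrA ler_wpM2l ?expR_ge0//.
apply: le_trans (expRN_le_powR k0 (mulr_gt0 a0 p0)) _.
rewrite ler_wpM2l ?powR_ge0// powRM ?(ltW a0) ?(ltW p0)// ler_wpM2l ?powR_ge0//.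
apply: le_trans (sqr_decay_le x (ltW k0)) _.
by rewrite (_ : 2 * k = s)// /k; field.
Qed.

Lemma integrable_gauss_moment (a : R) (n : nat) : 0 < a ->
  mu.-integrable setT (EFin \o (fun x => expR (- (a * x ^+ 2)) * x ^+ n)).
Proof.
move=> a0; have [|M M0 HM] := @gauss_decay a (2 + n%:R) a0.
  by rewrite ltr_pwDl.
apply: (@integrable_decay_bound _ _ M 1) => //; first by meas.
move=> x; rewrite normrM ger0_norm ?expR_ge0// normrX.
have p0 : 0 < 1 + `|x| by rewrite ltr_pwDl.
apply: le_trans (ler_wpM2r _ (HM x)) _; first by rewrite exprn_ge0.
rewrite -mulrA ler_wpM2l ?(ltW M0)//.
rewrite (_ : - (2 + n%:R) = - (1 + 1) - n%:R :> R); last by ring.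
rewrite gt0_powRD// -mulrA ler_piMr ?powR_ge0//.
rewrite powRN powR_mulrn ?(ltW p0)// mulrC ler_pdivrMr ?exprn_gt0// mul1r.
by rewrite lerXn2r ?nnegrE ?(ltW p0)// lerDr.
Qed.

Lemma integrable_gauss (a : R) : 0 < a ->
  mu.-integrable setT (EFin \o (fun x => expR (- (a * x ^+ 2)))).
Proof.
move=> a0; have := integrable_gauss_moment 0 a0.
by under eq_fun do rewrite expr0 mulr1.
Qed.

Lemma Rintegral_gauss (a m : R) : 0 < a ->
  \int[mu]_x expR (- (a * (x - m) ^+ 2)) = Num.sqrt (pi / a).
Proof.
move=> a0; pose s : R := Num.sqrt (2 * a)^-1.
have s0 : 0 < s by rewrite sqrtr_gt0 invr_gt0 mulr_gt0.
have s2 : s ^+ 2 = (2 * a)^-1 by rewrite sqr_sqrtr// invr_ge0 mulr_ge0// ltW.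
have p0 := normal_peak_gt0 (lt0r_neq0 s0).
have : \int[mu]_x (normal_pdf m s x) = 1 by rewrite /Rintegral integral_normal_pdf.
have E x : expR (- (a * (x - m) ^+ 2)) = (normal_peak s)^-1 * normal_pdf m s x.
  rewrite /normal_pdf gt_eqF// mulKf ?lt0r_neq0//.
  rewrite /normal_fun s2; congr expR; field; exact: lt0r_neq0.
under [X in _ -> X = _]eq_Rintegral do rewrite E.
rewrite RintegralZl//; last exact: integrable_normal_pdf.
move=> ->; rewrite mulr1 /normal_peak invrK s2; congr Num.sqrt.
by rewrite -mulr_natl; field; exact: lt0r_neq0.
Qed.

Lemma derive_gauss (a x : R) :
  is_derive x 1 (fun x => expR (- (a * x ^+ 2))) (- (2 * a * x) * expR (- (a * x ^+ 2))).
Proof.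
have d := dfun_expR (dfunN (dfunM (dfun_cst a x) (dfun_sqr x))).
by apply: (is_derive_eq d); ring.
Qed.

Lemma continuous_gauss (a : R) : continuous (fun x : R => expR (- (a * x ^+ 2))).
Proof. exact: is_derive_continuous (derive_gauss a). Qed.

(** The Fourier integral of exp(-(1 + it) a x^2) at frequency y, without the factor 2 pi. *)
Definition cgauss (a t y : R) : R[i] := cintegral mu (fun x =>
  (expR (- (a * x ^+ 2)))%:C%C * expi (y * x - t * (a * x ^+ 2))).

(** The order k = 1/2 of [normc_oscillatory], with ph(w) = a w^2 and ch(w) = (w/2) exp(-a w^2). *)
Lemma normc_cgauss0 (a t : R) : 0 < a ->
  normc (cgauss a t 0) = Num.sqrt (pi / a) * (1 + t ^+ 2) `^ (- (1 / 4)).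
Proof.
move=> a0; have [M M0 HM] := @gauss_decay a 2 a0 ltac:(by []).
have d1 (w : R) : is_derive w 1 (fun w => w / 2 * expR (- (a * w ^+ 2)))
    (1 / 2 * expR (- (a * w ^+ 2)) - expR (- (a * w ^+ 2)) * (a * w ^+ 2)).
  have d := dfunM (dfunM (dfun_id w) (dfun_cst 2^-1 w)) (derive_gauss a w).
  by apply: (is_derive_eq d); field.
have d2 (w : R) : is_derive w 1 (fun w => a * w ^+ 2) (2 * a * w).
  apply: (is_derive_eq (dfunM (dfun_cst a w) (dfun_sqr w))); ring.
have h := @normc_oscillatory R (fun w => expR (- (a * w ^+ 2))) (fun w => a * w ^+ 2)
   (fun w => 2 * a * w) (fun w => w / 2 * expR (- (a * w ^+ 2))) (1 / 2) M 1 ltr01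
   (@continuous_gauss a) (is_derive_continuous d2) (integrable_gauss a0) _ d1 d2.
transitivity (normc (cintegral mu (fun w => (expR (- (a * w ^+ 2)))%:C%C *
    expi (- (t * (a * w ^+ 2)))))).
  by congr normc; apply: eq_cintegral => x; rewrite mul0r sub0r.
rewrite h; last first.
- move=> w; rewrite normrM (ger0_norm (expR_ge0 _)).
  apply: le_trans (ler_wpM2l _ (HM w)) _ => //.
  have p0 : 0 < 1 + `|w| by rewrite ltr_pwDl.
  rewrite mulrCA ler_wpM2l ?(ltW M0)//.
  rewrite (_ : - 2 = - 1 - 1 :> R); last by ring.
  rewrite gt0_powRD// mulrCA ler_piMr ?powR_ge0//.
  rewrite powR_inv1 ?(ltW p0)// ler_pdivrMr// mul1r normrM.
  rewrite [X in _ * X]ger0_norm//.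
  by rewrite ler_pdivrMr//; have := normr_ge0 w; lra.
- by move=> w; field.
- have := integrableZl measurableT a (integrable_gauss_moment 2 a0).
  rewrite /comp; congr integrable; apply/funext => x /=.
  by rewrite -EFinM mulrCA.
congr (_ * _); last by congr (_ `^ _); field.
rewrite /cintegral/= (_ : \int[mu]_x 0 = 0); last first.
  by rewrite Rintegral_cst// mul0r.
rewrite expr0n/= addr0 sqrtr_sqr ger0_norm; last by apply: Rintegral_ge0 => x _; exact: expR_ge0.
rewrite -(Rintegral_gauss 0 a0); apply: eq_Rintegral => x _.
by rewrite subr0.
Qed.

(** As a function of y the integral satisfies G' = -y / (2a (1 + it)) G: this comes from integrating
    the derivative of exp(-a x^2) exp(i F(y, x)) in x. The solution carries exp(-y^2 / (4a (1 +
    it))), and 1/(1 + it) = (1 - it)/(1 + t^2) splits it into the two factors shown. *)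
Lemma cgaussE (a t y : R) : 0 < a ->
  cgauss a t y = cgauss a t 0 *
    ((expR (- (y ^+ 2 / (4 * a * (1 + t ^+ 2)))))%:C)%C *
    expi (t * (y ^+ 2 / (4 * a * (1 + t ^+ 2)))).
Proof.
move=> a0; have n0 := lt0r_neq0 a0.
have t0 : 1 + t ^+ 2 != 0 by rewrite lt0r_neq0// ltr_pwDl// sqr_ge0.
pose E x := expR (- (a * x ^+ 2)); pose F y x := y * x - t * (a * x ^+ 2).
have iE : mu.-integrable setT (EFin \o E) by exact: integrable_gauss.
have iE1 : mu.-integrable setT (EFin \o (fun x => E x * x)).
  exact: (integrable_gauss_moment 1 a0).
have mF z : measurable_fun setT (F z : mR -> R) by rewrite /F; meas.
have icos z f : mu.-integrable setT (EFin \o f) ->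
    mu.-integrable setT (EFin \o (fun x => f x * cos (F z x))).
  by move=> i; apply: integrable_bounded_mul => // [|x]; [meas|exact: cos_abs_le1].
have isin z f : mu.-integrable setT (EFin \o f) ->
    mu.-integrable setT (EFin \o (fun x => f x * sin (F z x))).
  by move=> i; apply: integrable_bounded_mul => // [|x]; [meas|exact: sin_abs_le1].
pose u z := \int[mu]_x (E x * cos (F z x)).
pose v z := \int[mu]_x (E x * sin (F z x)).
pose C z := \int[mu]_x (E x * x * cos (F z x)).
pose S z := \int[mu]_x (E x * x * sin (F z x)).
have GE z : cgauss a t z = (u z +i* v z)%C.
  rewrite /cgauss /cintegral; apply: complexP => /=; apply: eq_Rintegral => x _.
    by rewrite mul0r subr0.
  by rewrite mul0r addr0.
have dF (z x : R) : is_derive z 1 (F ^~ x) x.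
  apply: (is_derive_eq (dfunD (dfunM (dfun_id z) (dfun_cst x z)) (dfun_cst _ z))).
  by rewrite mul1r mulr0 !addr0.
have dFx (z x : R) : is_derive x 1 (F z) (z - t * (a * (2 * x))).
  apply: (is_derive_eq (dfunD (dfunM (dfun_cst z x) (dfun_id x))
    (dfunN (dfunM (dfun_cst t x) (dfunM (dfun_cst a x) (dfun_sqr x)))))).
  by ring.
have du (z : R) : is_derive z 1 u (- S z).
  have -> : - S z = \int[mu]_x (E x * (- sin (F z x) * x)).
    rewrite -mulN1r -RintegralZl//; last exact: isin.
    by apply: eq_Rintegral => w _; ring.
  apply: (@is_derive_Rintegral R _ mR mu (fun z x => E x * cos (F z x))
    (fun z x => E x * (- sin (F z x) * x)) (fun x => `|E x * x|)).
  - by move=> s; exact: icos.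
  - exact: (integrable_abse iE1).
  - move=> s w; rewrite [X in `|X|](_ : _ = - sin (F s w) * (E w * w)); last by ring.
    by rewrite normrM normrN ler_piMl// sin_abs_le1.
have dv (z : R) : is_derive z 1 v (C z).
  have -> : C z = \int[mu]_x (E x * (cos (F z x) * x)).
    by apply: eq_Rintegral => w _; ring.
  apply: (@is_derive_Rintegral R _ mR mu (fun z x => E x * sin (F z x))
    (fun z x => E x * (cos (F z x) * x)) (fun x => `|E x * x|)).
  - by move=> s; exact: isin.
  - exact: (integrable_abse iE1).
  - move=> s w; rewrite [X in `|X|](_ : _ = cos (F s w) * (E w * w)); last by ring.
    by rewrite normrM ler_piMl// cos_abs_le1.
have [M M0 HM] := @gauss_decay a 1 a0 ltr01.
have HE (G : R -> R) z x : (forall x, `|G x| <= 1) ->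
    `|E x * G (F z x)| <= M * (1 + `|x|) `^ (- 1).
  move=> G1; rewrite normrM ger0_norm ?expR_ge0//.
  by apply: le_trans (HM x); rewrite ler_piMr// expR_ge0.
have cE : continuous E by exact: continuous_gauss.
have cF z : continuous (F z) by apply: is_derive_continuous (dFx z).
have cFc z : continuous (fun x => cos (F z x)).
  by apply: continuous_fun_comp; [exact: continuous_cos|exact: cF].
have cFs z : continuous (fun x => sin (F z x)).
  by apply: continuous_fun_comp; [exact: continuous_sin|exact: cF].
have cEx : continuous (fun x => E x * x).
  by apply: continuous_funM => //; exact: continuous_fun_id.
have cc (c : R) (f : R -> R) : continuous f -> continuous (fun x => c * f x).
  by move=> cf; apply: continuous_funM => //; exact: continuous_fun_cst.
have ibp_cos z : - (2 * a) * C z - z * v z + 2 * t * a * S z = 0.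
  pose h' x := - (2 * a) * (E x * x * cos (F z x)) - z * (E x * sin (F z x)) +
    2 * t * a * (E x * x * sin (F z x)).
  have i1 := integrableZl measurableT (- (2 * a)) (icos z _ iE1).
  have i2 := integrableZl measurableT z (isin z _ iE).
  have i3 := integrableZl measurableT (2 * t * a) (isin z _ iE1).
  have i12 := integrableB measurableT i1 i2.
  transitivity (\int[mu]_x h' x).
    rewrite /h' RintegralD// RintegralB// !RintegralZl//; by [exact: icos|exact: isin].
  apply: (@Rintegral_derive_eq0 R (fun x => E x * cos (F z x)) h' M 1 ltr01).
  - move=> x; have d := dfunM (derive_gauss a x) (dfun_cos (dFx z x)).
    by apply: (is_derive_eq d); rewrite /h' /E; ring.
  - apply: continuous_funD; [apply: continuous_funB|]; apply: cc; exact: continuous_funM.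
  - exact: (integrableD measurableT i12 i3).
  - by move=> x; apply: HE; exact: cos_abs_le1.
have ibp_sin z : - (2 * a) * S z + z * u z - 2 * t * a * C z = 0.
  pose h' x := - (2 * a) * (E x * x * sin (F z x)) + z * (E x * cos (F z x)) -
    2 * t * a * (E x * x * cos (F z x)).
  have i1 := integrableZl measurableT (- (2 * a)) (isin z _ iE1).
  have i2 := integrableZl measurableT z (icos z _ iE).
  have i3 := integrableZl measurableT (2 * t * a) (icos z _ iE1).
  have i12 := integrableD measurableT i1 i2.
  transitivity (\int[mu]_x h' x).
    rewrite /h' RintegralB// RintegralD// !RintegralZl//; by [exact: icos|exact: isin].
  apply: (@Rintegral_derive_eq0 R (fun x => E x * sin (F z x)) h' M 1 ltr01).
  - move=> x; have d := dfunM (derive_gauss a x) (dfun_sin (dFx z x)).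
    by apply: (is_derive_eq d); rewrite /h' /E; ring.
  - apply: continuous_funB; [apply: continuous_funD|]; apply: cc; exact: continuous_funM.
  - exact: (integrableB measurableT i12 i3).
  - by move=> x; apply: HE; exact: sin_abs_le1.
pose p z : R := - z / (2 * a * (1 + t ^+ 2)).
pose q z : R := t * z / (2 * a * (1 + t ^+ 2)).
have d0 : 2 * a * (1 + t ^+ 2) != 0 by rewrite !mulf_neq0.
have pD z : p z * (2 * a * (1 + t ^+ 2)) = - z by rewrite /p divfK.
have qD z : q z * (2 * a * (1 + t ^+ 2)) = t * z by rewrite /q divfK.
have du' (z : R) : is_derive z 1 u (p z * u z - q z * v z).
  apply: (is_derive_eq (du z)); apply: (mulIf d0).
  rewrite mulrBl (mulrAC (p z)) (mulrAC (q z)) pD qD.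
  by have := congr1 ( *%R t) (ibp_cos z); have := ibp_sin z; lra.
have dv' (z : R) : is_derive z 1 v (p z * v z + q z * u z).
  apply: (is_derive_eq (dv z)); apply: (mulIf d0).
  rewrite (mulrDl (p z * v z)) (mulrAC (p z)) (mulrAC (q z)) pD qD.
  by have := congr1 ( *%R t) (ibp_sin z); have := ibp_cos z; lra.
have dsq (c z : R) : is_derive z 1 (fun z => c * z ^+ 2) (c * (2 * z)).
  by apply: (is_derive_eq (dfunM (dfun_cst c z) (dfun_sqr z))); ring.
have dk1 (z : R) : is_derive z 1
    (fun z => - (4 * a * (1 + t ^+ 2))^-1 * z ^+ 2) (p z).
  by apply: (is_derive_eq (dsq _ z)); rewrite /p; field; rewrite t0.
have dk2 (z : R) : is_derive z 1
    (fun z => t / (4 * a * (1 + t ^+ 2)) * z ^+ 2) (q z).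
  by apply: (is_derive_eq (dsq _ z)); rewrite /q; field; rewrite t0.
rewrite !GE (complex_linear_ode y du' dv' dk1 dk2).
congr (_ * (expR _)%:C%C * expi _); field; by rewrite t0.
Qed.

End complex_gaussian.

(** * The Fourier transform of a damped power *)

Section truncated_power.
Context {R : realType}.
Local Notation mR := (measurableTypeR R).
Local Notation mu := (@lebesgue_measure R).

Lemma pos_powR_ge0 (w s : R) : 0 <= pos_powR w s.
Proof. by rewrite /pos_powR; case: ifP => // _; exact: powR_ge0. Qed.

Lemma continuous0_pos_powR (s : R) : 0 < s ->
  {for 0, continuous (fun w : R => pos_powR w s)}.
Proof.
move=> s0; apply/cvgrPdist_lt => /= eps eps0.
near=> z; rewrite {1}/pos_powR ltxx sub0r normrN ger0_norm ?pos_powR_ge0//.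
rewrite /pos_powR; case: ifPn => // z0.
have : z < eps `^ s^-1.
  have : `|0 - z| < eps `^ s^-1.
    near: z; apply: (@cvgr_dist_lt _ _ _ _ _ id (0 : R)); first exact: cvg_id.
    by rewrite powR_gt0.
  by rewrite sub0r normrN gtr0_norm.
move=> h; have : z `^ s < (eps `^ s^-1) `^ s.
  by apply: gt0_ltr_powR; rewrite ?nnegrE ?powR_ge0// ltW.
by rewrite -powRrM mulVf ?gt_eqF// powRr1// ltW.
Unshelve. all: by end_near. Qed.

(** At 0 the difference quotient is z_+^(s-1), continuous there because s > 1; this is
    Caratheodory's criterion. *)
Lemma is_derive_pos_powR (s w : R) : 1 < s ->
  is_derive w 1 (fun w => pos_powR w s) (s * pos_powR w (s - 1)).
Proof.
move=> s1; have [w0|w0|->] := ltgtP w 0.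
- have e : \forall z \near w, (fun=> 0 : R) z = pos_powR z s.
    near=> z; rewrite /pos_powR ltNge ltW//=.
    by near: z; exact: lt_nbhsl.
  apply: (is_derive_eq (near_eq_is_derive e (dfun_cst 0 w))).
  by rewrite /pos_powR ltNge (ltW w0)/= mulr0.
- have e : \forall z \near w, (fun z => z `^ s) z = pos_powR z s.
    near=> z; rewrite /pos_powR ifT//.
    by near: z; exact: lt_nbhsr.
  apply: (is_derive_eq (near_eq_is_derive e (is_derive1_powR s w0))).
  by rewrite /pos_powR w0.
- apply/is_derive1_caratheodory; exists (fun z => pos_powR z (s - 1)); split.
  + move=> z; rewrite subr0 {2}/pos_powR ltxx subr0 /pos_powR; case: ifPn => [z0|]; last by rewrite mul0r.
    by rewrite -[X in _ * X](powRr1 (ltW z0)) -gt0_powRD// subrK.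
  + by apply: continuous0_pos_powR; rewrite subr_gt0.
  + by rewrite /pos_powR ltxx mulr0.
Unshelve. all: by end_near. Qed.

Lemma pos_powR_exp_decay (s r : R) : 0 <= s -> 0 < r -> exists2 M, 0 < M &
  forall w, pos_powR w s * expR (- w) <= M * (1 + `|w|) `^ (- r).
Proof.
move=> s0 r0; have sr0 : 0 < s + r by rewrite ltr_wpDl.
exists (expR 1 * (s + r) `^ (s + r)).
  by rewrite mulr_gt0 ?expR_gt0 ?powR_gt0.
move=> w; rewrite /pos_powR; case: ifPn => w0; last first.
  by rewrite mul0r !mulr_ge0 ?expR_ge0 ?powR_ge0.
rewrite gtr0_norm//; have p0 : 0 < 1 + w by rewrite ltr_wpDl.
have -> : expR (- w) = expR 1 * expR (- (1 + w)).
  by rewrite -expRD; congr expR; ring.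
have h := expRN_le_powR sr0 p0.
have h2 : w `^ s <= (1 + w) `^ s by apply: powR_homo; rewrite ?(ltW w0)// lerDr.
have -> : (1 + w) `^ (- r) = (1 + w) `^ s * (1 + w) `^ (- (s + r)).
  by rewrite -gt0_powRD//; congr (_ `^ _); ring.
rewrite mulrCA -!mulrA ler_wpM2l ?expR_ge0//.
rewrite mulrCA ler_pM ?powR_ge0 ?expR_ge0//.
Qed.

Variable alpha : R.
Hypothesis alpha1 : 1 < alpha.

Let g (w : R) : R := pos_powR w alpha * expR (- w).

Lemma derive_gpow (s w : R) : 1 < s ->
  is_derive w 1 (fun w => pos_powR w s * expR (- w))
   (s * (pos_powR w (s - 1) * expR (- w)) - pos_powR w s * expR (- w)).
Proof.
move=> s1; have d := dfunM (is_derive_pos_powR w s1) (dfun_expR (dfunN (dfun_id w))).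
by apply: (is_derive_eq d); ring.
Qed.

Let cg : continuous g.
Proof. by apply: is_derive_continuous => w; exact: derive_gpow. Qed.

Let mg : measurable_fun setT (g : mR -> R).
Proof. exact: continuous_measurable_fun. Qed.

Let g0 w : 0 <= g w.
Proof. by rewrite mulr_ge0 ?expR_ge0 ?pos_powR_ge0. Qed.

Let ig : mu.-integrable setT (EFin \o g).
Proof.
have a1 := alpha1.
have [|M M0 HM] := @pos_powR_exp_decay alpha (1 + 1) _ ltac:(by []); first by lra.
apply: (@integrable_decay_bound _ _ M 1) => // w.
by rewrite ger0_norm; [exact: HM|exact: g0].
Qed.

Definition gpow_ft (t : R) : R[i] :=
  cintegral mu (fun w => (g w)%:C%C * expi (- (t * w))).

Let pos_powRS (w : R) : pos_powR w (alpha + 1) = pos_powR w alpha * w.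
Proof.
rewrite /pos_powR; case: ifPn => w0; last by rewrite mul0r.
by rewrite gt0_powRD// powRr1// ltW.
Qed.

(** The order k = alpha + 1 of [normc_oscillatory], with ph(w) = w and ch(w) = w_+^(alpha+1) e^(-w).
    The constant is the integral of g, that is Gamma(alpha + 1). *)
Lemma normc_gpow_ft : exists2 c : R, 0 <= c &
  forall t, normc (gpow_ft t) = c * (1 + t ^+ 2) `^ (- ((alpha + 1) / 2)).
Proof.
exists (normc (cintegral mu (fun w => (g w)%:C%C))); first exact: normc_ge0.
move=> t; have al := alpha1.
have d1 (w : R) : is_derive w 1 (fun w => pos_powR w (alpha + 1) * expR (- w))
    ((alpha + 1) * g w - g w * w).
  have a1 : 1 < alpha + 1 by lra.
  apply: (is_derive_eq (derive_gpow w a1)).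
  by rewrite addrK pos_powRS /g; ring.
have [||M M0 HM] := @pos_powR_exp_decay (alpha + 1) (1 + 1); [by lra|by []|].
apply: (@normc_oscillatory R g (fun w => w) (fun=> 1)
  (fun w => pos_powR w (alpha + 1) * expR (- w)) (alpha + 1) M (1 + 1)) => //.
- by move=> x; exact: cvg_id.
- apply: (@integrable_decay_bound _ _ M 1) => //; first by meas.
  move=> w; rewrite (_ : g w * w = pos_powR w (alpha + 1) * expR (- w)).
    by rewrite ger0_norm// mulr_ge0 ?expR_ge0 ?pos_powR_ge0.
  by rewrite pos_powRS /g; ring.
- by move=> w; rewrite mulr1 pos_powRS /g; ring.
- by move=> w; rewrite ger0_norm// mulr_ge0 ?expR_ge0 ?pos_powR_ge0.
Qed.

Let g_lipschitz : exists2 L : R, 0 <= L & forall v w, `|g w - g v| <= L * `|w - v|.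
Proof.
have al := alpha1.
have [||M1 M10 HM1] := @pos_powR_exp_decay (alpha - 1) 1; [by lra|by []|].
have [||M2 M20 HM2] := @pos_powR_exp_decay alpha 1; [by lra|by []|].
have p1 (w : R) : (1 + `|w|) `^ (- 1) <= 1.
  rewrite powR_inv1 ?addr_ge0// invf_le1 ?ltr_pwDl// lerDl//.
have L0 : 0 <= alpha * M1 + M2 by rewrite addr_ge0 ?mulr_ge0// ltW//; lra.
exists (alpha * M1 + M2) => //.
pose g' w := alpha * (pos_powR w (alpha - 1) * expR (- w)) - g w.
have dg (w : R) : is_derive w 1 g (g' w) by exact: derive_gpow.
have g'L w : `|g' w| <= alpha * M1 + M2.
  apply: le_trans (ler_normB _ _) _.
  have a0 : 0 < alpha by lra.
  rewrite normrM (gtr0_norm a0) !ger0_norm ?mulr_ge0 ?expR_ge0 ?pos_powR_ge0//.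
  apply: lerD.
    rewrite ler_wpM2l ?(ltW a0)//; apply: le_trans (HM1 w) _.
    by rewrite ler_piMr ?(ltW M10).
  by apply: le_trans (HM2 w) _; rewrite ler_piMr ?(ltW M20).
have key v w : v < w -> `|g w - g v| <= (alpha * M1 + M2) * `|w - v|.
  move=> vw; have [c _ ->] := @MVT R g g' v w vw (fun x _ => dg x)
    (continuous_subspaceT cg).
  by rewrite normrM ler_wpM2r.
move=> v w; have [vw|wv|->] := ltgtP v w; first exact: key.
- by rewrite distrC (distrC w); exact: key.
- by rewrite !subrr normr0 mulr0.
Qed.

Let cmg : cmeasurable (fun w : mR => (g w)%:C%C).
Proof. exact: cmeasurable_real. Qed.

(** The Fubini argument wants a majorant integrable in t as well; the factor (1 + t^2)^(-1) supplies
    it and is divided out afterwards. *)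
Lemma cmeasurable_gpow_ft : cmeasurable (gpow_ft : mR -> R[i]).
Proof.
have ig' := integrable_sqr_decay (ltac:(lra) : 1 / 2 < (1 : R)).
suff : cmeasurable (fun t : mR => ((1 + t ^+ 2) `^ (- 1))%:C%C * gpow_ft t).
  move=> h; have m1 : cmeasurable (fun t : mR => (1 + t ^+ 2)%:C%C).
    by apply: cmeasurable_real; meas.
  have := cmeasurableM m1 h.
  congr cmeasurable; apply/funext => t; rewrite mulrA.
  have t0 : 0 < 1 + t ^+ 2 by rewrite ltr_pwDl// sqr_ge0.
  rewrite -[X in X * _](rmorphM (real_complex R)) /= powR_inv1 ?(ltW t0)//.
  by rewrite divff ?lt0r_neq0//= mul1r.
have -> : (fun t : mR => ((1 + t ^+ 2) `^ (- 1))%:C%C * gpow_ft t) =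
    (fun t => cintegral mu (fun w => ((1 + t ^+ 2) `^ (- 1))%:C%C *
      ((g w)%:C%C * expi (- (t * w))))).
  apply/funext => t; rewrite cintegralZl//.
  apply: (cintegrable_le _ ig) => [|w].
    by apply: cmeasurableM => //; apply: cmeasurable_expi; meas.
  by rewrite normcM normc_expi mulr1 normc_real ger0_norm.
apply: (@cmeasurable_cintegral_dominated R _ _ mR mR mu mu
  (fun t => (1 + t ^+ 2) `^ (- 1)) g ig' ig _ _
  (fun p => ((1 + p.1 ^+ 2) `^ (- 1))%:C%C * ((g p.2)%:C%C * expi (- (p.1 * p.2))))) => //.
- by move=> t; exact: powR_ge0.
- apply: cmeasurableM; first by apply: cmeasurable_real; meas.
  apply: cmeasurableM; last by apply: cmeasurable_expi; meas.
  by apply: cmeasurable_real; exact: measurableT_comp mg measurable_snd.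
- move=> t w; rewrite !normcM normc_expi mulr1 !normc_real !ger0_norm//.
  exact: powR_ge0.
Qed.

Lemma integrable_gpow_ft_bound (c : R) :
  mu.-integrable setT (EFin \o (fun t => c * (1 + t ^+ 2) `^ (- ((alpha + 1) / 2)))).
Proof.
have al := alpha1; have h : 1 / 2 < (alpha + 1) / 2 by lra.
exact: (integrableZl measurableT c (integrable_sqr_decay h)).
Qed.

Let smoothed (s v : R) : R[i] := cintegral mu (fun t => gpow_ft t * expi (t * v) *
    (expR (- (s ^+ 2 * t ^+ 2)))%:C%C).

(** After Fubini the inner integral in t is [cgauss (s ^+ 2) 0 (v - w)], a real Gaussian of width of
    order s in w - v. *)
Let smoothedE (s v : R) : 0 < s -> smoothed s v =
  ((Num.sqrt (pi / s ^+ 2) *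
    \int[mu]_w (g w * expR (- ((4 * s ^+ 2)^-1 * (w - v) ^+ 2)))))%:C%C.
Proof.
move=> s0; have ss0 : 0 < s ^+ 2 by rewrite exprn_gt0.
pose E t := expR (- (s ^+ 2 * t ^+ 2)).
have iE : mu.-integrable setT (EFin \o E) by exact: integrable_gauss.
pose F (p : mR * mR) := (E p.1)%:C%C * expi (p.1 * v) * ((g p.2)%:C%C * expi (- (p.1 * p.2))).
have mF : cmeasurable F.
  apply: cmeasurableM.
    apply: cmeasurableM; last by apply: cmeasurable_expi; meas.
    by apply: cmeasurable_real; rewrite /E; meas.
  apply: cmeasurableM; last by apply: cmeasurable_expi; meas.
  by apply: cmeasurable_real; exact: measurableT_comp mg measurable_snd.
have leF t w : normc (F (t, w)) <= E t * g w.
  by rewrite !normcM !normc_expi !mulr1 !normc_real !ger0_norm ?expR_ge0.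
have -> : smoothed s v = cintegral mu (fun t => cintegral mu (fun w => F (t, w))).
  apply: eq_cintegral => t.
  transitivity ((E t)%:C%C * expi (t * v) * gpow_ft t).
    by rewrite mulrC mulrCA mulrC.
  rewrite /gpow_ft -cintegralZl//.
  apply: (cintegrable_le _ ig) => [|w].
    by apply: cmeasurableM => //; apply: cmeasurable_expi; meas.
  by rewrite normcM normc_expi mulr1 normc_real ger0_norm.
rewrite (@cfubini_dominated R _ _ mR mR mu mu E g iE ig _ g0 F mF leF); last first.
  by move=> t; exact: expR_ge0.
have FE w : cintegral mu (fun t => F (t, w)) =
    (g w * (Num.sqrt (pi / s ^+ 2) * expR (- ((4 * s ^+ 2)^-1 * (w - v) ^+ 2))))%:C%C.
  have -> : cintegral mu (fun t => F (t, w)) =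
      (g w)%:C%C * cgauss (s ^+ 2) 0 (v - w).
    rewrite /cgauss -cintegralZl; last first.
      apply: (cintegrable_le _ iE) => [|t].
        apply: cmeasurableM; first by apply: cmeasurable_real; rewrite /E; meas.
        by apply: cmeasurable_expi; meas.
      by rewrite normcM normc_expi mulr1 normc_real ger0_norm// expR_ge0.
    apply: eq_cintegral => t; rewrite /F /= mul0r subr0 mulrBl expiD.
    by rewrite (mulrC t v) (mulrC t w) -/(E t); ring.
  rewrite cgaussE// mul0r expi0 mulr1.
  have -> : cgauss (s ^+ 2) 0 0 = (Num.sqrt (pi / s ^+ 2))%:C%C.
    rewrite /cgauss; under eq_cintegral do rewrite !mul0r subrr expi0 mulr1.
    rewrite /cintegral /= Rintegral_cst// mul0r; congr (_ +i* _)%C.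
    rewrite -(Rintegral_gauss 0 ss0); apply: eq_Rintegral => x _.
    by rewrite subr0.
  rewrite -!rmorphM /= expr0n/= addr0 mulr1.
  congr (_ * (_ * expR (- _)))%:C%C.
  by rewrite mulrC -[X in _ * X]sqrrN opprB.
under eq_cintegral do rewrite FE.
rewrite /cintegral /= Rintegral_cst// mul0r; congr (_ +i* _)%C.
rewrite -RintegralZl//; last first.
  apply: (@integrable_le_real R _ mR mu _ g) => //.
    by meas.
  move=> w; rewrite normrM (ger0_norm (g0 w)) ger0_norm ?expR_ge0//.
  rewrite ler_piMr// -expR0 ler_expR oppr_le0.
  by apply: mulr_ge0; rewrite ?sqr_ge0// invr_ge0 mulr_ge0 ?sqr_ge0.
by apply: eq_Rintegral => w _; rewrite mulrCA.
Qed.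

(* Inserting the factor e^(-s^2 t^2) gives a Gaussian average of [g] around [v];
   both sides move by O(s), as [g] is Lipschitz for alpha > 1. *)
Lemma gpow_ft_inversion (v : R) :
  cintegral mu (fun t => gpow_ft t * expi (t * v)) = ((2 * pi * g v)%:C)%C.
Proof.
have al := alpha1.
have [c c0 HG] := normc_gpow_ft.
have [L L0 HL] := g_lipschitz.
(* The damping error costs a factor s |t|, paid with a power 1/2 of 1 + t^2. The exponent left is
   alpha/2 > 1/2, so the error is integrable. *)
pose N (t : R) := c * (1 + t ^+ 2) `^ (- (alpha / 2)).
have iN : mu.-integrable setT (EFin \o N).
  have h : 1 / 2 < alpha / 2 by lra.
  exact: (integrableZl measurableT c (integrable_sqr_decay h)).
have iG := integrable_gpow_ft_bound c.
set I := cintegral _ _.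
have mI : cmeasurable (fun t : mR => gpow_ft t * expi (t * v)).
  by apply: cmeasurableM; [exact: cmeasurable_gpow_ft|apply: cmeasurable_expi; meas].
have step1 s : 0 < s -> normc (I - smoothed s v) <= s * \int[mu]_t N t.
  move=> s0; pose E t := expR (- (s ^+ 2 * t ^+ 2)).
  have mE : measurable_fun setT (E : mR -> R) by rewrite /E; meas.
  have E01 t : 0 <= 1 - E t.
    by rewrite subr_ge0 -expR0 ler_expR oppr_le0 mulr_ge0 ?sqr_ge0.
  (* With y = s |t|: the left side is at most min(1, y^2), which is at most y. *)
  have cE t : 1 - E t <= s * `|t|.
    have := expR_ge1Dx (- (s ^+ 2 * t ^+ 2)); rewrite -/(E t).
    have -> : s ^+ 2 * t ^+ 2 = (s * `|t|) ^+ 2.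
      by rewrite exprMn real_normK ?num_real.
    have : 0 < E t by exact: expR_gt0.
    have : 0 <= s * `|t| by rewrite mulr_ge0// ltW.
    set y := s * _ => y0 E0 h; have [y1|y1] := leP 1 y; first by lra.
    by nra.
  pose F t := gpow_ft t * expi (t * v) * (1 - E t)%:C%C.
  have mF : cmeasurable (F : mR -> R[i]).
    by apply: cmeasurableM => //; apply: cmeasurable_real; meas.
  have FN t : normc (F t) <= s * N t.
    rewrite /F !normcM normc_expi mulr1 normc_real HG (ger0_norm (E01 t)) /N.
    apply: le_trans (ler_wpM2l _ (cE t)) _; first by rewrite mulr_ge0 ?powR_ge0.
    have t0 : 0 < 1 + t ^+ 2 by rewrite ltr_pwDl// sqr_ge0.
    have -> : - ((alpha + 1) / 2) = - (alpha / 2) - 2^-1 by lra.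
    rewrite gt0_powRD// mulrCA ler_wpM2l ?(ltW s0)// -!mulrA ler_wpM2l//.
    rewrite ler_piMr ?powR_ge0// powRN mulrC ler_pdivrMr ?powR_gt0// mul1r.
    rewrite powR12_sqrt ?(ltW t0)// -sqrtr_sqr ler_sqrt ?(ltW t0)//.
    by rewrite lerDr.
  have isN := integrableZl measurableT s iN.
  have iF := cintegrable_le mF isN FN.
  have mS : cmeasurable (fun t : mR => gpow_ft t * expi (t * v) * (E t)%:C%C).
    by apply: cmeasurableM => //; exact: cmeasurable_real.
  have iS : cintegrable mu (fun t : mR => gpow_ft t * expi (t * v) * (E t)%:C%C).
    apply: (cintegrable_le mS iG) => t.
    rewrite !normcM normc_expi mulr1 normc_real HG ger0_norm ?expR_ge0//.
    by rewrite ler_piMr ?mulr_ge0 ?powR_ge0// -subr_ge0.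
  have -> : I - smoothed s v = cintegral mu F.
    apply/eqP; rewrite subr_eq /smoothed -cintegralD//; apply/eqP.
    apply: eq_cintegral => t; rewrite /F -mulrDr -rmorphD subrK rmorph1 mulr1//.
  apply: le_trans (normc_cintegral_le mF isN FN) _.
  by rewrite RintegralZl.
have step2 s : 0 < s -> normc (smoothed s v - ((2 * pi * g v)%:C)%C) <=
    s * (4 * L * Num.sqrt (2 * pi) * Num.sqrt pi).
  move=> s0; rewrite (smoothedE v s0) -rmorphB normc_real.
  have ss0 : 0 < s ^+ 2 by rewrite exprn_gt0.
  pose b := (4 * s ^+ 2)^-1.
  have b0 : 0 < b by rewrite invr_gt0 mulr_gt0.
  pose E w := expR (- (b * (w - v) ^+ 2)).
  have s1 (a : R) : 0 < a -> mu.-integrable setT (EFin \o (fun w => expR (- (a * (w - v) ^+ 2)))).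
    move=> a0; have h1 : \int[mu]_w expR (- (a * (w - v) ^+ 2)) != 0.
      by rewrite Rintegral_gauss// gt_eqF// sqrtr_gt0 divr_gt0// pi_gt0.
    apply/integrableP; split; first by apply/measurable_EFinP; meas.
    rewrite ltey; apply: contra h1 => /eqP h1; rewrite /Rintegral.
    by under eq_integral do rewrite -(ger0_norm (expR_ge0 _)); rewrite h1.
  have iE : mu.-integrable setT (EFin \o E) by exact: s1.
  have igE : mu.-integrable setT (EFin \o (fun w => g w * E w)).
    apply: integrable_bounded_mul => //; first by rewrite /E; meas.
    move=> w; rewrite ger0_norm ?expR_ge0// -expR0 ler_expR oppr_le0.
    by rewrite mulr_ge0 ?sqr_ge0 ?(ltW b0).
  have -> : 2 * pi * g v = Num.sqrt (pi / s ^+ 2) * \int[mu]_w (g v * E w).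
    suff h : Num.sqrt (pi / s ^+ 2) * Num.sqrt (pi / b) = 2 * pi.
      by rewrite RintegralZl// Rintegral_gauss// [RHS]mulrCA h [RHS]mulrC.
    rewrite -sqrtrM ?divr_ge0 ?pi_ge0 ?(ltW ss0)//.
    rewrite (_ : pi / s ^+ 2 * (pi / b) = (2 * pi) ^+ 2); last first.
      by rewrite /b; field; exact: lt0r_neq0.
    by rewrite sqrtr_sqr ger0_norm// mulr_ge0// pi_ge0.
  rewrite -mulrBr normrM (ger0_norm (sqrtr_ge0 _)) -RintegralB//; last first.
    exact: (integrableZl measurableT _ iE).
  have b20 : 0 < b / 2 by rewrite divr_gt0.
  have ib2 := s1 (b / 2) b20.
  have i2 := integrableZl measurableT (L * (2 * s)) ib2.
  (* Half of the exponent absorbs the Lipschitz factor: |w - v| = 2 s y and y exp(-y^2/2) <= 1. *)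
  have le1 w : `|g w * E w - g v * E w| <= L * (2 * s) * expR (- (b / 2 * (w - v) ^+ 2)).
    rewrite -mulrBl normrM (ger0_norm (expR_ge0 _)).
    apply: le_trans (ler_wpM2r (expR_ge0 _) (HL v w)) _.
    rewrite -!mulrA ler_wpM2l//.
    have [y [y0 wy]] : exists y, 0 <= y /\ `|w - v| = 2 * s * y.
      exists (`|w - v| / (2 * s)); split; last by field; exact: lt0r_neq0.
      by rewrite divr_ge0// mulr_ge0// ltW.
    have y2 : b * (w - v) ^+ 2 = y ^+ 2.
      rewrite -(real_normK (num_real (w - v))) wy /b; field; exact: lt0r_neq0.
    rewrite wy -!mulrA ler_wpM2l// ler_wpM2l ?(ltW s0)//.
    have -> : b * (2^-1 * (w - v) ^+ 2) = y ^+ 2 / 2 by rewrite -y2; ring.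
    rewrite /E y2.
    have -> : expR (- y ^+ 2) = expR (- (y ^+ 2 / 2)) * expR (- (y ^+ 2 / 2)).
      by rewrite -expRD; congr expR; field.
    rewrite (mulrA y) ler_piMl ?expR_ge0// expRN ler_pdivrMr ?expR_gt0// mul1r.
    apply: le_trans (expR_ge1Dx _); have := sqr_ge0 (1 - y); nra.
  apply: le_trans (ler_wpM2l (sqrtr_ge0 _) (le_normr_Rintegral measurableT _)) _.
    exact: (integrableB measurableT igE (integrableZl measurableT _ iE)).
  have mabs : measurable_fun setT (fun w : mR => `|g w * E w - g v * E w|).
    by rewrite /E; meas.
  have iabs : mu.-integrable setT (EFin \o (fun w => `|g w * E w - g v * E w|)).
    by apply: (integrable_le_real mabs i2) => w; rewrite normr_id.
  have leI := le_Rintegral measurableT iabs i2 (fun w _ => le1 w).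
  apply: le_trans (ler_wpM2l (sqrtr_ge0 _) leI) _.
  rewrite RintegralZl// Rintegral_gauss ?divr_gt0//.
  have -> : Num.sqrt (pi / s ^+ 2) = Num.sqrt pi / s.
    by rewrite sqrtrM ?pi_ge0// sqrtrV ?(ltW ss0)// sqrtr_sqr gtr0_norm.
  have -> : pi / (b / 2) = (2 * pi) * (2 * s) ^+ 2.
    by rewrite /b; field; exact: lt0r_neq0.
  rewrite (sqrtrM _ (_ : 0 <= 2 * pi)) ?mulr_ge0 ?pi_ge0// sqrtr_sqr.
  rewrite (@gtr0_norm _ (2 * s)) ?mulr_gt0//.
  rewrite le_eqVlt; apply/orP; left; apply/eqP; field; exact: lt0r_neq0.
suff : normc (I - ((2 * pi * g v)%:C)%C) = 0.
  by move=> /eq0_normc/eqP; rewrite subr_eq0 => /eqP.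
apply/eqP; rewrite eq_le normc_ge0 andbT; apply/ler_addgt0Pl => eps eps0.
rewrite addr0; set K := \int[mu]_t N t in step1.
set K2 := 4 * L * _ * _ in step2.
have K0 : 0 <= K by apply: Rintegral_ge0 => t _; rewrite mulr_ge0 ?powR_ge0.
have K20 : 0 <= K2 by rewrite !mulr_ge0.
have s0 : 0 < eps / (1 + K + K2) by rewrite divr_gt0// -addrA ltr_pwDl// addr_ge0.
have -> : I - ((2 * pi * g v)%:C)%C = (I - smoothed (eps / (1 + K + K2)) v) +
    (smoothed (eps / (1 + K + K2)) v - ((2 * pi * g v)%:C)%C).
  by rewrite addrA subrK.
apply: le_trans (le_normcD _ _) _.
apply: le_trans (lerD (step1 _ s0) (step2 _ s0)) _.
rewrite -mulrDr mulrAC ler_pdivrMr; last by rewrite -addrA ltr_pwDl// addr_ge0.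
by rewrite ler_wpM2l ?(ltW eps0)// -addrA lerDr.
Qed.

End truncated_power.

(** * Mean square estimates for complex Gaussian averages *)

Section kernel_bound.
Context {R : realType}.
Local Notation mR := (measurableTypeR R).
Local Notation mu := (@lebesgue_measure R).

Lemma dfunV (f : R -> R) (x a : R) : f x != 0 -> is_derive x 1 f a ->
  is_derive x 1 (fun y => (f y)^-1) (- (f x ^- 2) * a).
Proof.
by move=> fx df; exact: (@is_deriveV R f x a 1 fx df).
Qed.

Let p (t : R) : R := 1 + t ^+ 2.

Let p_ge1 t : 1 <= p t. Proof. by rewrite /p lerDl sqr_ge0. Qed.
Let p_gt0 t : 0 < p t. Proof. exact: lt_le_trans (p_ge1 t). Qed.
Let mp : measurable_fun setT (p : mR -> R). Proof. by rewrite /p; meas. Qed.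

Let t_le (t : R) : `|t| <= p t `^ 2^-1.
Proof.
by rewrite powR12_sqrt ?(ltW (p_gt0 t))// -sqrtr_sqr ler_sqrt ?(ltW (p_gt0 t))// lerDr.
Qed.

Let integrable_p (c : R) : 1 / 2 < c ->
  mu.-integrable setT (EFin \o (fun t => p t `^ (- c))).
Proof. exact: integrable_sqr_decay. Qed.

Let expR_p_le1 (S t : R) : 0 <= S -> 0 <= expR (- (S / p t)) <= 1.
Proof.
move=> S0; rewrite expR_ge0/= -expR0 ler_expR oppr_le0 divr_ge0//.
exact: ltW (p_gt0 t).
Qed.

Let integrable_pe (c S : R) : 1 / 2 < c -> 0 <= S ->
  mu.-integrable setT (EFin \o (fun t => p t `^ (- c) * expR (- (S / p t)))).
Proof.
move=> c2 S0; apply: integrable_bounded_mul; first exact: integrable_p.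
  by meas.
by move=> t; rewrite ger0_norm ?expR_ge0//; case/andP: (expR_p_le1 t S0).
Qed.

(** By [expRN_le_powR], exp(-S/p) <= k^k (S/p)^(-k): decay S^(-k) is bought with a factor p^k,
    affordable while c - k > 1/2. *)
Let Rintegral_pe_le (c k : R) : 0 < k -> 1 / 2 < c - k -> exists2 C : R, 0 <= C &
  forall S, 0 < S -> \int[mu]_t (p t `^ (- c) * expR (- (S / p t))) <= C * S `^ (- k).
Proof.
move=> k0 ck; exists (k `^ k * \int[mu]_t p t `^ (- (c - k))).
  by rewrite mulr_ge0 ?powR_ge0//; apply: Rintegral_ge0 => t _; exact: powR_ge0.
move=> S S0; rewrite mulrAC -RintegralZl//; last exact: integrable_p.
apply: le_Rintegral => //.
- by apply: integrable_pe; [lra|exact: ltW].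
- exact: (integrableZl measurableT _ (integrable_p ck)).
move=> t _; have pS : 0 < S / p t by rewrite divr_gt0.
apply: le_trans (ler_wpM2l (powR_ge0 _ _) (expRN_le_powR k0 pS)) _.
rewrite powRM ?(ltW S0) ?invr_ge0 ?(ltW (p_gt0 t))//.
rewrite -[(p t)^-1]powR_inv1 ?(ltW (p_gt0 t))// -powRrM mulN1r opprK.
have -> : - (c - k) = - c + k by ring.
rewrite gt0_powRD// le_eqVlt; apply/orP; left; apply/eqP; ring.
Qed.

(** [b] is the weight available and [b'] the decay obtained. Each use of [Rintegral_pe_le] below has
    c - k = (b - b' + 1)/2 > 1/2, and b' > 1 keeps k > 0. *)
Variables (b b' : R).
Hypotheses (b'1 : 1 < b') (b'b : b' < b).

(* The kernel of the weighted square integral of [heat_quad] over t, with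
   S = Y^2 + Z^2 and D = Y^2 - Z^2 for the two rescaled distances Y and Z. *)
Definition osc_kernel (S D : R) : R :=
  \int[mu]_t (p t `^ (- ((b + 1) / 2)) * expR (- (S / p t)) * cos (D * (t / p t))).

Let i_osc (c S : R) (F : R -> R) : 1 / 2 < c -> 0 <= S ->
  measurable_fun setT (F : mR -> R) -> (forall t, `|F t| <= 1) ->
  mu.-integrable setT (EFin \o (fun t => p t `^ (- c) * expR (- (S / p t)) * F t)).
Proof.
by move=> c2 S0 mF F1; apply: integrable_bounded_mul => //; exact: integrable_pe.
Qed.

Lemma osc_kernel_le S D : 0 <= S -> `|osc_kernel S D| <=
  \int[mu]_t (p t `^ (- ((b + 1) / 2)) * expR (- (S / p t))).
Proof.
move=> S0; have [h1 h2] := (b'1, b'b).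
have c2 : 1 / 2 < (b + 1) / 2 by lra.
have i1 := integrable_pe c2 S0.
have i2 : mu.-integrable setT (EFin \o (fun t =>
    p t `^ (- ((b + 1) / 2)) * expR (- (S / p t)) * cos (D * (t / p t)))).
  by apply: i_osc => // [|t]; [meas|exact: cos_abs_le1].
apply: le_trans (le_normr_Rintegral measurableT i2) _.
apply: le_Rintegral => //.
  exact: (integrable_abse i2).
move=> t _; rewrite normrM ger0_norm ?mulr_ge0 ?powR_ge0 ?expR_ge0//.
by rewrite ler_piMr ?mulr_ge0 ?powR_ge0 ?expR_ge0// cos_abs_le1.
Qed.

(** The remainder of an integration by parts. The phase t/p has derivative 2/p^2 - 1/p.
    Differentiating -p^((1-b)/2) exp(-S/p) sin(D t/p), the part -1/p reproduces D times the
    integrand of [osc_kernel]; minus [bracket] collects the part 2/p^2 and the derivative of the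
    amplitude. The stationary points t = 1 and t = -1 need no separate treatment: the 2/p^2 term
    carries |D| <= S, which the Gaussian decay exp(-S/p) pays for. *)
Let bracket (S D t : R) : R :=
  ((1 - b) * t * p t `^ (- ((b + 1) / 2)) + 2 * t * S * p t `^ (- ((b + 3) / 2))) *
    expR (- (S / p t)) * sin (D * (t / p t)) +
  2 * D * p t `^ (- ((b + 3) / 2)) * expR (- (S / p t)) * cos (D * (t / p t)).

Let mbracket S D : measurable_fun setT (bracket S D : mR -> R).
Proof. by rewrite /bracket; meas. Qed.

Let bracket_le S D t : 0 < S -> `|D| <= S -> `|bracket S D t| <=
  (b - 1) * (p t `^ (- (b / 2)) * expR (- (S / p t))) +
  4 * S * (p t `^ (- ((b + 2) / 2)) * expR (- (S / p t))).
Proof.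
move=> S0 DS; have [h1 h2] := (b'1, b'b); rewrite /bracket.
set s := sin _; set c := cos _; set e := expR _.
have s1 : `|s| <= 1 by exact: sin_abs_le1.
have c1 : `|c| <= 1 by exact: cos_abs_le1.
have e0 : 0 <= e by exact: expR_ge0.
set x := p t `^ (- ((b + 2) / 2)).
(* With r = p^(1/2) the half-integer powers become x r^2, x r, x and x/r, so the estimate is
   elementary algebra in x and r. *)
have [r [r1 tr rE]] : exists r, [/\ 1 <= r, `|t| <= r & p t `^ 2^-1 = r].
  exists (p t `^ 2^-1); split => //.
  by rewrite -[leLHS](powRr0 (p t)); apply: ler_powR => //.
have r0 : 0 < r by exact: lt_le_trans r1.
have x0 : 0 <= x by exact: powR_ge0.
have E1 : p t `^ (- ((b + 1) / 2)) = x * r.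
  by rewrite /x -rE -gt0_powRD//; congr (_ `^ _); lra.
have E2 : p t `^ (- ((b + 3) / 2)) = x / r.
  by rewrite /x -rE -powRN -gt0_powRD//; congr (_ `^ _); lra.
have E3 : p t `^ (- (b / 2)) = x * r * r.
  by rewrite /x -rE -!gt0_powRD//; congr (_ `^ _); lra.
rewrite E1 E2 E3.
have xr : x / r <= x by rewrite ler_piMr// invf_le1.
have txr : `|t| * (x / r) <= x.
  by rewrite mulrCA ler_piMr// ler_pdivrMr// mul1r.
have xr0 : 0 <= x / r by rewrite divr_ge0// ltW.
set A := (1 - b) * t * (x * r) + 2 * t * S * (x / r).
set B := 2 * D * (x / r).
have A1 : `|A| <= (b - 1) * (x * r * r) + 2 * S * x.
  apply: le_trans (ler_normD _ _) _; apply: lerD.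
    rewrite !normrM (distrC 1 b) (@ger0_norm _ (b - 1)); last by lra.
    rewrite (ger0_norm x0) (gtr0_norm r0) -!mulrA ler_wpM2l//; first by lra.
    by rewrite mulrCA ler_wpM2l// mulrC ler_wpM2l// ltW.
  rewrite (_ : 2 * t * S * (x / r) = 2 * S * (t * (x / r))); last by ring.
  rewrite normrM (@ger0_norm _ (2 * S)) ?mulr_ge0 ?(ltW S0)//.
  rewrite ler_wpM2l ?mulr_ge0 ?(ltW S0)// normrM (ger0_norm xr0)//.
have B1 : `|B| <= 2 * S * x.
  rewrite normrM (ger0_norm xr0) normrM (@ger0_norm _ 2)//.
  by apply: ler_pM => //; rewrite ?mulr_ge0// ler_wpM2l.
apply: le_trans (ler_normD _ _) _.
have hA : `|A * e * s| <= `|A| * e.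
  by rewrite !normrM (ger0_norm e0) ler_piMr// mulr_ge0.
have hB : `|B * e * c| <= `|B| * e.
  by rewrite !normrM (ger0_norm e0) ler_piMr// mulr_ge0.
have := ler_wpM2r e0 A1; have := ler_wpM2r e0 B1; lra.
Qed.

Let integrable_bracket S D : 0 < S -> `|D| <= S ->
  mu.-integrable setT (EFin \o bracket S D).
Proof.
move=> S0 DS; have [h1 h2] := (b'1, b'b).
have e1 : 1 / 2 < b / 2 by lra.
have e2 : 1 / 2 < (b + 2) / 2 by lra.
have i1 := integrableZl measurableT (b - 1) (integrable_pe e1 (ltW S0)).
have i2 := integrableZl measurableT (4 * S) (integrable_pe e2 (ltW S0)).
exact: (integrable_le_real (mbracket S D) (integrableD measurableT i1 i2)
  (fun t => bracket_le t S0 DS)).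
Qed.

Let ibp S D : 0 < S -> `|D| <= S ->
  D * osc_kernel S D = \int[mu]_t bracket S D t.
Proof.
move=> S0 DS; have [h1 h2] := (b'1, b'b).
pose k t := p t `^ (- ((b + 1) / 2)) * expR (- (S / p t)) * cos (D * (t / p t)).
have ik : mu.-integrable setT (EFin \o k).
  by apply: i_osc => [|||t]; [lra|exact: ltW|meas|exact: cos_abs_le1].
pose h t := - (p t `^ ((1 - b) / 2) * expR (- (S / p t)) * sin (D * (t / p t))).
pose h' t := D * k t - bracket S D t.
have dp (t : R) : is_derive t 1 p (2 * t).
  apply: (is_derive_eq (dfunD (dfun_cst 1 t) (dfun_sqr t))); exact: add0r.
have dpow (s t : R) := dfun_powR s (p_gt0 t) (dp t).
have dinv (t : R) := dfunV (lt0r_neq0 (p_gt0 t)) (dp t).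
have dE (t : R) := dfun_expR (dfunN (dfunM (dfun_cst S t) (dinv t))).
have dA (t : R) := dfunM (dfun_cst D t) (dfunM (dfun_id t) (dinv t)).
have cpow (s : R) : continuous (fun t : R => p t `^ s) := is_derive_continuous (dpow s).
have cE : continuous (fun t : R => expR (- (S / p t))) := is_derive_continuous dE.
have cc : continuous (fun t : R => cos (D * (t / p t))) :=
  is_derive_continuous (fun t => dfun_cos (dA t)).
have cs : continuous (fun t : R => sin (D * (t / p t))) :=
  is_derive_continuous (fun t => dfun_sin (dA t)).
have iD := integrableZl measurableT D ik.
have ib := integrable_bracket S0 DS.
have I0 : \int[mu]_t h' t = 0.
  have b1 : 0 < b - 1 by lra.
  apply: (@Rintegral_derive_eq0 R h h' (2 `^ ((b - 1) / 2)) (b - 1) b1).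
  - move=> t.
    apply: (is_derive_eq (dfunN (dfunM (dfunM (dpow ((1 - b) / 2) t) (dE t)) (dfun_sin (dA t))))).
    rewrite /h' /k /bracket.
    have -> : (1 - b) / 2 - 1 = - ((b + 1) / 2) by lra.
    have -> : p t `^ ((1 - b) / 2) = p t `^ (- ((b + 1) / 2)) * p t.
      rewrite -[X in _ = _ * X](powRr1 (ltW (p_gt0 t))) -gt0_powRD//.
      by congr (_ `^ _); lra.
    have -> : p t `^ (- ((b + 3) / 2)) = p t `^ (- ((b + 1) / 2)) / p t.
      rewrite -[X in _ = _ / X](powRr1 (ltW (p_gt0 t))) -powRN -gt0_powRD//.
      by congr (_ `^ _); lra.
    set e := expR _; set s := sin _; set c := cos _; set x := _ `^ _.
    have p0 := lt0r_neq0 (p_gt0 t).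
    have tp : t * t = p t - 1 by rewrite /p; ring.
    have -> : t * (- p t ^- 2 * (2 * t)) = - 2 * (p t - 1) / p t ^+ 2.
      by rewrite -tp; field.
    by move: (p t) p0 => q p0; field.
  - apply: continuous_funB.
      apply: continuous_funM; first exact: continuous_fun_cst.
      by apply: continuous_funM => //; exact: continuous_funM.
    apply: continuous_funD; apply: continuous_funM => //; apply: continuous_funM => //.
      apply: continuous_funD; apply: continuous_funM => //; apply: continuous_funM.
      - exact: continuous_fun_cst.
      - exact: continuous_fun_id.
      - by apply: continuous_funM; [exact: continuous_fun_cst|exact: continuous_fun_id].
      - exact: continuous_fun_cst.
    by apply: continuous_funM => //; exact: continuous_fun_cst.
  - exact: (integrableB measurableT iD ib).
  - move=> t; rewrite /h normrN !normrM (ger0_norm (powR_ge0 _ _)).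
    rewrite -[leRHS]mulr1 -mulrA mulr1.
    apply: le_trans (_ : p t `^ ((1 - b) / 2) * 1 <= _).
      rewrite ler_wpM2l ?powR_ge0// mulr_ile1//.
        by rewrite ger0_norm ?expR_ge0//; case/andP: (expR_p_le1 t (ltW S0)).
      exact: sin_abs_le1.
    rewrite mulr1 (_ : (1 - b) / 2 = - ((b - 1) / 2)); last by lra.
    apply: le_trans (sqr_decay_le t _) _; first by lra.
    by rewrite (_ : 2 * ((b - 1) / 2) = b - 1)//; lra.
apply/eqP; rewrite -subr_eq0; apply/eqP; rewrite -[RHS]I0 /h'.
by rewrite RintegralB// RintegralZl.
Qed.

Let osc_kernel_D_le : exists2 C : R, 0 <= C & forall S D, 0 < S -> `|D| <= S ->
  `|D| * `|osc_kernel S D| <= C * S `^ ((1 - b') / 2).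
Proof.
have [h1 h2] := (b'1, b'b).
have [||C1 C10 HC1] := @Rintegral_pe_le (b / 2) ((b' - 1) / 2); [lra|lra|].
have [||C2 C20 HC2] := @Rintegral_pe_le ((b + 2) / 2) ((b' + 1) / 2); [lra|lra|].
exists ((b - 1) * C1 + 4 * C2).
  by rewrite addr_ge0 ?mulr_ge0//; lra.
move=> S D S0 DS; have S0' := ltW S0; rewrite -normrM ibp//.
have e1 : 1 / 2 < b / 2 by lra.
have e2 : 1 / 2 < (b + 2) / 2 by lra.
have i1 := integrableZl measurableT (b - 1) (integrable_pe e1 S0').
have i2 := integrableZl measurableT (4 * S) (integrable_pe e2 S0').
have ib := integrable_bracket S0 DS.
apply: le_trans (le_normr_Rintegral measurableT ib) _.
have := le_Rintegral measurableT (integrable_abse ib) (integrableD measurableT i1 i2)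
  (fun t _ => bracket_le t S0 DS).
move=> /le_trans; apply.
rewrite RintegralD// !RintegralZl//; [|exact: integrable_pe|exact: integrable_pe].
have := HC1 _ S0; have := HC2 _ S0.
have -> : S `^ (- ((b' - 1) / 2)) = S `^ ((1 - b') / 2) by congr (_ `^ _); lra.
have -> : S `^ ((1 - b') / 2) = S * S `^ (- ((b' + 1) / 2)).
  rewrite -[X in _ = X * _](powRr1 S0') -gt0_powRD//; congr (_ `^ _); lra.
set I1 := Rintegral _ _ _; set I2 := Rintegral _ _ _; set y := S `^ _ => k2 k1.
have b1 : 0 <= b - 1 by lra.
have := ler_wpM2l b1 k1; have := ler_wpM2l S0' k2; lra.
Qed.

(** Let q = sqrt(S). For S > 1 the absolute bound gives K <= C q^(-b'), and integration by parts
    gives |D| K <= C q^(1-b'). Since |D| = d (u + v) >= d q, also d K <= C q^(-b'); adding the two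
    gives the factor 1 + d. For S <= 1 everything is bounded. The constant 3^(b') comes from 1 + u +
    v <= 3 in the latter case and 1 + u + v <= 3 q in the former. *)
Lemma osc_kernel_bound : exists2 C : R, 0 < C & forall Y Z : R,
  `|osc_kernel (Y ^+ 2 + Z ^+ 2) (Y ^+ 2 - Z ^+ 2)| <=
  C * (1 + `|Y| + `|Z|) `^ (- b') * (1 + `| `|Y| - `|Z| |)^-1.
Proof.
have [h1 h2] := (b'1, b'b).
have [C1 C10 HC1] := osc_kernel_D_le.
have [||C2 C20 HC2] := @Rintegral_pe_le ((b + 1) / 2) (b' / 2); [lra|lra|].
pose C0 := \int[mu]_t p t `^ (- ((b + 1) / 2)).
have C00 : 0 <= C0 by apply: Rintegral_ge0 => t _; exact: powR_ge0.
have c3 : 0 < 3 `^ b' :> R by exact: powR_gt0.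
exists ((C1 + C2 + 2 * C0 + 1) * 3 `^ b').
  by rewrite mulr_gt0// ltr_wpDl// !addr_ge0// mulr_ge0.
move=> Y Z.
have -> : Y ^+ 2 = `|Y| ^+ 2 by rewrite real_normK ?num_real.
have -> : Z ^+ 2 = `|Z| ^+ 2 by rewrite real_normK ?num_real.
have u0 := normr_ge0 Y; have v0 := normr_ge0 Z.
move: `|Y| `|Z| u0 v0 => u v u0 v0.
set S := u ^+ 2 + v ^+ 2; set D := u ^+ 2 - v ^+ 2.
have S0 : 0 <= S by rewrite addr_ge0 ?sqr_ge0.
have d0 := normr_ge0 (u - v); set d := `|u - v| in d0 *.
have d1 : 0 < 1 + d by rewrite ltr_pwDl.
rewrite ler_pdivlMr//.
have N0 : 0 < 1 + u + v by rewrite -addrA ltr_pwDl// addr_ge0.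
set K := `|osc_kernel S D|.
have K0 : 0 <= K by exact: normr_ge0.
have [S1|S1] := leP S 1.
  have u1 : u <= 1 by rewrite /S in S1; nra.
  have v1 : v <= 1 by rewrite /S in S1; nra.
  have KC : K <= C0.
    apply: le_trans (osc_kernel_le _ S0) _; apply: le_Rintegral => //.
    - by apply: integrable_pe => //; lra.
    - by apply: integrable_p; lra.
    - by move=> t _; rewrite ler_piMr ?powR_ge0//; case/andP: (expR_p_le1 t S0).
  have dle : d <= 1 by rewrite ler_norml; apply/andP; split; lra.
  have N3 : 3 `^ (- b') <= (1 + u + v) `^ (- b').
    by apply: gt0_powRN_anti => //; lra.
  have c3N : 3 `^ b' * 3 `^ (- b') = 1 :> R by rewrite powRN divff// gt_eqF.
  have N3' : 1 <= 3 `^ b' * (1 + u + v) `^ (- b').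
    by rewrite -[leLHS]c3N ler_wpM2l// ltW.
  rewrite -mulrA; apply: le_trans (_ : (C1 + C2 + 2 * C0 + 1) * 1 <= _).
    by nra.
  by rewrite ler_wpM2l// !addr_ge0// mulr_ge0.
have S0' : 0 < S by lra.
pose q := Num.sqrt S.
have q2 : q ^+ 2 = S by rewrite sqr_sqrtr.
have q0 : 0 < q by rewrite sqrtr_gt0.
have q1 : 1 <= q by nra.
have quv : q <= u + v by rewrite -ler_sqr ?nnegrE ?(ltW q0) ?addr_ge0// q2 /S; nra.
have Nq : (1 + u + v) / 3 <= q.
  have : (u + v) ^+ 2 <= (2 * q) ^+ 2 by rewrite exprMn q2 /S; have := sqr_ge0 (u - v); nra.
  rewrite ler_sqr ?nnegrE ?addr_ge0 ?mulr_ge0 ?(ltW q0)// => h.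
  by rewrite ler_pdivrMr//; lra.
have Sq (s : R) : S `^ (s / 2) = q `^ s.
  by rewrite -q2 -powR_mulrn ?(ltW q0)// -powRrM; congr (_ `^ _); field.
have qN : q `^ (- b') <= 3 `^ b' * (1 + u + v) `^ (- b').
  apply: le_trans (gt0_powRN_anti _ Nq _) _; [by rewrite divr_gt0|lra|].
  rewrite powRM ?(ltW N0)// mulrC -[3^-1]powR_inv1// -powRrM mulN1r opprK//.
have DS : `|D| <= S by rewrite ler_norml /D /S; apply/andP; split; nra.
have DE : `|D| = d * (u + v).
  by rewrite /D subr_sqr normrM (@ger0_norm _ (u + v)) ?addr_ge0.
have k1 : K <= C2 * q `^ (- b').
  apply: le_trans (osc_kernel_le _ S0) _; apply: le_trans (HC2 _ S0') _.
  by rewrite -mulNr Sq.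
have k2 : d * K <= C1 * q `^ (- b').
  have := HC1 _ _ S0' DS; rewrite DE Sq -/K.
  rewrite (_ : 1 - b' = - b' + 1); last by ring.
  rewrite gt0_powRD// powRr1 ?(ltW q0)// => h.
  by rewrite -(ler_pM2r q0); have := ler_wpM2l (mulr_ge0 d0 K0) quv; lra.
apply: le_trans (_ : (C1 + C2) * q `^ (- b') <= _); first by lra.
rewrite -mulrA; apply: ler_pM => //; first by rewrite addr_ge0.
- exact: powR_ge0.
- by rewrite -addrA lerDl addr_ge0// mulr_ge0.
Qed.

End kernel_bound.

Section square_function.
Context {R : realType}.
Local Notation mR := (measurableTypeR R).
Local Notation mu := (@lebesgue_measure R).

Lemma powR_ge_id (x q : R) : 1 <= x -> 1 <= q -> x <= x `^ q.
Proof. by move=> x1 q1; rewrite -[leLHS]powRr1 ?(le_trans ler01)//; apply: ler_powR. Qed.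

Lemma powR_le1_anti (x q s : R) : 0 <= x -> x <= 1 -> 0 < q -> q <= s -> x `^ s <= x `^ q.
Proof.
move=> x0 x1 q0 qs; have [->|xn] := eqVneq x 0.
  by rewrite !powR0// gt_eqF// (lt_le_trans q0).
have xp : 0 < x by rewrite lt_neqAle eq_sym xn.
rewrite -[s](subrK q) addrC gt0_powRD// ler_piMr ?powR_ge0//.
have -> : 1 = 1 `^ (s - q) :> R by rewrite powR1.
by apply: powR_homo => //; rewrite subr_ge0.
Qed.

(** If ab >= 1 then ab <= (ab)^q, and the factor k is dropped. If ab < 1 and b <= a, then b <= 1 and
    ab <= a^q: through a when a >= 1, through a^2 when a <= 1, which is where q <= 2 enters. Small
    products thus keep the off-diagonal factor k and involve one power only. *)
Lemma mul_le_powR_interp (a b k q : R) : 0 <= a -> 0 <= b -> 0 <= k -> k <= 1 ->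
  1 <= q -> q <= 2 ->
  a * b * k <= a `^ q * b `^ q + (a `^ q + b `^ q) * k.
Proof.
move=> + + k0 k1 q1 q2.
have q0 : 0 < q by lra.
wlog ab : a b / b <= a.
  move=> h a0 b0; have [ab|/ltW ab] := leP b a; first exact: h.
  by rewrite (mulrC a) (mulrC (a `^ q)) (addrC (a `^ q)); exact: h.
move=> a0 b0; have A0 := powR_ge0 a q; have B0 := powR_ge0 b q.
have [ab1|ab1] := leP 1 (a * b).
  have h : a * b <= a `^ q * b `^ q by rewrite -powRM//; exact: powR_ge_id.
  have : a * b * k <= a * b by rewrite ler_piMr ?mulr_ge0.
  have : 0 <= (a `^ q + b `^ q) * k by rewrite mulr_ge0 ?addr_ge0.
  by lra.
have b1 : b <= 1 by nra.
have h : a * b <= a `^ q.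
  have [a1|/ltW a1] := leP 1 a.
    by apply: le_trans (powR_ge_id a1 q1); rewrite ler_piMr.
  apply: (@le_trans _ _ (a `^ 2)); last exact: powR_le1_anti.
  by rewrite powR_mulrn// expr2 ler_wpM2l.
have := ler_wpM2r k0 h.
have : 0 <= b `^ q * k by rewrite mulr_ge0.
have : 0 <= a `^ q * b `^ q by rewrite mulr_ge0.
by lra.
Qed.

Definition wt (e u : R) : R := (1 + `|u|) `^ (- (1 + e)).

Lemma wt_ge0 e u : 0 <= wt e u. Proof. exact: powR_ge0. Qed.

(* After integration both terms on the right are O(A^(2/q)) when A bounds the
   averages of f^q: in the first each of f(y)^q and f(z)^q is averaged, in the
   second only one of them, against an integrable weight in the other variable. *)
Lemma interp_weight (A q e a b Y Z : R) : 0 < A -> 0 <= a -> 0 <= b -> 1 <= q -> q <= 2 ->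
  0 < e ->
  a * b * ((1 + `|Y| + `|Z|) `^ (- (2 / q + 2 * e)) * (1 + `| `|Y| - `|Z| |)^-1) <=
  A `^ (2 / q - 2) * ((a `^ q * wt e Y) * (b `^ q * wt e Z)) +
  A `^ (2 / q - 1) * ((a `^ q * wt e Y + b `^ q * wt e Z) * wt e (`|Y| - `|Z|)).
Proof.
move=> A0 a0 b0 q1 q2 e0; have q0 : 0 < q by lra.
rewrite /wt; have u0 := normr_ge0 Y; have v0 := normr_ge0 Z.
move: `|Y| `|Z| u0 v0 => u v u0 v0.
set d := `|u - v|; have d0 : 0 <= d by exact: normr_ge0.
have d1 : 0 < 1 + d by rewrite ltr_pwDl.
pose N := 1 + u + v; have N0 : 0 < N by rewrite /N -addrA ltr_pwDl// addr_ge0.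
set k := (1 + d)^-1; have k0 : 0 <= k by rewrite invr_ge0 ltW.
have k1 : k <= 1 by rewrite invf_le1// lerDl.
(* The interpolation is applied to a w and b w with w^q = 1/(A N), so the typical size of f^q at
   distance N is normalised; multiplying back by W^(2/q) undoes w^2. *)
pose W := A * N; have W0 : 0 < W by rewrite mulr_gt0.
pose w := W `^ (- q^-1); have w0 : 0 < w by exact: powR_gt0.
have wq : w `^ q = W^-1.
  by rewrite -powRrM mulNr mulVf ?gt_eqF// powR_inv1// ltW.
have w2 : W `^ (2 / q) * w ^+ 2 = 1.
  rewrite -powR_mulrn ?(ltW w0)// -powRrM -gt0_powRD//.
  by rewrite (_ : 2 / q + - q^-1 * 2%:R = 0) ?powRr0//; ring.
have wp : 0 <= W `^ (2 / q) by exact: powR_ge0.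
have aw : 0 <= a * w by rewrite mulr_ge0// ltW.
have bw : 0 <= b * w by rewrite mulr_ge0// ltW.
have := ler_wpM2l wp (mul_le_powR_interp aw bw k0 k1 q1 q2).
have -> : W `^ (2 / q) * (a * w * (b * w) * k) = a * b * k.
  rewrite [LHS](_ : _ = W `^ (2 / q) * w ^+ 2 * (a * b * k)); last by ring.
  by rewrite w2 mul1r.
rewrite (powRM q a0 (ltW w0)) (powRM q b0 (ltW w0)) wq.
set aq := a `^ q; set bq := b `^ q.
have aq0 : 0 <= aq by exact: powR_ge0.
have bq0 : 0 <= bq by exact: powR_ge0.
set wu := (1 + u) `^ _; set wv := (1 + v) `^ _; set wd := (1 + d) `^ _.
set Nb := N `^ (- (2 / q + 2 * e)) => h.
have Nb0 : 0 <= Nb by exact: powR_ge0.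
have u1 : 0 < 1 + u by rewrite ltr_pwDl.
have v1 : 0 < 1 + v by rewrite ltr_pwDl.
have uN : 1 + u <= N by rewrite /N; lra.
have vN : 1 + v <= N by rewrite /N; lra.
have dN : 1 + d <= N.
  by rewrite /N -addrA lerD2l /d ler_norml; apply/andP; split; lra.
have WE (s : R) : W `^ (2 / q) * W `^ (- s) * Nb = A `^ (2 / q - s) * N `^ (- s - 2 * e).
  rewrite -gt0_powRD// powRM ?(ltW A0) ?(ltW N0)// -mulrA /Nb -gt0_powRD//.
  by congr (_ * _ `^ _); ring.
have e1 : 0 <= 1 + e by lra.
(* The spare 2e in the decay is shared: e for each of the two weights here, and in [hNd] e for one
   weight and e to make the factor in d integrable. *)
have hN2 : N `^ (- 2 - 2 * e) <= wu * wv.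
  rewrite (_ : - 2 - 2 * e = - (1 + e) + - (1 + e)); last by ring.
  by rewrite gt0_powRD// ler_pM ?powR_ge0//; apply: gt0_powRN_anti.
have hNd (x : R) : 0 < x -> x <= N -> N `^ (- 1 - 2 * e) * k <= x `^ (- (1 + e)) * wd.
  move=> x0 xN; rewrite (_ : - 1 - 2 * e = - (1 + e) + - e); last by ring.
  have -> : wd = (1 + d) `^ (- e) * k.
    rewrite /wd /k -[X in _ = _ * X]powR_inv1 ?(ltW d1)// -gt0_powRD//.
    by congr (_ `^ _); ring.
  rewrite gt0_powRD// mulrA ler_wpM2r//.
  by rewrite ler_pM ?powR_ge0//; apply: gt0_powRN_anti => //; exact: ltW.
have W1 : W^-1 = W `^ (- 1) by rewrite powR_inv1// ltW.
have W2 : W `^ (- 1) * W `^ (- 1) = W `^ (- 2).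
  by rewrite -gt0_powRD//; congr (_ `^ _); ring.
have E1 := WE 1; have E2 := WE 2.
have P1 : 0 <= A `^ (2 / q - 1) by exact: powR_ge0.
have P2 : 0 <= A `^ (2 / q - 2) by exact: powR_ge0.
have := ler_wpM2r Nb0 h.
rewrite W1.
have -> : W `^ (2 / q) * (aq * W `^ (- 1) * (bq * W `^ (- 1)) +
   (aq * W `^ (- 1) + bq * W `^ (- 1)) * k) * Nb =
   aq * bq * (W `^ (2 / q) * (W `^ (- 1) * W `^ (- 1)) * Nb) +
   (aq + bq) * (k * (W `^ (2 / q) * W `^ (- 1) * Nb)) by ring.
rewrite W2 E1 E2 => h'.
have t1 : aq * bq * (A `^ (2 / q - 2) * N `^ (- 2 - 2 * e)) <=
    A `^ (2 / q - 2) * (aq * wu * (bq * wv)).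
  rewrite [leRHS](_ : _ = aq * bq * (A `^ (2 / q - 2) * (wu * wv))); last by ring.
  by rewrite ler_wpM2l ?mulr_ge0// ler_wpM2l.
have t2 (x y : R) : 0 <= x -> 0 < y -> y <= N ->
    x * (k * (A `^ (2 / q - 1) * N `^ (- 1 - 2 * e))) <=
    A `^ (2 / q - 1) * (x * y `^ (- (1 + e)) * wd).
  move=> x0 y0 yN.
  rewrite [leRHS](_ : _ = x * (A `^ (2 / q - 1) * (y `^ (- (1 + e)) * wd))); last by ring.
  rewrite ler_wpM2l// mulrCA ler_wpM2l// mulrC; exact: hNd.
have t3 := t2 _ _ aq0 u1 uN; have t4 := t2 _ _ bq0 v1 vN.
rewrite -/wu -/wv in t3 t4.
have -> : a * b * (Nb * k) = a * b * k * Nb by ring.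
apply: le_trans h' _; rewrite [X in _ + X <= _]mulrDl (mulrDl _ _ wd) (mulrDr (A `^ (2 / q - 1))).
by apply: lerD => //; apply: lerD.
Qed.

End square_function.

(** * From the kernel to ball averages *)

Section square_estimate.
Context {R : realType}.
Local Notation mR := (measurableTypeR R).
Local Notation mu := (@lebesgue_measure R).

(* The canonical sigma-finite structure on products found by unification is
   the one of probability measures, hence this copy. *)
Definition plane_measure : set (mR * mR)%type -> \bar R := (mu \x mu)%E.

HB.instance Definition _ := Measure.copy plane_measure (mu \x mu)%E.

Lemma plane_measure_sigma_finite : sigma_finite setT plane_measure.
Proof.
have /sigma_finiteP[F [FT ndF Foo]] := sigma_finiteT mu.
exists (fun n => F n `*` F n).
  rewrite -setXTT FT predeqE => -[x y]; split.
    move=> [/= [n _ Fnx] [k _ Fky]]; exists (maxn n k) => //; split.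
    - by move: x Fnx; exact/subsetPset/ndF/leq_maxl.
    - by move: y Fky; exact/subsetPset/ndF/leq_maxr.
  by move=> [n _ []/= ? ?]; split; exists n.
move=> k; have [? ?] := Foo k.
split; first exact: measurableX.
by rewrite /plane_measure product_measure1E// lte_mul_pinfty// ge0_fin_numE.
Qed.

HB.instance Definition _ := Measure_isSigmaFinite.Build _ _ _
  plane_measure plane_measure_sigma_finite.

(* The Gaussian is exp(- (lam (x - y))^2 / (1 + i t)). *)
Definition heat_quad (f : R -> R[i]) (lam x t : R) : R[i] :=
  cintegral mu (fun y => f y *
    ((expR (- ((lam * (x - y)) ^+ 2 / (1 + t ^+ 2))))%:C%C *
     expi (t * ((lam * (x - y)) ^+ 2 / (1 + t ^+ 2))))).

Lemma wt_scaled_le (e : R) : 0 < e -> exists2 C : R, 0 < C &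
  (forall (g : R -> R) (x A : R), measurable_fun setT (g : mR -> R) ->
    (forall y, 0 <= g y) -> 0 <= A ->
    (forall rho, 0 < rho -> (\int[mu]_(y in ball x rho) (g y)%:E <= (2 * rho * A)%:E)%E) ->
    forall lam, 0 < lam ->
    (\int[mu]_y (g y * wt e (lam * (x - y)))%:E <= (C * lam^-1 * A)%:E)%E) /\
  (forall x c lam, 0 < lam ->
    (\int[mu]_y (wt e (c - `|lam * (x - y)|))%:E <= (C * lam^-1)%:E)%E).
Proof.
move=> e0; have [C C0 HC] := ball_weight_le e0.
have wE lam x y : 0 < lam -> wt e (lam * (x - y)) = (1 + `|x - y| / lam^-1) `^ (- (1 + e)).
  by move=> l0; rewrite /wt normrM gtr0_norm// invrK mulrC.
have mw g : measurable_fun setT (g : mR -> R) ->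
    measurable_fun setT (fun y => wt e (g y) : mR).
  by move=> mg; rewrite /wt; meas.
exists (2 * C); first by rewrite mulr_gt0.
split.
  move=> g x A mg g0 A0 hA lam l0.
  under eq_integral do rewrite wE//.
  apply: le_trans (HC g x A mg g0 A0 hA lam^-1 _) _; first by rewrite invr_gt0.
  rewrite lee_fin ler_wpM2r// ler_wpM2r ?invr_ge0 ?(ltW l0)//.
  by have := ltW C0; lra.
move=> x c lam l0.
have H1 z : (\int[mu]_y (wt e (lam * (z - y)))%:E <= (C * lam^-1)%:E)%E.
  have := HC (cst 1) z 1 (measurable_cst _) (fun _ => ler01) ler01.
  have hb rho : 0 < rho -> (\int[mu]_(y in ball z rho) (cst 1 y)%:E <= (2 * rho * 1)%:E)%E.
    move=> rho0; rewrite [leLHS](_ : _ = (\int[mu]_(y in ball z rho) (cst 1%:E y)))%E//.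
    rewrite integral_cst; last exact: measurable_ball.
    have mb : mu (ball (z : R) rho) = (rho *+ 2)%:E := lebesgue_measure_ball _ (ltW rho0).
    by rewrite mul1e [leLHS]mb mulr1 mulr2n mulrDl !mul1r.
  have l0' : 0 < lam^-1 by rewrite invr_gt0.
  move=> /(_ hb _ l0'); rewrite mulr1.
  by under eq_integral do rewrite mul1r -wE//.
have l1 : lam != 0 by rewrite gt_eqF.
(* The inner absolute value is removed by summing over both signs, which gives two translates
   centred at x - c/lam and x + c/lam; each is the case g = 1 of [ball_weight_le]. *)
apply: (@le_trans _ _ (\int[mu]_y ((wt e (lam * (x - c / lam - y)))%:E +
    (wt e (lam * (x + c / lam - y)))%:E))%E).
  apply: ge0_le_integral => //.
  - by move=> y _; rewrite lee_fin wt_ge0.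
  - by apply/measurable_EFinP; apply: mw; meas.
  - by apply: emeasurable_funD; apply/measurable_EFinP; apply: mw; meas.
  - move=> y _; rewrite -EFinD lee_fin.
    have -> : lam * (x - c / lam - y) = - (c - lam * (x - y)) by field.
    have -> : lam * (x + c / lam - y) = c - - (lam * (x - y)) by field.
    have -> : wt e (- (c - lam * (x - y))) = wt e (c - lam * (x - y)).
      by rewrite /wt normrN.
    case: (ler0P (lam * (x - y))) => _; first by rewrite lerDr wt_ge0.
    by rewrite lerDl wt_ge0.
rewrite ge0_integralD//.
- apply: le_trans (leeD (H1 _) (H1 _)) _.
  by rewrite -EFinD lee_fin; lra.
- by move=> y _; rewrite lee_fin wt_ge0.
- by apply/measurable_EFinP; apply: mw; meas.
- by move=> y _; rewrite lee_fin wt_ge0.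
- by apply/measurable_EFinP; apply: mw; meas.
Qed.

Lemma tonelli_le1 (u : R -> R) (k : R * R -> R) (I c : R) :
  measurable_fun setT (u : mR -> R) -> measurable_fun setT (k : mR * mR -> R) ->
  (forall y, 0 <= u y) -> (forall w, 0 <= k w) -> 0 <= c ->
  (\int[mu]_y (u y)%:E <= I%:E)%E ->
  (forall y, (\int[mu]_z (k (y, z))%:E <= c%:E)%E) ->
  (\int[(mu \x mu)%E]_w (u w.1 * k w)%:E <= (I * c)%:E)%E.
Proof.
move=> mu_ mk u0 k0 c0 hI hc.
have mu1 : measurable_fun setT (fun w : mR * mR => u w.1).
  exact: (measurableT_comp mu_ measurable_fst).
rewrite (@fubini_tonelli1 _ _ mR mR R mu mu (fun w => (u w.1 * k w)%:E)); last 2 first.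
- by apply/measurable_EFinP; exact: measurable_funM.
- by move=> w; rewrite lee_fin mulr_ge0.
apply: (@le_trans _ _ (\int[mu]_y (u y * c)%:E)%E).
  apply: ge0_le_integral => //.
  - by move=> y _; apply: integral_ge0 => z _; rewrite lee_fin mulr_ge0.
  - apply: (@measurable_fun_fubini_tonelli_F _ _ mR mR R mu (fun w => (u w.1 * k w)%:E)).
      by apply/measurable_EFinP; exact: measurable_funM.
    by move=> w; rewrite lee_fin mulr_ge0.
  - by apply/measurable_EFinP; apply: measurable_funM => //; exact: measurable_cst.
  - move=> y _; rewrite /fubini_F /=; under eq_integral do rewrite EFinM.
    rewrite ge0_integralZl ?lee_fin//; [by rewrite EFinM lee_wpmul2l ?lee_fin| |].
    - by apply/measurable_EFinP; exact: (measurableT_comp mk (pair1_measurable y)).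
    - by move=> z _; rewrite lee_fin.
under eq_integral do rewrite EFinM.
rewrite ge0_integralZr ?lee_fin//;
  [by rewrite EFinM lee_wpmul2r ?lee_fin|exact/measurable_EFinP|by move=> y _; rewrite lee_fin].
Qed.

Lemma tonelli_le2 (u : R -> R) (k : R * R -> R) (I c : R) :
  measurable_fun setT (u : mR -> R) -> measurable_fun setT (k : mR * mR -> R) ->
  (forall y, 0 <= u y) -> (forall w, 0 <= k w) -> 0 <= c ->
  (\int[mu]_y (u y)%:E <= I%:E)%E ->
  (forall z, (\int[mu]_y (k (y, z))%:E <= c%:E)%E) ->
  (\int[(mu \x mu)%E]_w (u w.2 * k w)%:E <= (I * c)%:E)%E.
Proof.
move=> mu_ mk u0 k0 c0 hI hc.
have mu2 : measurable_fun setT (fun w : mR * mR => u w.2).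
  exact: (measurableT_comp mu_ measurable_snd).
have mk' : measurable_fun setT ((fun w => k (w.2, w.1)) : mR * mR -> R).
  by apply: (measurableT_comp mk); exact: measurable_swap.
rewrite (@fubini_tonelli2 _ _ mR mR R mu mu (fun w => (u w.2 * k w)%:E)); last 2 first.
- by apply/measurable_EFinP; exact: measurable_funM.
- by move=> w; rewrite lee_fin mulr_ge0.
rewrite -(@fubini_tonelli1 _ _ mR mR R mu mu (fun w => (u w.1 * k (w.2, w.1))%:E)); last 2 first.
- apply/measurable_EFinP; apply: measurable_funM => //.
  exact: (measurableT_comp mu_ measurable_fst).
- by move=> w; rewrite lee_fin mulr_ge0.
exact: (@tonelli_le1 u (fun w => k (w.2, w.1))).
Qed.

(** Expanding the square gives f(y) f(z) exp(-(Y^2 + Z^2)/p) cos((Y^2 - Z^2) t/p) with Y = lam (x -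
    y) and Z = lam (x - z), the cosine alone because f is real. Integrating first in t leaves f(y)
    f(z) [osc_kernel], which [osc_kernel_bound] and [interp_weight] reduce to weighted integrals of
    |f|^q. *)
Lemma real_square_estimate (q b : R) : 1 <= q -> q <= 2 -> 2 / q < b ->
  exists2 C : R, 0 < C &
  forall (f : R -> R) (x A lam : R), measurable_fun setT (f : mR -> R) ->
  mu.-integrable setT (EFin \o f) -> 0 < A -> 0 < lam ->
  (forall rho, 0 < rho ->
    (\int[mu]_(y in ball x rho) (`|f y| `^ q)%:E <= (2 * rho * A)%:E)%E) ->
  \int[mu]_t ((1 + t ^+ 2) `^ (- ((b + 1) / 2)) *
     normc (heat_quad (fun y => (f y)%:C%C) lam x t) ^+ 2) <=
  C * lam ^- 2 * A `^ (2 / q).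
Proof.
move=> q1 q2 qb; have q0 : 0 < q by lra.
have iq : 1 <= 2 / q by rewrite ler_pdivlMr// mul1r.
(* With this [e], b' is the midpoint of 2/q and b, and 2/q + 2e is the decay that [interp_weight]
   consumes. *)
pose e := (b - 2 / q) / 4; have e0 : 0 < e by rewrite divr_gt0// subr_gt0.
pose b' := 2 / q + 2 * e.
have b'1 : 1 < b' by rewrite /b'; lra.
have b'b : b' < b by rewrite /b' /e; lra.
have [C0 C00 HK] := osc_kernel_bound b'1 b'b.
have [C1 C10 [HW1 HW2]] := wt_scaled_le e0.
(* One C1^2 from the product of two averages, two from the symmetric pair of mixed terms. *)
exists (C0 * (3 * C1 ^+ 2)); first by rewrite !mulr_gt0// exprn_gt0.
move=> f x A lam mf intf A0 l0 hA.
pose Y y := lam * (x - y).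
have mY : measurable_fun setT (Y : mR -> R) by rewrite /Y; meas.
pose p (t : R) : R := 1 + t ^+ 2.
have p1 t : 1 <= p t by rewrite /p lerDl sqr_ge0.
have p0 t : 0 < p t by exact: lt_le_trans (p1 t).
pose h t := p t `^ (- ((b + 1) / 2)).
have h0 t : 0 <= h t by exact: powR_ge0.
have h1 t : h t <= 1.
  by rewrite /h powRN invf_le1 ?powR_gt0// -[leLHS](powRr0 (p t)) ler_powR//; lra.
have ih : mu.-integrable setT (EFin \o h) by apply: integrable_sqr_decay; lra.
pose G y := `|f y|; have mG : measurable_fun setT (G : mR -> R) by rewrite /G; meas.
have iG : mu.-integrable setT (EFin \o G) by exact: (integrable_abse intf).
have G0 y : 0 <= G y by exact: normr_ge0.
pose F (w : mR * mR * mR) := f w.1.1 * f w.1.2 * (h w.2 *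
  expR (- ((Y w.1.1 ^+ 2 + Y w.1.2 ^+ 2) / p w.2)) *
  cos ((Y w.1.1 ^+ 2 - Y w.1.2 ^+ 2) * (w.2 / p w.2))).
have mf11 : measurable_fun setT (fun w : mR * mR * mR => f w.1.1).
  by apply: measurableT_comp => //; exact: measurableT_comp measurable_fst measurable_fst.
have mf12 : measurable_fun setT (fun w : mR * mR * mR => f w.1.2).
  by apply: measurableT_comp => //; exact: measurableT_comp measurable_snd measurable_fst.
have mY11 : measurable_fun setT (fun w : mR * mR * mR => Y w.1.1).
  by apply: measurableT_comp => //; exact: measurableT_comp measurable_fst measurable_fst.
have mY12 : measurable_fun setT (fun w : mR * mR * mR => Y w.1.2).
  by apply: measurableT_comp => //; exact: measurableT_comp measurable_snd measurable_fst.
have mp : measurable_fun setT (fun w : mR * mR * mR => p w.2).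
  by rewrite /p; meas.
have mF : measurable_fun setT F by rewrite /F /h; meas.
have Fle w t : `|F (w, t)| <= G w.1 * G w.2 * h t.
  rewrite /F /G /= !normrM -mulrA -[leRHS]mulrA ler_wpM2l// ler_wpM2l//.
  rewrite -mulrA (ger0_norm (h0 t)) ler_piMr//.
  rewrite mulr_ile1// ?cos_abs_le1// ger0_norm ?expR_ge0// -expR0 ler_expR oppr_le0.
  by rewrite divr_ge0 ?addr_ge0 ?sqr_ge0// ltW.
have iGG : (mu \x mu)%E.-integrable setT (EFin \o (fun w : mR * mR => G w.1 * G w.2)).
  have mG1 : measurable_fun setT (fun w : mR * mR => G w.1).
    exact: (measurableT_comp mG measurable_fst).
  have mG2 : measurable_fun setT (fun w : mR * mR => G w.2).
    exact: (measurableT_comp mG measurable_snd).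
  have mGG : measurable_fun setT (fun w : mR * mR => G w.1 * G w.2).
    exact: measurable_funM.
  apply: (@integrable_prod_dominated _ _ _ mR mR mu mu G G iG iG) => //.
  by move=> y z; rewrite ger0_norm// mulr_ge0 ?G0.
have Y2E y t : 0 <= Y y ^+ 2 / p t by rewrite divr_ge0 ?sqr_ge0// ltW.
have S1 t : h t * normc (heat_quad (fun y => (f y)%:C%C) lam x t) ^+ 2 =
    \int[(mu \x mu)%E]_w F (w, t).
  pose E y := expR (- (Y y ^+ 2 / p t)).
  pose a y := f y * (E y * cos (t * (Y y ^+ 2 / p t))).
  pose s y := f y * (E y * sin (t * (Y y ^+ 2 / p t))).
  have E1 y : `|E y| <= 1.
    by rewrite ger0_norm ?expR_ge0// -expR0 ler_expR oppr_le0.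
  have ia : mu.-integrable setT (EFin \o a).
    apply: integrable_bounded_mul => //; first by rewrite /E; meas.
    by move=> y; rewrite normrM mulr_ile1// cos_abs_le1.
  have is_ : mu.-integrable setT (EFin \o s).
    apply: integrable_bounded_mul => //; first by rewrite /E; meas.
    by move=> y; rewrite normrM mulr_ile1// sin_abs_le1.
  have -> : normc (heat_quad (fun y => (f y)%:C%C) lam x t) ^+ 2 =
      (\int[mu]_y a y) ^+ 2 + (\int[mu]_y s y) ^+ 2.
    rewrite normc_sqr /heat_quad /cintegral /=; congr (_ ^+ 2 + _ ^+ 2).
      by apply: eq_Rintegral => y _; rewrite !mul0r !subr0.
    by apply: eq_Rintegral => y _; rewrite !mul0r !addr0.
  have mFt : measurable_fun setT (fun w => F (w, t) : mR).
    exact: (measurableT_comp mF (pair2_measurable t)).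
  rewrite (@Rintegral_prod_dominated R _ _ mR mR mu mu G G (fun w => F (w, t)))//; last first.
    move=> y z; apply: le_trans (Fle _ _) _.
    by rewrite ler_piMr// mulr_ge0 ?G0.
  (* The addition formula for the cosine separates y from z, so the double integral is a sum of two
     squares. *)
  have Fyz y z : F (y, z, t) = h t * a y * a z + h t * s y * s z.
    rewrite /F /a /s /E /=.
    have -> : expR (- ((Y y ^+ 2 + Y z ^+ 2) / p t)) =
        expR (- (Y y ^+ 2 / p t)) * expR (- (Y z ^+ 2 / p t)).
      by rewrite -expRD; congr expR; ring.
    have -> : (Y y ^+ 2 - Y z ^+ 2) * (t / p t) =
        t * (Y y ^+ 2 / p t) - t * (Y z ^+ 2 / p t) by ring.
    by rewrite cosB; ring.
  have inner y : \int[mu]_z (h t * a y * a z + h t * s y * s z) =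
      (h t * \int[mu]_z a z) * a y + (h t * \int[mu]_z s z) * s y.
    rewrite RintegralD//; [|exact: (integrableZl measurableT _ ia)|exact: (integrableZl measurableT _ is_)].
    by rewrite !RintegralZl//; ring.
  transitivity (\int[mu]_y ((h t * \int[mu]_z a z) * a y + (h t * \int[mu]_z s z) * s y)); last first.
    apply: eq_Rintegral => y _; rewrite -inner.
    by apply: eq_Rintegral => z _; rewrite Fyz.
  rewrite RintegralD//; [|exact: (integrableZl measurableT _ ia)|exact: (integrableZl measurableT _ is_)].
  by rewrite !RintegralZl//; ring.
rewrite (_ : \int[mu]_t _ = \int[mu]_t \int[(mu \x mu)%E]_w F (w, t)); last first.
  by apply: eq_Rintegral => t _; exact: S1.
have GG0 (w : mR * mR) : 0 <= G w.1 * G w.2 by rewrite mulr_ge0 ?G0.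
rewrite -(@Rfubini_dominated R _ _ (mR * mR)%type mR plane_measure mu _ h iGG ih GG0 h0 F mF Fle).
pose K w := osc_kernel b (Y w.1 ^+ 2 + Y w.2 ^+ 2) (Y w.1 ^+ 2 - Y w.2 ^+ 2).
have FK w : \int[mu]_t F (w, t) = f w.1 * f w.2 * K w.
  rewrite /F /= RintegralZl//.
  apply: integrable_bounded_mul.
  - apply: integrable_bounded_mul => //; first by rewrite /p; meas.
    move=> t; rewrite ger0_norm ?expR_ge0// -expR0 ler_expR oppr_le0.
    by rewrite divr_ge0 ?addr_ge0 ?sqr_ge0// ltW.
  - by rewrite /p; meas.
  - by move=> t; exact: cos_abs_le1.
pose Phi w := \int[mu]_t F (w, t).
have mPhi : measurable_fun setT (Phi : mR * mR -> R).
  exact: (@measurable_Rintegral_dominated R _ _ (mR * mR)%type mR plane_measure mu _ h iGG ih GG0 h0 F mF Fle).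
pose g y := `|f y| `^ q * wt e (Y y).
have g0 y : 0 <= g y by rewrite mulr_ge0 ?powR_ge0 ?wt_ge0.
have mg : measurable_fun setT (g : mR -> R) by rewrite /g /wt; meas.
pose k (w : R * R) := wt e (`|Y w.1| - `|Y w.2|).
have k0 w : 0 <= k w by exact: wt_ge0.
have mk : measurable_fun setT (k : mR * mR -> R).
  by rewrite /k /wt /Y; meas.
pose B (w : R * R) := A `^ (2 / q - 2) * (g w.1 * g w.2) +
   A `^ (2 / q - 1) * ((g w.1 + g w.2) * k w).
have PhiB w : `|Phi w| <= C0 * B w.
  rewrite /Phi FK !normrM.
  apply: le_trans (ler_wpM2l _ (HK (Y w.1) (Y w.2))) _; first by rewrite mulr_ge0.
  set u := `|f w.1|; set v := `|f w.2|; set N := _ `^ _; set d := _^-1.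
  have -> : u * v * (C0 * N * d) = C0 * (u * v * (N * d)) by ring.
  by rewrite ler_wpM2l ?(ltW C00)//; exact: (interp_weight _ _ A0 (normr_ge0 (f w.1)) (normr_ge0 (f w.2)) q1 q2 e0).
have iPhi : (mu \x mu)%E.-integrable setT (EFin \o Phi).
  have hC : (mu \x mu)%E.-integrable setT (EFin \o (fun w : mR * mR => C0 * (G w.1 * G w.2))).
    exact: (integrableZl measurableT _ iGG).
  apply: (integrable_le_real mPhi hC) => w.
  rewrite /Phi FK !normrM mulrC ler_wpM2r ?mulr_ge0//.
  apply: le_trans (HK _ _) _; rewrite -mulrA ler_piMr ?(ltW C00)//.
  rewrite mulr_ile1 ?powR_ge0 ?invr_ge0 ?addr_ge0//.
    have n1 : 1 <= 1 + `|Y w.1| + `|Y w.2| by rewrite -addrA lerDl addr_ge0.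
    rewrite -[leRHS](powRr0 (1 + `|Y w.1| + `|Y w.2|)); apply: ler_powR => //.
    by rewrite oppr_le0; lra.
  by rewrite invf_le1 ?ltr_pwDl// lerDl.
pose c1 := C1 * lam^-1 * A.
have c10 : 0 <= c1 by rewrite !mulr_ge0 ?invr_ge0// ltW.
have Ig : (\int[mu]_y (g y)%:E <= c1%:E)%E.
  by apply: HW1 => //; [meas|exact: ltW].
have c20 : 0 <= C1 * lam^-1 by rewrite mulr_ge0 ?invr_ge0// ltW.
have T1 : (\int[(mu \x mu)%E]_w (g w.1 * g w.2)%:E <= (c1 * c1)%:E)%E.
  apply: (@tonelli_le1 g (fun w => g w.2)) => //.
  exact: (measurableT_comp mg measurable_snd).
have T2 : (\int[(mu \x mu)%E]_w (g w.1 * k w)%:E <= (c1 * (C1 * lam^-1))%:E)%E.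
  have HW2' y : (\int[mu]_z (k (y, z))%:E <= (C1 * lam^-1)%:E)%E.
    exact: (HW2 x `|Y y| lam l0).
  exact: (tonelli_le1 mg mk g0 k0 c20 Ig HW2').
have T3 : (\int[(mu \x mu)%E]_w (g w.2 * k w)%:E <= (c1 * (C1 * lam^-1))%:E)%E.
  have HW2' z : (\int[mu]_y (k (y, z))%:E <= (C1 * lam^-1)%:E)%E.
    apply: le_trans (HW2 x `|Y z| lam l0); rewrite le_eqVlt; apply/orP; left.
    by apply/eqP/eq_integral => y _; rewrite /k /wt distrC.
  exact: (tonelli_le2 mg mk g0 k0 c20 Ig HW2').
have mg1 : measurable_fun setT (fun w : mR * mR => g w.1).
  exact: (measurableT_comp mg measurable_fst).
have mg2 : measurable_fun setT (fun w : mR * mR => g w.2).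
  exact: (measurableT_comp mg measurable_snd).
have IB : (\int[(mu \x mu)%E]_w (C0 * B w)%:E <=
    (C0 * (A `^ (2 / q - 2) * (c1 * c1) + A `^ (2 / q - 1) *
      (c1 * (C1 * lam^-1) + c1 * (C1 * lam^-1))))%:E)%E.
  have P1 := powR_ge0 A (2 / q - 1); have P2 := powR_ge0 A (2 / q - 2).
  have m1 : measurable_fun setT (fun w : mR * mR => (g w.1 * g w.2)%:E).
    by apply/measurable_EFinP; exact: measurable_funM.
  have m2 : measurable_fun setT (fun w : mR * mR => (g w.1 * k w)%:E).
    by apply/measurable_EFinP; exact: measurable_funM.
  have m3 : measurable_fun setT (fun w : mR * mR => (g w.2 * k w)%:E).
    by apply/measurable_EFinP; exact: measurable_funM.
  have z1 (w : mR * mR) : (0 <= (g w.1 * g w.2)%:E)%E by rewrite lee_fin mulr_ge0.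
  have z2 (w : mR * mR) : (0 <= (g w.1 * k w)%:E)%E by rewrite lee_fin mulr_ge0.
  have z3 (w : mR * mR) : (0 <= (g w.2 * k w)%:E)%E by rewrite lee_fin mulr_ge0.
  have BE : (\int[(mu \x mu)%E]_w (C0 * B w)%:E = \int[(mu \x mu)%E]_w
     (C0%:E * ((A `^ (2 / q - 2))%:E * (g w.1 * g w.2)%:E +
     (A `^ (2 / q - 1))%:E * ((g w.1 * k w)%:E + (g w.2 * k w)%:E))))%E.
    by apply: eq_integral => w _; rewrite /B (mulrDl (g w.1)).
  rewrite BE.
  have m23 : measurable_fun setT (fun w : mR * mR => ((g w.1 * k w)%:E + (g w.2 * k w)%:E)%E).
    exact: emeasurable_funD.
  have z23 (w : mR * mR) : (0 <= ((g w.1 * k w)%:E + (g w.2 * k w)%:E))%E by rewrite adde_ge0.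
  have n1 : measurable_fun setT (fun w : mR * mR =>
      (A `^ (2 / q - 2))%:E * (g w.1 * g w.2)%:E)%E by exact: measurable_funeM.
  have n2 : measurable_fun setT (fun w : mR * mR =>
      (A `^ (2 / q - 1))%:E * ((g w.1 * k w)%:E + (g w.2 * k w)%:E))%E by exact: measurable_funeM.
  have y1 (w : mR * mR) : (0 <= (A `^ (2 / q - 2))%:E * (g w.1 * g w.2)%:E)%E.
    by rewrite mule_ge0// lee_fin.
  have y2 (w : mR * mR) : (0 <= (A `^ (2 / q - 1))%:E *
      ((g w.1 * k w)%:E + (g w.2 * k w)%:E))%E by rewrite mule_ge0// lee_fin.
  rewrite ge0_integralZl//; last 3 first.
  - exact: emeasurable_funD.
  - by move=> w _; rewrite adde_ge0.
  - by rewrite lee_fin ltW.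
  rewrite [leRHS]EFinM lee_wpmul2l ?lee_fin ?(ltW C00)//.
  rewrite ge0_integralD// EFinD; apply: leeD.
    by rewrite ge0_integralZl ?lee_fin// EFinM lee_wpmul2l// lee_fin.
  rewrite ge0_integralZl ?lee_fin// EFinM lee_wpmul2l// ?lee_fin//.
  rewrite (ge0_integralD _ measurableT _ m2 _ m3); [|by move=> w _|by move=> w _].
  exact: (leeD T2 T3).
have lePhi : (\int[(mu \x mu)%E]_w (Phi w)%:E <= \int[(mu \x mu)%E]_w (C0 * B w)%:E)%E.
  apply: (@le_trans _ _ (\int[(mu \x mu)%E]_w `|(Phi w)%:E|)%E).
    apply: le_trans (lee_abs _) _; apply: le_abse_integral => //.
    exact/measurable_EFinP.
  apply: ge0_le_integral => //.
  - by apply: measurableT_comp => //; exact/measurable_EFinP.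
  - by apply/measurable_EFinP; rewrite /B; meas.
  - by move=> w _; rewrite lee_fin.
rewrite -lee_fin {1}/Rintegral fineK; last exact: integrable_fin_num.
apply: le_trans lePhi _; apply: le_trans IB _.
rewrite lee_fin le_eqVlt; apply/orP; left; apply/eqP.
have -> : A `^ (2 / q) = A `^ (2 / q - 2) * A ^+ 2.
  by rewrite -powR_mulrn ?(ltW A0)// -gt0_powRD//; congr (_ `^ _); ring.
have -> : A `^ (2 / q - 1) = A `^ (2 / q - 2) * A.
  by rewrite -[X in _ = _ * X](powRr1 (ltW A0)) -gt0_powRD//; congr (_ `^ _); ring.
by rewrite /c1; field; rewrite gt_eqF.
Qed.

End square_estimate.

Section measurable_parametric.
Context {R : realType} {d1 d2} {T1 : measurableType d1} {T2 : measurableType d2}.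

(** Measurability in x does not depend on the measure put on x: with the Dirac mass at [x0] the
    constant 1 is integrable, and [h] alone is a product majorant. *)
Lemma cmeasurable_cintegral (m2 : {sigma_finite_measure set T2 -> \bar R})
    (F : T1 * T2 -> R[i]) (h : T2 -> R) (x0 : T1) :
  cmeasurable F -> m2.-integrable setT (EFin \o h) -> 
  (forall x y, normc (F (x, y)) <= h y) ->
  cmeasurable (fun x => cintegral m2 (fun y => F (x, y))).
Proof.
move=> mF ih leF.
have i1 : (\d_x0 : {sigma_finite_measure set T1 -> \bar R}).-integrable setT (EFin \o cst (1 : R)).
  apply/integrableP; split; first by apply/measurable_EFinP; exact: measurable_cst.
  by rewrite /= integral_dirac//= diracT mul1e normr1 ltry.
apply: (@cmeasurable_cintegral_dominated R _ _ T1 T2 \d_x0 m2 (cst 1) h i1 ih _ _ F mF) => //.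
- by move=> y; apply: le_trans (normc_ge0 _) (leF x0 y).
- by move=> x y; rewrite mul1r.
Qed.

End measurable_parametric.

(** * Complex-valued functions and the pointwise bound in t *)

Section heat_bounds.
Context {R : realType}.
Local Notation mR := (measurableTypeR R).
Local Notation mu := (@lebesgue_measure R).

Variables (f : R -> R[i]).
Hypotheses (mf : cmeasurable (f : mR -> R[i]))
  (intf : mu.-integrable setT (EFin \o (fun y => normc (f y)))).

Let hq_meas lam x : cmeasurable (fun w : mR * mR => f w.2 *
    ((expR (- ((lam * (x - w.2)) ^+ 2 / (1 + w.1 ^+ 2))))%:C%C *
     expi (w.1 * ((lam * (x - w.2)) ^+ 2 / (1 + w.1 ^+ 2))))).
Proof.
apply: cmeasurableM.
  by case: mf => m1 m2; split; [exact: (measurableT_comp m1 measurable_snd)|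
    exact: (measurableT_comp m2 measurable_snd)].
by apply: cmeasurableM; [apply: cmeasurable_real|apply: cmeasurable_expi]; meas.
Qed.

Let expR_le1 (y t : R) : expR (- (y ^+ 2 / (1 + t ^+ 2))) <= 1.
Proof. by rewrite -expR0 ler_expR oppr_le0 divr_ge0 ?sqr_ge0// addr_ge0 ?sqr_ge0. Qed.

Let hq_normE lam x t y : normc (f y *
    ((expR (- ((lam * (x - y)) ^+ 2 / (1 + t ^+ 2))))%:C%C *
     expi (t * ((lam * (x - y)) ^+ 2 / (1 + t ^+ 2))))) =
  normc (f y) * expR (- ((lam * (x - y)) ^+ 2 / (1 + t ^+ 2))).
Proof. by rewrite !normcM normc_expi mulr1 normc_real ger0_norm ?expR_ge0. Qed.

Lemma cmeasurable_heat_quad lam x : cmeasurable (heat_quad f lam x : mR -> R[i]).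
Proof.
apply: (@cmeasurable_cintegral R _ _ mR mR mu _ _ (0 : R) (hq_meas lam x) intf) => t y /=.
by rewrite hq_normE ler_piMr ?normc_ge0.
Qed.

Lemma cintegrable_heat_quad lam x t : cintegrable mu (fun y => f y *
    ((expR (- ((lam * (x - y)) ^+ 2 / (1 + t ^+ 2))))%:C%C *
     expi (t * ((lam * (x - y)) ^+ 2 / (1 + t ^+ 2))))).
Proof.
apply: (cintegrable_le _ intf) => [|y]; last by rewrite hq_normE ler_piMr ?normc_ge0.
have [m1 m2] := hq_meas lam x.
by split; [exact: (measurableT_comp m1 (pair1_measurable t))|
  exact: (measurableT_comp m2 (pair1_measurable t))].
Qed.

Lemma heat_quad_le lam x t : normc (heat_quad f lam x t) <= \int[mu]_y normc (f y).
Proof.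
have [i1 i2] := cintegrable_heat_quad lam x t.
apply: normc_cintegral_le => //.
- by split; apply/measurable_EFinP; [case/integrableP: i1|case/integrableP: i2].
- by move=> y; rewrite hq_normE ler_piMr ?normc_ge0.
Qed.

Lemma normc_imag : normc (0 +i* 1 : R[i])%C = 1.
Proof. by rewrite /= expr0n expr1n/= add0r sqrtr1. Qed.

Lemma normcD_sqr_le (z w : R[i]) :
  normc (z + w) ^+ 2 <= 2 * (normc z ^+ 2 + normc w ^+ 2).
Proof.
apply: (@le_trans _ _ ((normc z + normc w) ^+ 2)).
  by rewrite lerXn2r ?nnegrE ?addr_ge0 ?normc_ge0// le_normcD.
rewrite -subr_ge0 [X in 0 <= X](_ : _ = (normc z - normc w) ^+ 2) ?sqr_ge0//.
by ring.
Qed.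

Lemma heat_quad_ReIm lam x t : heat_quad f lam x t =
  heat_quad (fun y => (complex.Re (f y))%:C%C) lam x t +
  (0 +i* 1)%C * heat_quad (fun y => (complex.Im (f y))%:C%C) lam x t.
Proof.
have [m1 m2] := mf.
pose E y := (expR (- ((lam * (x - y)) ^+ 2 / (1 + t ^+ 2))))%:C%C *
     expi (t * ((lam * (x - y)) ^+ 2 / (1 + t ^+ 2))).
have mE : cmeasurable (E : mR -> R[i]).
  by apply: cmeasurableM; [apply: cmeasurable_real|apply: cmeasurable_expi]; meas.
have E1 y : normc (E y) <= 1.
  by rewrite /E normcM normc_expi mulr1 normc_real ger0_norm ?expR_ge0.
have i1 : cintegrable mu (fun y => (complex.Re (f y))%:C%C * E y).
  apply: (cintegrable_le _ intf) => [|y].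
    by apply: cmeasurableM => //; exact: cmeasurable_real.
  rewrite normcM normc_real; apply: le_trans (normr_Re_le (f y)).
  by rewrite ler_piMr.
have i2 : cintegrable mu (fun y => (complex.Im (f y))%:C%C * E y).
  apply: (cintegrable_le _ intf) => [|y].
    by apply: cmeasurableM => //; exact: cmeasurable_real.
  rewrite normcM normc_real; apply: le_trans (normr_Im_le (f y)).
  by rewrite ler_piMr.
have i3 : cintegrable mu (fun y => (0 +i* 1)%C * ((complex.Im (f y))%:C%C * E y)).
  apply: (cintegrable_le _ intf) => [|y].
    apply: cmeasurableM; first exact: cmeasurable_cst.
    by apply: cmeasurableM => //; exact: cmeasurable_real.
  rewrite normcM normc_imag mul1r normcM normc_real.
  by apply: le_trans (normr_Im_le (f y)); rewrite ler_piMr.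
rewrite /heat_quad -cintegralZl// -cintegralD//.
have key (z w : R[i]) : z * w = (complex.Re z)%:C%C * w +
    (0 +i* 1)%C * ((complex.Im z)%:C%C * w).
  by case: z w => [a b] [c d]; apply: complexP => /=; ring.
by apply: eq_cintegral => y; exact: key.
Qed.

End heat_bounds.

Section heat_estimates.
Context {R : realType}.
Local Notation mR := (measurableTypeR R).
Local Notation mu := (@lebesgue_measure R).

Lemma square_estimate (q b : R) : 1 <= q -> q <= 2 -> 2 / q < b ->
  exists2 C : R, 0 < C &
  forall (f : R -> R[i]) (x A lam : R), cmeasurable (f : mR -> R[i]) ->
  mu.-integrable setT (EFin \o (fun y => normc (f y))) -> 0 < A -> 0 < lam ->
  (forall rho, 0 < rho ->
    (\int[mu]_(y in ball x rho) (normc (f y) `^ q)%:E <= (2 * rho * A)%:E)%E) ->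
  \int[mu]_t ((1 + t ^+ 2) `^ (- ((b + 1) / 2)) * normc (heat_quad f lam x t) ^+ 2) <=
  C * lam ^- 2 * A `^ (2 / q).
Proof.
move=> q1 q2 qb; have [C C0 HC] := real_square_estimate q1 q2 qb.
(* A factor 2 from |a + ib|^2 <= 2 (|a|^2 + |b|^2) for complex a and b, and one copy of C for each
   of the real and imaginary parts of f. *)
exists (4 * C); first by rewrite mulr_gt0.
move=> f x A lam mf intf A0 l0 hA.
have q0 : 0 < q by lra.
have iq : 1 <= 2 / q by rewrite ler_pdivlMr// mul1r.
pose h (t : R) := (1 + t ^+ 2) `^ (- ((b + 1) / 2)).
have h0 t : 0 <= h t by exact: powR_ge0.
have ih : mu.-integrable setT (EFin \o h) by apply: integrable_sqr_decay; lra.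
have [m1 m2] := mf.
have part (P : R[i] -> R) : (forall z, `|P z| <= normc z) ->
    measurable_fun setT (fun y : mR => P (f y)) ->
  [/\ \int[mu]_t (h t * normc (heat_quad (fun y => (P (f y))%:C%C) lam x t) ^+ 2) <=
      C * lam ^- 2 * A `^ (2 / q) & 
      mu.-integrable setT (EFin \o (fun t =>
        h t * normc (heat_quad (fun y => (P (f y))%:C%C) lam x t) ^+ 2))].
  move=> Ple mP.
  have iP : mu.-integrable setT (EFin \o (fun y => P (f y))).
    exact: (integrable_le_real mP intf (fun y => Ple (f y))).
  have iP' : mu.-integrable setT (EFin \o (fun y => normc ((P (f y))%:C%C))).
    under eq_fun do rewrite normc_real.
    exact: (integrable_abse iP).
  have mP' : cmeasurable (fun y : mR => (P (f y))%:C%C) by exact: cmeasurable_real.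
  split.
    apply: HC => // rho rho0; apply: le_trans (hA rho rho0).
    apply: ge0_le_integral => //.
    - exact: measurable_ball.
    - by apply: measurable_funTS; apply/measurable_EFinP; meas.
    - apply: measurable_funTS; apply/measurable_EFinP; apply: measurable_fun_powR.
      exact: measurable_normc.
    - by move=> y _; rewrite lee_fin; apply: powR_homo => //; exact: ltW.
  pose I := \int[mu]_y normc ((P (f y))%:C%C).
  have I0 : 0 <= I by apply: Rintegral_ge0 => y _; exact: normc_ge0.
  apply: (@integrable_le_real R _ mR mu _ (fun t => h t * I ^+ 2)).
  - apply: measurable_funM; first by rewrite /h; meas.
    apply: measurable_funX; apply: measurable_normc.
    exact: (cmeasurable_heat_quad mP' iP').
  - exact: (integrableZr measurableT _ ih).
  - move=> t; rewrite ger0_norm; last by apply: mulr_ge0; [exact: h0|exact: sqr_ge0].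
    apply: ler_wpM2l; first exact: h0.
    by rewrite lerXn2r ?nnegrE ?normc_ge0//; exact: heat_quad_le.
have [H1 I1] := part (@complex.Re R) (@normr_Re_le R) m1.
have [H2 I2] := part (@complex.Im R) (@normr_Im_le R) m2.
have i12 := integrableZl measurableT 2 (integrableD measurableT I1 I2).
have key t : h t * normc (heat_quad f lam x t) ^+ 2 <=
   2 * (h t * normc (heat_quad (fun y => (complex.Re (f y))%:C%C) lam x t) ^+ 2 +
        h t * normc (heat_quad (fun y => (complex.Im (f y))%:C%C) lam x t) ^+ 2).
  rewrite -mulrDr [leRHS]mulrCA; apply: ler_wpM2l; first exact: h0.
  rewrite heat_quad_ReIm//.
  apply: le_trans (normcD_sqr_le _ _) _.
  by rewrite (normcM (0 +i* 1)%C) normc_imag mul1r.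
apply: (@le_trans _ _ (\int[mu]_t (2 *
  (h t * normc (heat_quad (fun y => (complex.Re (f y))%:C%C) lam x t) ^+ 2 +
   h t * normc (heat_quad (fun y => (complex.Im (f y))%:C%C) lam x t) ^+ 2)))).
  apply: le_Rintegral => //.
    apply: (@integrable_le_real R _ mR mu _ _ _ i12).
    apply: measurable_funM; first by rewrite /h; meas.
    by apply: measurable_funX; apply: measurable_normc; exact: cmeasurable_heat_quad.
    by move=> t; rewrite ger0_norm; [exact: key|apply: mulr_ge0; [exact: h0|exact: sqr_ge0]].
  by move=> t _; exact: key.
have iD := integrableD measurableT I1 I2.
have -> : 4 * C * lam ^- 2 * A `^ (2 / q) = 4 * (C * lam ^- 2 * A `^ (2 / q)).
  by rewrite -!mulrA.
move: (C * lam ^- 2 * A `^ (2 / q)) H1 H2 => X H1 H2.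
have -> : 4 * X = 2 * (X + X) by rewrite -mulr2n -[X *+ 2]mulr_natl mulrA -natrM.
apply: (@le_trans _ _ (2 * (\int[mu]_t (h t * normc (heat_quad (fun y => (complex.Re (f y))%:C%C) lam x t) ^+ 2) +
   \int[mu]_t (h t * normc (heat_quad (fun y => (complex.Im (f y))%:C%C) lam x t) ^+ 2)))).
  by rewrite -RintegralD// -RintegralZl.
exact: (ler_wpM2l (ler0n _ 2) (lerD H1 H2)).
Qed.

(** In modulus the Gaussian is exp(-(lam (x - y)/s)^2) with s = (1 + t^2)^(1/2): an average at scale
    s/lam, of mass of order s/lam. *)
Lemma sup_estimate : exists2 C : R, 0 < C &
  forall (f : R -> R[i]) (x A lam t : R), cmeasurable (f : mR -> R[i]) ->
  mu.-integrable setT (EFin \o (fun y => normc (f y))) -> 0 <= A -> 0 < lam ->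
  (forall rho, 0 < rho ->
    (\int[mu]_(y in ball x rho) (normc (f y))%:E <= (2 * rho * A)%:E)%E) ->
  normc (heat_quad f lam x t) <= C * lam^-1 * (1 + t ^+ 2) `^ 2^-1 * A.
Proof.
have [C C0 [HW _]] := @wt_scaled_le R 1 ltr01.
have [M M0 HM] := @gauss_decay R 1 2 ltr01 (ltac:(by [])).
exists (M * C); first by rewrite mulr_gt0.
move=> f x A lam t mf intf A0 l0 hA.
pose p := 1 + t ^+ 2; have p0 : 0 < p by rewrite /p ltr_pwDl// sqr_ge0.
pose s := p `^ 2^-1; have s0 : 0 < s by exact: powR_gt0.
have s2 : s ^+ 2 = p.
  by rewrite -powR_mulrn ?(ltW s0)// -powRrM mulVf// powRr1// ltW.
have mn : measurable_fun setT (fun y : mR => normc (f y)) by exact: measurable_normc.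
pose g y := normc (f y) * (M * wt 1 (lam / s * (x - y))).
have mw : measurable_fun setT (fun y : mR => M * wt 1 (lam / s * (x - y))).
  by rewrite /wt; meas.
have w1 y : wt 1 (lam / s * (x - y)) <= 1.
  rewrite /wt powRN invf_le1 ?powR_gt0 ?ltr_pwDl//.
  rewrite -[leLHS](powRr0 (1 + `|lam / s * (x - y)|)); apply: ler_powR => //.
  by rewrite lerDl.
have ig : mu.-integrable setT (EFin \o g).
  apply: (@integrable_le_real R _ mR mu _ (fun y => normc (f y) * M)).
  - exact: measurable_funM.
  - exact: (integrableZr measurableT _ intf).
  - move=> y; rewrite /g normrM (ger0_norm (normc_ge0 _)) ler_wpM2l ?normc_ge0//.
    by rewrite ger0_norm ?mulr_ge0 ?wt_ge0 ?(ltW M0)// ler_piMr ?(ltW M0).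
have [i1 i2] := cintegrable_heat_quad mf intf lam x t.
have mq : cmeasurable (fun y : mR => f y *
    ((expR (- ((lam * (x - y)) ^+ 2 / (1 + t ^+ 2))))%:C%C *
     expi (t * ((lam * (x - y)) ^+ 2 / (1 + t ^+ 2))))).
  by split; apply/measurable_EFinP; [case/integrableP: i1|case/integrableP: i2].
apply: le_trans (normc_cintegral_le mq ig _) _.
  move=> y; rewrite !normcM normc_expi mulr1 normc_real ger0_norm ?expR_ge0//.
  rewrite ler_wpM2l ?normc_ge0//.
  apply: le_trans (HM _); rewrite le_eqVlt; apply/orP; left; apply/eqP.
  congr expR; congr (- _); rewrite mul1r -/p -s2; field; exact: lt0r_neq0.
have ls0 : 0 < lam / s by rewrite divr_gt0.
rewrite -lee_fin /Rintegral fineK; last exact: integrable_fin_num.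
have -> : (\int[mu]_y (g y)%:E = M%:E * \int[mu]_y (normc (f y) * wt 1 (lam / s * (x - y)))%:E)%E.
  rewrite -ge0_integralZl ?lee_fin ?(ltW M0)//.
  - by apply: eq_integral => y _; rewrite /g mulrCA EFinM.
  - by apply/measurable_EFinP; apply: measurable_funM => //; rewrite /wt; meas.
  - by move=> y _; rewrite lee_fin mulr_ge0 ?normc_ge0 ?wt_ge0.
apply: (@le_trans _ _ (M%:E * (C * (lam / s)^-1 * A)%:E)%E).
  rewrite lee_wpmul2l ?lee_fin ?(ltW M0)//; apply: HW => // y; exact: normc_ge0.
rewrite -EFinM lee_fin le_eqVlt; apply/orP; left; apply/eqP.
by rewrite -/p -/s; field; rewrite !lt0r_neq0.
Qed.

End heat_estimates.

(** * Bochner-Riesz means as superpositions of Gaussian averages *)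

Section subordination.
Context {R : realType}.
Local Notation mR := (measurableTypeR R).
Local Notation mu := (@lebesgue_measure R).

Definition heat_mean (f : R -> R[i]) (r x t : R) : R[i] :=
  cintegral mu (fun xi => fourier f xi * e2pi (x * xi) *
    ((expR (- (r ^- 2 * xi ^+ 2)))%:C%C * expi (- (t * (r ^- 2 * xi ^+ 2))))).

Section one_function.
Variable f : R -> R[i].
Hypotheses (mf : cmeasurable (f : mR -> R[i]))
  (intf : mu.-integrable setT (EFin \o (fun y => normc (f y)))).

Lemma e2piE (t : R) : e2pi t = expi (2 * pi * t). Proof. by []. Qed.

Lemma cmeasurable_fourier : cmeasurable (fourier f : mR -> R[i]).
Proof.
apply: (@cmeasurable_cintegral R _ _ mR mR mu
  (fun w => f w.2 * e2pi (- (w.2 * w.1))) _ (0 : R) _ intf).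
  apply: cmeasurableM.
    by case: mf => m1 m2; split; [exact: (measurableT_comp m1 measurable_snd)|
      exact: (measurableT_comp m2 measurable_snd)].
  by apply: cmeasurable_expi; meas.
by move=> y z; rewrite normcM e2piE normc_expi mulr1.
Qed.

Let mfy xi : cmeasurable (fun y : mR => f y * e2pi (- (y * xi))).
Proof. by apply: cmeasurableM => //; apply: cmeasurable_expi; meas. Qed.

Lemma normc_fourier_le xi : normc (fourier f xi) <= \int[mu]_y normc (f y).
Proof.
apply: normc_cintegral_le => // y.
by rewrite normcM e2piE normc_expi mulr1.
Qed.

(** By Fubini, the multiplier becomes the kernel [cgauss] at frequency 2 pi (x - y). With a = r^(-2)
    one has (2 pi (x - y))^2 / (4a) = (pi r (x - y))^2, hence the scale [pi * r]. *)
Lemma heat_meanE (r x t : R) : 0 < r ->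
  heat_mean f r x t = cgauss (r ^- 2) t 0 * heat_quad f (pi * r) x t.
Proof.
move=> r0; have a0 : 0 < r ^- 2 by rewrite invr_gt0 exprn_gt0.
set a := r ^- 2 in a0 *.
pose E xi := expR (- (a * xi ^+ 2)).
have iE : mu.-integrable setT (EFin \o E) by exact: integrable_gauss.
pose F (w : mR * mR) := (E w.1)%:C%C * expi (- (t * (a * w.1 ^+ 2))) *
  expi (2 * pi * (x - w.2) * w.1) * f w.2.
have mf2 : cmeasurable (fun w : mR * mR => f w.2).
  by case: mf => m1 m2; split; [exact: (measurableT_comp m1 measurable_snd)|
    exact: (measurableT_comp m2 measurable_snd)].
have mF : cmeasurable F.
  apply: cmeasurableM => //; apply: cmeasurableM; last by apply: cmeasurable_expi; meas.
  by apply: cmeasurableM; [apply: cmeasurable_real|apply: cmeasurable_expi];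
    rewrite /E; meas.
have Fle xi y : normc (F (xi, y)) <= E xi * normc (f y).
  by rewrite !normcM !normc_expi !mulr1 normc_real ger0_norm ?expR_ge0.
have -> : heat_mean f r x t = cintegral mu (fun xi => cintegral mu (fun y => F (xi, y))).
  apply: eq_cintegral => xi.
  transitivity ((E xi)%:C%C * expi (- (t * (a * xi ^+ 2))) * e2pi (x * xi) *
      fourier f xi).
    by rewrite /E; ring.
  rewrite /fourier -cintegralZl; last first.
    apply: (cintegrable_le (mfy xi) intf) => y.
    by rewrite normcM e2piE normc_expi mulr1.
  apply: eq_cintegral => y; rewrite /F /= !e2piE.
  have -> : 2 * pi * (x - y) * xi = 2 * pi * (x * xi) + 2 * pi * - (y * xi) by ring.
  by rewrite expiD; ring.
rewrite (@cfubini_dominated R _ _ mR mR mu mu E (fun y => normc (f y)) iE intf _ _ F mF Fle);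
  last 2 first.
- by move=> xi; exact: expR_ge0.
- by move=> y; exact: normc_ge0.
have ihq := cintegrable_heat_quad mf intf (pi * r) x t.
rewrite /heat_quad -cintegralZl//; apply: eq_cintegral => y.
transitivity (f y * cgauss a t (2 * pi * (x - y))).
  rewrite /cgauss -cintegralZl; last first.
    apply: (cintegrable_le _ iE) => [|xi].
      by apply: cmeasurableM; [apply: cmeasurable_real|apply: cmeasurable_expi];
        rewrite /E; meas.
    by rewrite normcM normc_expi mulr1 normc_real ger0_norm ?expR_ge0.
  apply: eq_cintegral => xi; rewrite /F /= (expiD (2 * pi * (x - y) * xi)).
  by rewrite -/(E xi); ring.
rewrite cgaussE//.
have t0 : 1 + t ^+ 2 != 0 by rewrite lt0r_neq0// ltr_pwDl// sqr_ge0.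
have -> : (2 * pi * (x - y)) ^+ 2 / (4 * a * (1 + t ^+ 2)) =
    (pi * r * (x - y)) ^+ 2 / (1 + t ^+ 2).
  by rewrite /a; field; rewrite t0 lt0r_neq0.
by ring.
Qed.

End one_function.

Lemma normc_heat_mean (f : R -> R[i]) (r x t : R) : 0 < r ->
  cmeasurable (f : mR -> R[i]) ->
  mu.-integrable setT (EFin \o (fun y => normc (f y))) ->
  normc (heat_mean f r x t) =
  Num.sqrt pi * r * (1 + t ^+ 2) `^ (- (1 / 4)) * normc (heat_quad f (pi * r) x t).
Proof.
move=> r0 mf intf; rewrite heat_meanE// normcM normc_cgauss0 ?invr_gt0 ?exprn_gt0//.
congr (_ * _ * _); rewrite invrK sqrtrM ?pi_ge0// sqrtr_sqr gtr0_norm//.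
Qed.

Variables (m : nat) (alpha : R).
Hypothesis alpha1 : 1 < alpha.

Lemma bochner_riesz_subordination (f : 'I_m -> R -> R[i]) (r x : R) : 0 < r ->
  (forall i, cmeasurable (f i : mR -> R[i])) ->
  (forall i, mu.-integrable setT (EFin \o (fun y => normc (f i y)))) ->
  bochner_riesz alpha r f x = cintegral mu (fun t =>
    (expR 1 / (2 * pi))%:C%C * expi t * gpow_ft alpha t * \prod_i heat_mean (f i) r x t).
Proof.
move=> r0 mf intf; have a0 : 0 < r ^- 2 by rewrite invr_gt0 exprn_gt0.
set a := r ^- 2 in a0 *.
have pi0 := @pi_gt0 R.
have [c c0 HG] := normc_gpow_ft alpha1.
have mG := cmeasurable_gpow_ft alpha1.
have iG := integrable_gpow_ft_bound alpha1 c.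
(* With u = s / r^2, the factor e comes from (1 - u)_+^alpha = e e^(-u) g(1 - u) and 1/(2 pi) from
   the inversion formula. The factor e^(-u) goes to the Gaussians, and t (1 - u) = t - t u leaves
   [expi t] outside the product. *)
pose D : R := expR 1 / (2 * pi).
have D0 : 0 <= D by rewrite divr_ge0 ?expR_ge0// mulr_ge0// ltW.
pose h t := D * (c * (1 + t ^+ 2) `^ (- ((alpha + 1) / 2))).
have ih : mu.-integrable setT (EFin \o h) by exact: (integrableZl measurableT D iG).
have h0 t : 0 <= h t by apply: mulr_ge0 => //; rewrite mulr_ge0 ?powR_ge0.
pose u i t xi := fourier (f i) xi * e2pi (x * xi) *
    ((expR (- (a * xi ^+ 2)))%:C%C * expi (- (t * (a * xi ^+ 2)))).
pose k (i : 'I_m) xi := (\int[mu]_y normc (f i y)) * expR (- (a * xi ^+ 2)).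
have ik i : mu.-integrable setT (EFin \o k i).
  exact: (integrableZl measurableT _ (integrable_gauss a0)).
have k0 i xi : 0 <= k i xi.
  by rewrite mulr_ge0 ?expR_ge0//; apply: Rintegral_ge0 => y _; exact: normc_ge0.
have mu_ i t : cmeasurable (u i t : mR -> R[i]).
  apply: cmeasurableM.
    apply: cmeasurableM; first exact: cmeasurable_fourier.
    by apply: cmeasurable_expi; meas.
  by apply: cmeasurableM; [apply: cmeasurable_real|apply: cmeasurable_expi]; meas.
have ule i t xi : normc (u i t xi) <= k i xi.
  rewrite !normcM e2piE !normc_expi !mulr1 normc_real ger0_norm ?expR_ge0//.
  by rewrite ler_wpM2r ?expR_ge0//; exact: normc_fourier_le.
pose K (v : m.-tuple mR) := \prod_i k i (tnth v i).
have iK : (lebesgue_tuple R m).-integrable setT (EFin \o K).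
  exact: integrable_tuple_prod.
have K0 v : 0 <= K v by exact: prodr_ge0.
pose F (w : m.-tuple mR * mR) := D%:C%C * expi w.2 * gpow_ft alpha w.2 *
  \prod_i u i w.2 (tnth w.1 i).
have mF : cmeasurable F.
  have mG2 : cmeasurable (fun w : m.-tuple mR * mR => gpow_ft alpha w.2).
    by case: mG => m1 m2; split; [exact: (measurableT_comp m1 measurable_snd)|
      exact: (measurableT_comp m2 measurable_snd)].
  apply: cmeasurableM.
    apply: cmeasurableM => //; apply: cmeasurableM; first exact: cmeasurable_cst.
    by apply: cmeasurable_expi; meas.
  apply: (@cmeasurable_prod R _ _ _ _ (fun i w => u i w.2 (tnth w.1 i))) => i.
  have mt : measurable_fun setT (fun w : m.-tuple mR * mR => tnth w.1 i : mR).
    exact: (measurableT_comp (measurable_tnth i) measurable_fst).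
  apply: cmeasurableM.
    apply: cmeasurableM; last by apply: cmeasurable_expi; meas.
    by case: (cmeasurable_fourier (mf i) (intf i)) => m1 m2; split;
      [exact: (measurableT_comp m1 mt)|exact: (measurableT_comp m2 mt)].
  by apply: cmeasurableM; [apply: cmeasurable_real|apply: cmeasurable_expi]; meas.
have Fle v t : normc (F (v, t)) <= K v * h t.
  rewrite /F normcM normcM normcM normc_real normc_expi mulr1 HG (ger0_norm D0) mulrC.
  apply: ler_wpM2r; first exact: h0.
  rewrite normc_prod; apply: ler_prod => i _.
  by rewrite normc_ge0 ule.
transitivity (cintegral (lebesgue_tuple R m) (fun v => cintegral mu (fun t => F (v, t)))).
  apply: eq_cintegral => v.
  set s := \sum_(i < m) `|tnth v i| ^+ 2.
  pose P : R[i] := \prod_i (fourier (f i) (tnth v i) * e2pi (x * tnth v i)).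
  have sE : \sum_(i < m) a * tnth v i ^+ 2 = s / r ^+ 2.
    rewrite -big_distrr /= mulrC; congr (_ * _).
    by apply: eq_bigr => i _; rewrite real_normK ?num_real.
  have FE t : F (v, t) = (D%:C%C * P * (expR (- (s / r ^+ 2)))%:C%C) *
      (gpow_ft alpha t * expi (t * (1 - s / r ^+ 2))).
    rewrite /F /= /u big_split/= -/P.
    rewrite [X in _ * (P * X)]big_split/= -expi_sum.
    rewrite (_ : \prod_i (expR (- (a * tnth v i ^+ 2)))%:C%C =
      (expR (- (s / r ^+ 2)))%:C%C); last first.
      by rewrite -rmorph_prod -expR_sum sumrN sE.
    rewrite (_ : \sum_i - (t * (a * tnth v i ^+ 2)) = - (t * (s / r ^+ 2))); last first.
      by rewrite sumrN -big_distrr /= sE.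
    have -> : t * (1 - s / r ^+ 2) = t + - (t * (s / r ^+ 2)) by ring.
    by rewrite expiD; ring.
  under [RHS]eq_cintegral do rewrite FE.
  rewrite cintegralZl; last first.
    apply: (cintegrable_le _ iG) => [|t].
      by apply: cmeasurableM => //; apply: cmeasurable_expi; meas.
    by rewrite normcM normc_expi mulr1 HG.
  rewrite gpow_ft_inversion//.
  rewrite -mulrA.
  have -> : \prod_(i < m) fourier (f i) (tnth v i) * e2pi (x * \sum_(i < m) tnth v i) = P.
    rewrite /P big_split /=; congr (_ * _).
    by rewrite e2piE mulrA big_distrr /= expi_sum; apply: eq_bigr => i _; rewrite e2piE mulrA.
  set q := s / r ^+ 2; set pw := pos_powR _ _.
  have E1 : expR 1 * (expR (- q) * expR (- (1 - q))) = 1.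
    by rewrite -!expRD [X in expR X](_ : _ = 0) ?expR0//; ring.
  have E : D * expR (- q) * (2 * pi * (pw * expR (- (1 - q)))) = pw.
    transitivity (pw * (expR 1 * (expR (- q) * expR (- (1 - q))))).
      have D2 : D * (2 * pi) = expR 1 by rewrite /D divfK// mulf_neq0// gt_eqF.
      by rewrite -D2; ring.
    by rewrite E1 mulr1.
  transitivity ((D * expR (- q) * (2 * pi * (pw * expR (- (1 - q)))))%:C%C * P).
    by rewrite E.
  by rewrite (rmorphM (real_complex R)) (rmorphM (real_complex R) D) /=; ring.
rewrite (@cfubini_dominated R _ _ _ mR (lebesgue_tuple R m) mu K h iK ih K0 h0 F mF Fle).
apply: eq_cintegral => t.
rewrite /F /= cintegralZl; last first.
  apply: (cintegrable_le _ iK) => [|v].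
    exact: (cmeasurable_tuple_prod (fun i => mu_ i t)).
  by rewrite normc_prod; apply: ler_prod => i _; rewrite normc_ge0 ule.
by rewrite (cintegral_tuple_prod ik (fun i => mu_ i t) (fun i => ule i t)).
Qed.

End subordination.

(** * Pointwise bound of the means by ball averages *)

Section pointwise_domination.
Context {R : realType}.
Local Notation mR := (measurableTypeR R).
Local Notation mu := (@lebesgue_measure R).

Lemma cmeasurable_heat_mean (f : R -> R[i]) (r x : R) : 0 < r ->
  cmeasurable (f : mR -> R[i]) ->
  mu.-integrable setT (EFin \o (fun y => normc (f y))) ->
  cmeasurable (heat_mean f r x : mR -> R[i]).
Proof.
move=> r0 mf intf; have a0 : 0 < r ^- 2 by rewrite invr_gt0 exprn_gt0.
have iE := integrableZl measurableT (\int[mu]_y normc (f y)) (integrable_gauss a0).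
apply: (@cmeasurable_cintegral R _ _ mR mR mu (fun w => fourier f w.2 * e2pi (x * w.2) *
    ((expR (- (r ^- 2 * w.2 ^+ 2)))%:C%C * expi (- (w.1 * (r ^- 2 * w.2 ^+ 2))))) _ (0 : R) _ iE).
  apply: cmeasurableM.
    apply: cmeasurableM; last by apply: cmeasurable_expi; meas.
    by case: (cmeasurable_fourier mf intf) => m1 m2; split;
      [exact: (measurableT_comp m1 measurable_snd)|
      exact: (measurableT_comp m2 measurable_snd)].
  by apply: cmeasurableM; [apply: cmeasurable_real|apply: cmeasurable_expi]; meas.
move=> t xi; rewrite normcM normcM normcM e2piE !normc_expi !mulr1 normc_real.
rewrite ger0_norm ?expR_ge0//; apply: ler_wpM2r; first exact: expR_ge0.
exact: normc_fourier_le.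
Qed.

Lemma integrable_heat_quad_sqr (f : R -> R[i]) (c lam x : R) : 1 / 2 < c ->
  cmeasurable (f : mR -> R[i]) ->
  mu.-integrable setT (EFin \o (fun y => normc (f y))) ->
  mu.-integrable setT (EFin \o
    (fun t => (1 + t ^+ 2) `^ (- c) * normc (heat_quad f lam x t) ^+ 2)).
Proof.
move=> c2 mf intf.
pose I := \int[mu]_y normc (f y).
have ih := integrable_sqr_decay c2.
apply: (@integrable_le_real R _ mR mu _ (fun t => (1 + t ^+ 2) `^ (- c) * I ^+ 2)).
- apply: measurable_funM; first by meas.
  apply: measurable_funX; apply: measurable_normc.
  exact: (cmeasurable_heat_quad mf intf).
- exact: (integrableZr measurableT _ ih).
- move=> t; rewrite ger0_norm; last by apply: mulr_ge0; [exact: powR_ge0|exact: sqr_ge0].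
  apply: ler_wpM2l; first exact: powR_ge0.
  have I0 : 0 <= I by apply: Rintegral_ge0 => y _; exact: normc_ge0.
  by rewrite lerXn2r ?nnegrE ?normc_ge0//; exact: heat_quad_le.
Qed.

Lemma weighted_heat_mean_sqr (b p r N H : R) : 0 < p ->
  H = Num.sqrt pi * r * p `^ (- (1 / 4)) * N ->
  (p `^ (- (b / 4)) * H) ^+ 2 = pi * r ^+ 2 * (p `^ (- ((b + 1) / 2)) * N ^+ 2).
Proof.
move=> p0 ->; rewrite !exprMn sqr_sqrtr ?pi_ge0//.
have -> : p `^ (- ((b + 1) / 2)) = p `^ (- (b / 4)) ^+ 2 * p `^ (- (1 / 4)) ^+ 2.
  by rewrite !expr2 -!gt0_powRD//; congr (_ `^ _); field.
ring.
Qed.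

Lemma mul_le_weighted_sqr (u v tau : R) : 0 < tau ->
  u * v <= (tau * u ^+ 2 + v ^+ 2 / tau) / 2.
Proof.
move=> t0; rewrite ler_pdivlMr// -subr_ge0.
have -> : tau * u ^+ 2 + v ^+ 2 / tau - u * v * 2 = (tau * u - v) ^+ 2 / tau.
  by field; exact: lt0r_neq0.
by rewrite divr_ge0 ?sqr_ge0// ltW.
Qed.

(* The geometric mean of the two square integrals comes from
   [mul_le_weighted_sqr], with tau balancing the sizes of A i0 and A i1. *)
Lemma bochner_riesz_le (m : nat) (alpha : R) (i0 i1 : 'I_m) (qs : 'I_m -> R) :
  1 < alpha -> i0 != i1 -> (forall i, 1 <= qs i) -> (forall i, qs i <= 2) ->
  (forall i, i != i0 -> i != i1 -> qs i = 1) ->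
  m%:R / 2 - 2 + (qs i0)^-1 + (qs i1)^-1 < alpha ->
  exists2 C : R, 0 < C &
  forall (f : 'I_m -> R -> R[i]) (x r : R) (A : 'I_m -> R), 0 < r ->
  (forall i, cmeasurable (f i : mR -> R[i])) ->
  (forall i, mu.-integrable setT (EFin \o (fun y => normc (f i y)))) ->
  (forall i, 0 < A i) ->
  (forall i rho, 0 < rho ->
    (\int[mu]_(y in ball x rho) (normc (f i y) `^ qs i)%:E <= (2 * rho * A i)%:E)%E) ->
  normc (bochner_riesz alpha r f x) <= C * \prod_i A i `^ (qs i)^-1.
Proof.
move=> alpha1 i01 qs1 qs2 qsE qa.
(* Chosen so that (b i0 + b i1)/4 = (alpha + 1)/2 - (m - 2)/4: the decay of [gpow_ft] minus the
   growth of the other m - 2 factors. It is positive exactly by the hypothesis on alpha. *)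
pose eta := (2 * alpha + 4 - m%:R - 2 / qs i0 - 2 / qs i1) / 2.
have eta0 : 0 < eta by rewrite /eta; lra.
pose b i := 2 / qs i + eta.
have hb i : 2 / qs i < b i by rewrite /b ltrDl.
have [C0 C00 H0] := square_estimate (qs1 i0) (qs2 i0) (hb i0).
have [C1 C10 H1] := square_estimate (qs1 i1) (qs2 i1) (hb i1).
have [Cs Cs0 Hs] := @sup_estimate R.
have [c c0 HG] := normc_gpow_ft alpha1.
have pi0 := @pi_gt0 R.
pose D : R := expR 1 / (2 * pi).
have D0 : 0 <= D by rewrite divr_ge0 ?expR_ge0// mulr_ge0// ltW.
pose S := Num.sqrt pi * (Cs * pi^-1).
have S0 : 0 <= S by rewrite mulr_ge0 ?sqrtr_ge0// divr_ge0// ltW.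
pose others i := (i != i0) && (i != i1).
have prodE (X : 'I_m -> R) : \prod_i X i = X i0 * X i1 * \prod_(i | others i) X i.
  rewrite (bigD1 i0)//= (bigD1 i1)/=; last by rewrite eq_sym.
  by rewrite mulrA; congr (_ * _); apply: eq_bigl => i.
pose n := #|others|.
have mn : (m = n + 2)%N.
  have := cardC (mem [:: i0; i1]); rewrite card_ord => <-.
  have /card_uniqP -> : uniq [:: i0; i1] by rewrite /= inE i01.
  rewrite addnC; congr (_ + _)%N; apply: eq_card => i.
  by rewrite !inE /others negb_or.
have mn2 : m%:R = n%:R + 2 :> R by rewrite mn natrD.
(* The summand 1 only makes the constant positive, [c] being known as nonnegative. *)
exists (D * c * S ^+ n * ((C0 + C1) / (2 * pi)) + 1).
  apply: ltr_wpDl => //; apply: mulr_ge0.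
    by apply: mulr_ge0; [exact: mulr_ge0|exact: exprn_ge0].
  by apply: divr_ge0; [apply: addr_ge0; exact: ltW|apply: mulr_ge0 => //; exact: ltW].
move=> f x r A r0 mf intf A0 hA.
pose p (t : R) := 1 + t ^+ 2.
have p0 t : 0 < p t by rewrite /p ltr_pwDl// sqr_ge0.
have [H HD] : exists H : 'I_m -> R -> R,
    forall i t, H i t = normc (heat_mean (f i) r x t).
  by exists (fun i t => normc (heat_mean (f i) r x t)).
have HE i t : H i t = Num.sqrt pi * r * p t `^ (- (1 / 4)) * normc (heat_quad (f i) (pi * r) x t).
  by rewrite HD; exact: normc_heat_mean.
have Hn i t : 0 <= H i t by rewrite HD normc_ge0.
have l0 : 0 < pi * r by rewrite mulr_gt0.
(* The exponent is 1/2 from [sup_estimate] minus 1/4 from the prefactor of the Gaussian; the powers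
   of r cancel. *)
have Hoth i t : others i -> H i t <= S * p t `^ (1 / 4) * A i.
  move=> /andP[n0 n1].
  have ball1 rho : 0 < rho -> (\int[mu]_(y in ball x rho) (normc (f i y))%:E <= (2 * rho * A i)%:E)%E.
    move=> rho0; apply: le_trans (hA i rho rho0); rewrite le_eqVlt; apply/orP; left.
    by apply/eqP/eq_integral => y _; rewrite qsE// powRr1// normc_ge0.
  have := Hs (f i) x (A i) (pi * r) t (mf i) (intf i) (ltW (A0 i)) l0 ball1.
  rewrite HE -/(p t) => hs.
  have k0 : 0 <= Num.sqrt pi * r * p t `^ (- (1 / 4)).
    by rewrite !mulr_ge0 ?sqrtr_ge0 ?powR_ge0// ltW.
  apply: le_trans (ler_wpM2l k0 hs) _; rewrite le_eqVlt; apply/orP; left; apply/eqP.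
  have -> : p t `^ 2^-1 = p t `^ (1 / 4) * p t `^ (1 / 4).
    by rewrite -gt0_powRD//; congr (_ `^ _); field.
  have e1 : p t `^ (- (1 / 4)) * p t `^ (1 / 4) = 1.
    by rewrite -gt0_powRD// addNr powRr0.
  transitivity (S * (p t `^ (- (1 / 4)) * p t `^ (1 / 4)) * p t `^ (1 / 4) * A i).
    rewrite /S invfM; move: (pi^-1) (Num.sqrt pi) => q s.
    by field; rewrite gt_eqF.
  by rewrite e1 mulr1.
pose u i t := p t `^ (- (b i / 4)) * H i t.
pose T := A i1 `^ (qs i1)^-1 / A i0 `^ (qs i0)^-1.
have T0 : 0 < T by rewrite divr_gt0// powR_gt0.
pose PA := \prod_(i | others i) A i.
have PA0 : 0 <= PA by apply: prodr_ge0 => i _; exact: ltW.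
pose K := D * c * S ^+ n * PA.
have K0 : 0 <= K.
  by apply: mulr_ge0 => //; apply: mulr_ge0; [exact: mulr_ge0|exact: exprn_ge0].
pose g t := K * ((T * u i0 t ^+ 2 + u i1 t ^+ 2 / T) / 2).
have usq i t : u i t ^+ 2 = pi * r ^+ 2 * (p t `^ (- ((b i + 1) / 2)) *
    normc (heat_quad (f i) (pi * r) x t) ^+ 2).
  exact: (weighted_heat_mean_sqr (b i) (p0 t) (HE i t)).
have b1 i : 1 / 2 < (b i + 1) / 2.
  have := hb i; have : 1 <= 2 / qs i by rewrite ler_pdivlMr ?mul1r// (lt_le_trans ltr01).
  by lra.
have iu i : mu.-integrable setT (EFin \o (fun t => u i t ^+ 2)).
  under eq_fun do rewrite usq.
  exact: (integrableZl measurableT _ (integrable_heat_quad_sqr (pi * r) x (b1 i) (mf i) (intf i))).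
have Iu i C : \int[mu]_t (p t `^ (- ((b i + 1) / 2)) *
    normc (heat_quad (f i) (pi * r) x t) ^+ 2) <= C * (pi * r) ^- 2 * A i `^ (2 / qs i) ->
    \int[mu]_t u i t ^+ 2 <= C / pi * (A i `^ (qs i)^-1) ^+ 2.
  move=> hC; under eq_Rintegral do rewrite usq.
  rewrite RintegralZl//; last exact: integrable_heat_quad_sqr.
  have k0 : 0 <= pi * r ^+ 2 by rewrite mulr_ge0 ?exprn_ge0// ltW.
  apply: le_trans (ler_wpM2l k0 hC) _; rewrite le_eqVlt; apply/orP; left; apply/eqP.
  have -> : A i `^ (2 / qs i) = (A i `^ (qs i)^-1) ^+ 2.
    by rewrite -powR_mulrn ?powR_ge0// -powRrM mulrC.
  have pn : (pi : R) != 0 by rewrite gt_eqF.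
  have rn : r != 0 by rewrite gt_eqF.
  by move: (pi : R) pn => q qn; field; rewrite qn rn.
have i1_ := integrableZl measurableT T (iu i0).
have i2_ := integrableZr measurableT T^-1 (iu i1).
have i12 := integrableD measurableT i1_ i2_.
have i12' := integrableZr measurableT 2^-1 i12.
have ig : mu.-integrable setT (EFin \o g) by exact: (integrableZl measurableT K i12').
rewrite bochner_riesz_subordination//.
have mG := cmeasurable_gpow_ft alpha1.
have mF : cmeasurable (fun t : mR => (expR 1 / (2 * pi))%:C%C * expi t * gpow_ft alpha t *
    \prod_i heat_mean (f i) r x t).
  apply: cmeasurableM.
    apply: cmeasurableM => //; apply: cmeasurableM; first exact: cmeasurable_cst.
    by apply: cmeasurable_expi; meas.
  by apply: cmeasurable_prod => i; exact: cmeasurable_heat_mean.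
apply: le_trans (normc_cintegral_le mF ig _) _.
  move=> t; rewrite normcM normcM normcM normc_real normc_expi mulr1 HG -/D (ger0_norm D0).
  rewrite normc_prod -/(p t).
  have -> : \prod_i normc (heat_mean (f i) r x t) = \prod_i H i t.
    by apply: eq_bigr => i _; rewrite HD.
  rewrite prodE.
  have hp : \prod_(i | others i) H i t <= S ^+ n * p t `^ (n%:R / 4) * PA.
    apply: (@le_trans _ _ (\prod_(i | others i) (S * p t `^ (1 / 4) * A i))).
      by apply: ler_prod => i oi; apply/andP; split; [exact: Hn|exact: Hoth].
    rewrite big_split/= -/PA prodr_const -/n exprMn.
    by rewrite -[(p t `^ _) ^+ n]powR_mulrn ?powR_ge0// -powRrM (_ : 1 / 4 * n%:R = n%:R / 4)//; ring.
  have h2 : 0 <= D * (c * p t `^ (- ((alpha + 1) / 2))).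
    by apply: mulr_ge0 => //; rewrite mulr_ge0 ?powR_ge0.
  have HH : 0 <= H i0 t * H i1 t := mulr_ge0 (Hn i0 t) (Hn i1 t).
  move: (\prod_(i | others i) H i t) hp => Q hp.
  apply: (@le_trans _ _ (D * (c * p t `^ (- ((alpha + 1) / 2))) *
      (H i0 t * H i1 t * (S ^+ n * p t `^ (n%:R / 4) * PA)))).
    by apply: ler_wpM2l => //; exact: ler_wpM2l.
  apply: (@le_trans _ _ (K * (u i0 t * u i1 t))); last first.
    by apply: ler_wpM2l => //; exact: mul_le_weighted_sqr.
  rewrite le_eqVlt; apply/orP; left; apply/eqP; rewrite /K /u.
  have e1 : p t `^ (- ((alpha + 1) / 2)) * p t `^ (n%:R / 4) =
      p t `^ (- (b i0 / 4)) * p t `^ (- (b i1 / 4)).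
    by rewrite -!gt0_powRD//; congr (_ `^ _); rewrite /b /eta mn2; lra.
  transitivity (D * c * S ^+ n * PA * (H i0 t * H i1 t) *
     (p t `^ (- ((alpha + 1) / 2)) * p t `^ (n%:R / 4))); first by ring.
  by rewrite e1; ring.
rewrite RintegralZl//.
have Ig : \int[mu]_t ((T * u i0 t ^+ 2 + u i1 t ^+ 2 / T) / 2) =
    (T * \int[mu]_t u i0 t ^+ 2 + (\int[mu]_t u i1 t ^+ 2) / T) / 2.
  by rewrite RintegralZr// RintegralD// RintegralZl// RintegralZr.
rewrite Ig.
have J0 := Iu i0 C0 (H0 _ _ _ _ (mf i0) (intf i0) (A0 i0) l0 (hA i0)).
have J1 := Iu i1 C1 (H1 _ _ _ _ (mf i1) (intf i1) (A0 i1) l0 (hA i1)).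
have PE : \prod_i A i `^ (qs i)^-1 = A i0 `^ (qs i0)^-1 * A i1 `^ (qs i1)^-1 * PA.
  rewrite prodE; congr (_ * _); apply: eq_bigr => i /andP[n0 n1].
  by rewrite qsE// invr1 powRr1// ltW.
rewrite PE.
have a0 : 0 < A i0 `^ (qs i0)^-1 by exact: powR_gt0.
have a1 : 0 < A i1 `^ (qs i1)^-1 by exact: powR_gt0.
rewrite /T; move: (A i0 `^ (qs i0)^-1) (A i1 `^ (qs i1)^-1) a0 a1 J0 J1 => x0 x1 x00 x10.
move: (\int[mu]_t u i0 t ^+ 2) (\int[mu]_t u i1 t ^+ 2) => X Y hX hY.
have Ti : (x1 / x0)^-1 = x0 / x1 by rewrite invf_div.
rewrite Ti.
have T10 : 0 <= x1 / x0 by rewrite divr_ge0// ltW.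
have T01 : 0 <= x0 / x1 by rewrite divr_ge0// ltW.
apply: (@le_trans _ _ (K * ((x1 / x0 * (C0 / pi * x0 ^+ 2) + C1 / pi * x1 ^+ 2 * (x0 / x1)) / 2))).
  apply: ler_wpM2l => //; apply: ler_wpM2r => //.
  by apply: lerD; [exact: ler_wpM2l|exact: ler_wpM2r].
have -> : K * ((x1 / x0 * (C0 / pi * x0 ^+ 2) + C1 / pi * x1 ^+ 2 * (x0 / x1)) / 2) =
    D * c * S ^+ n * ((C0 + C1) / (2 * pi)) * (x0 * x1 * PA).
  rewrite /K; have pn : (pi : R) != 0 by rewrite gt_eqF.
  have [n0 n1] : x0 != 0 /\ x1 != 0 by rewrite !gt_eqF.
  have alg (d s w q : R) : q != 0 -> d * c * s * w *
      ((x1 / x0 * (C0 / q * x0 ^+ 2) + C1 / q * x1 ^+ 2 * (x0 / x1)) / 2) =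
      d * c * s * ((C0 + C1) / (2 * q)) * (x0 * x1 * w).
    by move=> qn; field; rewrite qn n0 n1.
  exact: alg.
by rewrite ler_wpM2r ?lerDl// !mulr_ge0// ltW.
Qed.

End pointwise_domination.

(** * The maximal function *)

Section exponential_layer_cake.
Context {R : realType}.
Local Notation mR := (measurableTypeR R).
Local Notation mu := (@lebesgue_measure R).

(* The layer-cake formula for y^s in the variable u = ln(level). *)
Definition exp_below (s y u : R) : R := if expR u < y then expR (s * u) else 0.

Lemma exp_below_ge0 s y u : 0 <= exp_below s y u.
Proof. by rewrite /exp_below; case: ifP => // _; exact: expR_ge0. Qed.

Lemma measurable_exp_below d (T : measurableType d) s (f g : T -> R) :
  measurable_fun setT f -> measurable_fun setT g ->
  measurable_fun setT (fun t => exp_below s (f t) (g t)).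
Proof.
move=> mf mg; have me : measurable_fun setT (fun t => expR (g t)).
  exact: measurable_fun_expR.
have mb : measurable_fun setT (fun t => expR (g t) < f t).
  exact: measurable_fun_ltr.
apply: measurable_fun_ifT => //.
by apply: measurable_fun_expR; apply: measurable_funM => //; exact: measurable_cst.
Qed.

(** The exact value is y^s / s. The bound puts exp(-s (ln y - u)) below an integrable weight centred
    at ln y. *)
Lemma exp_below_le (s : R) : 0 < s -> exists2 C : R, 0 < C &
  forall y, 0 <= y -> (\int[mu]_u (exp_below s y u)%:E <= (C * y `^ s)%:E)%E.
Proof.
move=> s0; have [C C0 HC] := ball_weight_le (@ltr01 R).
(* From exp(-s (1 + v)) <= 2^2 (s (1 + v))^(-2) with v = ln y - u; [expR s] compensates for
   replacing v by 1 + v. *)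
pose K : R := expR s * (2 `^ 2 * s `^ (-2)).
have K0 : 0 < K by rewrite !mulr_gt0 ?powR_gt0// expR_gt0.
exists (K * C); first exact: mulr_gt0.
move=> y; rewrite le_eqVlt => /orP[/eqP <-|y0].
  rewrite powR0 ?gt_eqF// mulr0 integral0_eq// => u _.
  by rewrite /exp_below ltNge ltW ?expR_gt0.
have hb rho : 0 < rho -> (\int[mu]_(u in ball (ln y) rho) (cst 1 u)%:E <= (2 * rho * 1)%:E)%E.
  move=> rho0; rewrite [leLHS](_ : _ = (\int[mu]_(u in ball (ln y) rho) (cst 1%:E u)))%E//.
  rewrite integral_cst; last exact: measurable_ball.
  have mb : mu (ball (ln y : R) rho) = (rho *+ 2)%:E := lebesgue_measure_ball _ (ltW rho0).
  by rewrite mul1e [leLHS]mb mulr1 mulr2n mulrDl !mul1r.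
have := HC (cst 1) (ln y) 1 (measurable_cst _) (fun _ => ler01) ler01 hb 1 ltr01.
rewrite !mulr1 => H.
have mw : measurable_fun setT (fun u : mR => 1 * (1 + `|ln y - u| / 1) `^ (- (1 + 1)) : R).
  by meas.
apply: (@le_trans _ _ (\int[mu]_u ((K * y `^ s)%:E *
    (1 * (1 + `|ln y - u| / 1) `^ (- (1 + 1)))%:E))%E).
  apply: ge0_le_integral => //.
  - by move=> u _; rewrite lee_fin exp_below_ge0.
  - by apply/measurable_EFinP; apply: measurable_exp_below.
  - by apply: measurable_funeM; exact/measurable_EFinP.
  - move=> u _; rewrite -EFinM lee_fin divr1 mul1r /exp_below; case: ifPn => [uy|_]; last first.
      by rewrite !mulr_ge0 ?powR_ge0// ltW.
    have v0 : 0 < ln y - u by rewrite subr_gt0 -ltr_expR lnK.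
    rewrite gtr0_norm//.
    have := expRN_le_powR (ltr0Sn R 1) (_ : 0 < s * (1 + (ln y - u))).
    have w0 : 0 < 1 + (ln y - u) by rewrite addr_gt0.
    rewrite mulr_gt0// => /(_ isT) h.
    have -> : s * u = s + s * ln y + - (s * (1 + (ln y - u))) by ring.
    rewrite !expRD -[expR (s * ln y)]mulr1 mulr1.
    have -> : expR (s * ln y) = y `^ s by rewrite /powR gt_eqF.
    apply: (@le_trans _ _ (expR s * y `^ s * (2 `^ 2 * (s * (1 + (ln y - u))) `^ (-2)))).
      by apply: ler_wpM2l => //; rewrite mulr_ge0 ?expR_ge0 ?powR_ge0.
    rewrite powRM ?(ltW s0) ?(ltW w0)//.
    have -> : - (1 + 1) = -2 :> R by ring.
    by rewrite le_eqVlt; apply/orP; left; apply/eqP; rewrite /K; ring.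
rewrite ge0_integralZl ?lee_fin//; last 2 first.
- exact/measurable_EFinP.
- by rewrite mulr_ge0 ?powR_ge0// ltW.
apply: (@le_trans _ _ ((K * y `^ s)%:E * C%:E)%E).
  by apply: lee_wpmul2l => //; rewrite lee_fin mulr_ge0 ?powR_ge0// ltW.
by rewrite -EFinM lee_fin le_eqVlt; apply/orP; left; apply/eqP; ring.
Qed.

(** The unit interval below ln y suffices: there exp(s u) >= y^s e^(-s). *)
Lemma powR_le_exp_below (s y : R) : 0 < s -> 0 <= y ->
  ((y `^ s)%:E <= (expR s)%:E * \int[mu]_u (exp_below s y u)%:E)%E.
Proof.
move=> s0; rewrite le_eqVlt => /orP[/eqP <-|y0].
  rewrite powR0 ?gt_eqF// mule_ge0 ?lee_fin ?expR_ge0//.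
  by apply: integral_ge0 => u _; rewrite lee_fin exp_below_ge0.
pose D : set R := `]ln y - 1, ln y[%classic.
have mD : measurable (D : set mR) by exact: measurable_itv.
have muD : mu D = 1%:E.
  by rewrite lebesgue_measure_itv/= lte_fin ltrBlDr ltrDl ltr01 -EFinB; congr (_%:E); ring.
apply: (@le_trans _ _ ((expR s)%:E * \int[mu]_(u in D) (cst (y `^ s * expR (- s))%:E u))%E).
  rewrite integral_cst// [X in (_ * (_ * X))%E]muD mule1 -EFinM lee_fin.
  by rewrite mulrCA -expRD subrr expR0 mulr1.
apply: lee_wpmul2l; first by rewrite lee_fin expR_ge0.
apply: (@le_trans _ _ (\int[mu]_(u in D) (exp_below s y u)%:E)%E).
  apply: ge0_le_integral => //.
  - by move=> u _; rewrite lee_fin mulr_ge0 ?powR_ge0 ?expR_ge0.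
  - by apply: measurable_funTS; apply/measurable_EFinP; exact: measurable_exp_below.
  - move=> u; rewrite /D /= in_itv/= => /andP[u1 u2]; rewrite lee_fin /exp_below.
    have -> : expR u < y by rewrite -[y]lnK ?ltr_expR.
    by rewrite /powR gt_eqF// -expRD ler_expR; nra.
apply: ge0_subset_integral => //.
- by apply/measurable_EFinP; exact: measurable_exp_below.
- by move=> u _; rewrite lee_fin exp_below_ge0.
Qed.

End exponential_layer_cake.

Section maximal_strong_type.
Context {R : realType}.
Local Notation mR := (measurableTypeR R).
Local Notation mu := (@lebesgue_measure R).

Lemma integrable_locally_integrable (g : R -> R) :
  mu.-integrable setT (EFin \o g) -> locally_integrable setT g.
Proof.
move=> ig; have := @integrable_locally R g setT measurableT ig.
by rewrite patch_setT.
Qed.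

Variables (g : R -> R) (B : R).
Hypotheses (mg : measurable_fun setT (g : mR -> R)) (g0 : forall x, 0 <= g x)
  (gB : forall x, g x <= B) (ig : mu.-integrable setT (EFin \o g)).

Let lg : locally_integrable setT g. Proof. exact: integrable_locally_integrable. Qed.

Let HL_le : forall x, (HL_maximal g x <= B%:E)%E.
Proof.
move=> x; rewrite /HL_maximal; apply: ge_ereal_sup => _ [rho + <-].
rewrite /= in_itv/= andbT => rho0.
rewrite /iavg lebesgue_measure_ball ?(ltW rho0)//.
have r2 : 0 < rho *+ 2 by rewrite mulrn_wgt0.
rewrite inver gt_eqF// -lee_pdivlMl ?invr_gt0// invrK -EFinM.
apply: (@le_trans _ _ (\int[mu]_(y in ball x rho) (cst B%:E y))%E).
  apply: ge0_le_integral => //; first exact: measurable_ball.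
  - apply: measurable_funTS; apply: measurableT_comp => //.
    exact/measurable_EFinP.
  - by move=> y _; rewrite lee_fin ger0_norm.
rewrite integral_cst; last exact: measurable_ball.
have mb : mu (ball (x : R) rho) = (rho *+ 2)%:E := lebesgue_measure_ball _ (ltW rho0).
by rewrite [X in (_ * X)%E]mb -EFinM mulrC.
Qed.

(** The bound [B] on g makes the maximal function finite everywhere, so [fine] loses nothing. *)
Definition maximal_fun (x : R) : R := fine (HL_maximal g x).

Let HLE x : HL_maximal g x = (maximal_fun x)%:E.
Proof.
rewrite /maximal_fun fineK// ge0_fin_numE ?HL_maximalT_ge0//.
by apply: le_lt_trans (HL_le x) _; rewrite ltry.
Qed.

Lemma maximal_fun_ge0 x : 0 <= maximal_fun x.
Proof. by rewrite -lee_fin -HLE HL_maximalT_ge0. Qed.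

Lemma measurable_maximal_fun : measurable_fun setT (maximal_fun : mR -> R).
Proof.
apply: (measurableT_comp (@fine_measurable R setT measurableT)).
exact: measurable_HL_maximal lg.
Qed.

Lemma ball_le_maximal_fun x rho : 0 < rho ->
  (\int[mu]_(y in ball x rho) (g y)%:E <= (2 * rho * maximal_fun x)%:E)%E.
Proof.
move=> rho0; have : (iavg g (ball x rho) <= HL_maximal g x)%E.
  by apply: ereal_sup_ubound; exists rho => //=; rewrite in_itv/= rho0.
have r2 : 0 < rho *+ 2 by rewrite mulrn_wgt0.
rewrite HLE /iavg lebesgue_measure_ball ?(ltW rho0)// inver gt_eqF//.
rewrite -lee_pdivlMl ?invr_gt0// invrK -EFinM [2 * rho]mulr_natl.
apply: le_trans; rewrite le_eqVlt; apply/orP; left; apply/eqP.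
by apply: eq_integral => y _; rewrite /= ger0_norm.
Qed.

(** Since g <= g1 + l/2, where g1 is g cut to the set g > l/2, an average of g above l forces one of
    g1 above l/2. The weak (1,1) inequality with constant 3 at level l/2 gives 6/l; the cut is what
    allows integration over all levels. *)
Lemma maximal_weak_type (l : R) : 0 < l ->
  (mu [set x | (l < maximal_fun x)%R] <=
   (6 / l)%:E * \int[mu]_x (if (l / 2 < g x)%R then g x else 0)%:E)%E.
Proof.
move=> l0; pose g1 x := if l / 2 < g x then g x else 0.
have mg1 : measurable_fun setT (g1 : mR -> R).
  have mb : measurable_fun setT (fun y : mR => l / 2 < g y).
    by apply: measurable_fun_ltr => //; exact: measurable_cst.
  by apply: measurable_fun_ifT => //; exact: measurable_cst.
have g10 x : 0 <= g1 x by rewrite /g1; case: ifP.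
have ig1 : mu.-integrable setT (EFin \o g1).
  apply: (integrable_le_real mg1 ig) => x; rewrite ger0_norm// /g1.
  by case: ifP.
have lg1 := integrable_locally_integrable ig1.
have l2 : 0 < l / 2 by rewrite divr_gt0.
have -> : [set x | (l < maximal_fun x)%R] = [set x | (l%:E < HL_maximal g x)%E].
  by apply/seteqP; split=> x /=; rewrite HLE lte_fin.
apply: (@le_trans _ _ (mu [set x | (HL_maximal g1 x > (l / 2)%:E)%E])).
  apply: le_measure; rewrite ?inE.
  - rewrite -[X in measurable X]setTI.
    apply: emeasurable_fun_o_infty => //.
    exact: measurable_HL_maximal.
  - rewrite -[X in measurable X]setTI; apply: emeasurable_fun_o_infty => //.
    exact: measurable_HL_maximal.
  - move=> x /= /ereal_sup_gt[_ [rho + <-]].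
    rewrite /= in_itv/= andbT => rho0 h.
    apply: lt_le_trans (ereal_sup_ubound _); last first.
      by exists rho => //=; rewrite in_itv/= rho0.
    move: h; have r2 : 0 < rho *+ 2 by rewrite mulrn_wgt0.
    rewrite /iavg lebesgue_measure_ball ?(ltW rho0)// inver gt_eqF//.
    rewrite !lte_pdivlMl// -!EFinM.
    apply: contraTT; rewrite -!leNgt => h; have mB := measurable_ball (x : R) rho.
    apply: (@le_trans _ _ (\int[mu]_(y in ball x rho) ((g1 y)%:E + (l / 2)%:E))%E).
      apply: ge0_le_integral => //.
      - apply: measurable_funTS; apply: measurableT_comp => //.
        exact/measurable_EFinP.
      - by apply: measurable_funTS; apply/measurable_EFinP; meas.
      - move=> y _; rewrite -EFinD lee_fin ger0_norm// /g1.
        by case: ltP => // ?; [rewrite lerDl ltW|rewrite add0r].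
    rewrite ge0_integralD//.
    - have mb : mu (ball (x : R) rho) = (rho *+ 2)%:E := lebesgue_measure_ball _ (ltW rho0).
      rewrite integral_cst// [X in (_ + _ * X)%E]mb.
      have -> : (rho *+ 2 * l)%:E = ((rho *+ 2 * (l / 2))%:E + (l / 2 * (rho *+ 2))%:E)%E.
        by rewrite -EFinD; congr (_%:E); lra.
      rewrite -EFinM; apply: leeD => //; apply: le_trans h.
      rewrite le_eqVlt; apply/orP; left; apply/eqP.
      by apply: eq_integral => y _; rewrite /= ger0_norm.
    - by move=> y _; rewrite lee_fin.
    - by apply: measurable_funTS; apply/measurable_EFinP.
    - by move=> y _; rewrite lee_fin ltW.
apply: le_trans (maximal_inequality lg1 l2) _.
rewrite (_ : 3 / (l / 2) = 6 / l); last by field; rewrite gt_eqF.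
rewrite le_eqVlt; apply/orP; left; apply/eqP; congr (_ * _)%E.
by apply: eq_integral => y _; rewrite /= ger0_norm.
Qed.

(** Marcinkiewicz's argument in logarithmic levels: integrate [maximal_weak_type] at level e^u over
    u, then exchange the integrals. The inner one is (2 g)^(P-1) up to a constant, finite because P
    > 1. *)
Lemma maximal_strong_type_layer (P C : R) : 1 < P -> 0 < C ->
  (forall y, 0 <= y -> (\int[mu]_u (exp_below (P - 1) y u)%:E <= (C * y `^ (P - 1))%:E)%E) ->
  (\int[mu]_x (maximal_fun x `^ P)%:E <=
   (expR P * (6 * (C * 2 `^ (P - 1))))%:E * \int[mu]_x (g x `^ P)%:E)%E.
Proof.
move=> P1 C0 HC; have P0 : 0 < P by lra.
have mm := measurable_maximal_fun.
have m2 f : measurable_fun setT (f : mR -> R) ->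
    measurable_fun setT (fun w : mR * mR => exp_below P (f w.1) w.2).
  move=> mf; apply: measurable_exp_below; last exact: measurable_snd.
  exact: (measurableT_comp mf measurable_fst).
pose F (w : mR * mR) := (exp_below P (maximal_fun w.1) w.2)%:E.
have mF : measurable_fun setT F by apply/measurable_EFinP; exact: m2.
have F0 w : (0 <= F w)%E by rewrite lee_fin exp_below_ge0.
(* The factor 6/l at level l = e^u lowers the exponent from P to P - 1, and the cut l/2 < g reads
   e^u < 2 g. *)
pose K (w : mR * mR) : R := g w.1 * exp_below (P - 1) (2 * g w.1) w.2.
have mg1 : measurable_fun setT (fun w : mR * mR => g w.1).
  exact: (measurableT_comp mg measurable_fst).
have mK : measurable_fun setT K.
  apply: measurable_funM => //; apply: measurable_exp_below; last exact: measurable_snd.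
  by apply: measurable_funM => //; exact: measurable_cst.
have mKE : measurable_fun setT (fun w : mR * mR => (K w)%:E) by exact/measurable_EFinP.
have K0 w : 0 <= K w by rewrite mulr_ge0// exp_below_ge0.
have K0E w : (0 <= (K w)%:E)%E by rewrite lee_fin.
have mK1 x : measurable_fun setT (fun u : mR => K (x, u)).
  exact: (measurableT_comp mK (pair1_measurable x)).
have mK2 u : measurable_fun setT (fun x : mR => K (x, u)).
  exact: (measurableT_comp mK (pair2_measurable u)).
apply: (@le_trans _ _ (\int[mu]_x ((expR P)%:E * \int[mu]_u F (x, u)))%E).
  apply: ge0_le_integral => //.
  - by move=> x _; rewrite lee_fin powR_ge0.
  - by apply/measurable_EFinP; meas.
  - apply: measurable_funeM.
    exact: (@measurable_fun_fubini_tonelli_F _ _ mR mR R mu F mF F0).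
  - move=> x _; apply: powR_le_exp_below => //; exact: maximal_fun_ge0.
rewrite ge0_integralZl ?lee_fin ?expR_ge0//; last 2 first.
- exact: (@measurable_fun_fubini_tonelli_F _ _ mR mR R mu F mF F0).
- by move=> x _; exact: integral_ge0.
rewrite EFinM -muleA; apply: lee_wpmul2l; first by rewrite lee_fin expR_ge0.
rewrite (@fubini_tonelli _ _ mR mR R mu mu F mF F0).
apply: (@le_trans _ _ (\int[mu]_u (6%:E * \int[mu]_x (K (x, u))%:E))%E).
  apply: ge0_le_integral => //.
  - by move=> u _; exact: integral_ge0.
  - exact: (@measurable_fun_fubini_tonelli_G _ _ mR mR R mu F mF F0).
  - apply: measurable_funeM.
    exact: (@measurable_fun_fubini_tonelli_G _ _ mR mR R mu _ mKE K0E).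
  - move=> u _.
    have u0 := expR_gt0 u.
    have mS : measurable ([set x | (expR u < maximal_fun x)%R] : set mR).
      rewrite -[X in measurable X]setTI.
      by apply: (emeasurable_fun_o_infty (f := EFin \o maximal_fun) _ _ (expR u)%:E) => //;
        exact/measurable_EFinP.
    have E1 : (\int[mu]_x F (x, u) =
        (expR (P * u))%:E * mu [set x | (expR u < maximal_fun x)%R])%E.
      have -> : mu [set x | (expR u < maximal_fun x)%R] =
          (\int[mu]_x (\1_[set x | (expR u < maximal_fun x)%R] x)%:E)%E.
        by rewrite integral_indic// setIT.
      rewrite -ge0_integralZl ?lee_fin ?expR_ge0//; last first.
        by apply/measurable_EFinP; exact: measurable_indic.
      apply: eq_integral => x _; rewrite /F /exp_below /= indicE.
      have -> : (x \in [set x | expR u < maximal_fun x]) = (expR u < maximal_fun x).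
        by apply/idP/idP; rewrite inE.
      by case: (expR u < maximal_fun x); [exact/esym/mule1|exact/esym/mule0].
    rewrite E1; apply: le_trans (lee_wpmul2l _ (maximal_weak_type u0)) _.
      by rewrite lee_fin expR_ge0.
    rewrite muleA -EFinM.
    have -> : expR (P * u) * (6 / expR u) = 6 * expR ((P - 1) * u).
      by rewrite mulrBl mul1r expRB; ring.
    rewrite EFinM -muleA; apply: lee_wpmul2l => //.
    rewrite -ge0_integralZl ?lee_fin ?expR_ge0//; last 2 first.
    - apply/measurable_EFinP; apply: measurable_fun_ifT => //.
      by apply: measurable_fun_ltr => //; exact: measurable_cst.
    - by move=> x _; rewrite lee_fin; case: ifP.
    rewrite le_eqVlt; apply/orP; left; apply/eqP; apply: eq_integral => x _.
    have hE : (expR u / 2 < g x) = (expR u < 2 * g x) by rewrite ltr_pdivrMr// mulrC.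
    rewrite /K /exp_below /= hE -EFinM; congr (_%:E).
    by case: ifP => _; [exact: mulrC|rewrite !mulr0].
rewrite ge0_integralZl//; last 2 first.
- exact: (@measurable_fun_fubini_tonelli_G _ _ mR mR R mu _ mKE K0E).
- by move=> u _; apply: integral_ge0 => x _; rewrite lee_fin.
rewrite EFinM -muleA; apply: lee_wpmul2l => //.
rewrite -(@fubini_tonelli _ _ mR mR R mu mu _ mKE K0E).
apply: (@le_trans _ _ (\int[mu]_x ((C * 2 `^ (P - 1))%:E * (g x `^ P)%:E))%E).
  apply: ge0_le_integral => //.
  - by move=> x _; apply: integral_ge0 => u _; rewrite lee_fin.
  - exact: (@measurable_fun_fubini_tonelli_F _ _ mR mR R mu _ mKE K0E).
  - by apply: measurable_funeM; apply/measurable_EFinP; meas.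
  - move=> x _; rewrite /fubini_F /= /K /=.
    under eq_integral do rewrite EFinM.
    rewrite ge0_integralZl ?lee_fin//; last 2 first.
    - by apply/measurable_EFinP; exact: measurable_exp_below.
    - by move=> u _; rewrite lee_fin exp_below_ge0.
    apply: le_trans (lee_wpmul2l _ (HC _ _)) _; [by rewrite lee_fin|exact: mulr_ge0|].
    rewrite -!EFinM lee_fin powRM//.
    have -> : g x `^ P = g x * g x `^ (P - 1).
      have [->|gn] := eqVneq (g x) 0; first by rewrite powR0 ?mul0r// gt_eqF.
      have gp : 0 < g x by rewrite lt_neqAle eq_sym gn g0.
      by rewrite -{2}[g x]powRr1// -gt0_powRD// addrC subrK.
    by rewrite le_eqVlt; apply/orP; left; apply/eqP; ring.
rewrite ge0_integralZl ?lee_fin//.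
- by apply/measurable_EFinP; meas.
- by move=> x _; rewrite lee_fin powR_ge0.
- by rewrite mulr_ge0 ?powR_ge0// ltW.
Qed.

End maximal_strong_type.

(** The maximal function is hidden behind the two properties consumed later, ball averages and the
    L^P bound; [C] is chosen before [g]. *)
Lemma hardy_littlewood {R : realType} (P : R) : 1 < P -> exists2 C : R, 0 < C &
  forall (g : R -> R) (B : R),
  measurable_fun setT (g : measurableTypeR R -> R) -> (forall x, 0 <= g x) ->
  (forall x, g x <= B) ->
  (@lebesgue_measure R).-integrable setT (EFin \o g) ->
  exists G : R -> R,
    [/\ measurable_fun setT (G : measurableTypeR R -> R), forall x, 0 <= G x,
        forall x rho, 0 < rho ->
          (\int[@lebesgue_measure R]_(y in ball x rho) (g y)%:E <= (2 * rho * G x)%:E)%E &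
        (\int[@lebesgue_measure R]_x (G x `^ P)%:E <=
         C%:E * \int[@lebesgue_measure R]_x (g x `^ P)%:E)%E].
Proof.
move=> P1; have P10 : 0 < P - 1 by rewrite subr_gt0.
have [C C0 HC] := exp_below_le P10.
exists (expR P * (6 * (C * 2 `^ (P - 1)))); first by rewrite !mulr_gt0 ?expR_gt0 ?powR_gt0.
move=> g B mg g0 gB ig; exists (maximal_fun g); split.
- exact: measurable_maximal_fun ig.
- exact: (maximal_fun_ge0 mg g0 gB ig).
- exact: (ball_le_maximal_fun mg g0 gB ig).
- exact: (maximal_strong_type_layer mg g0 gB ig P1 C0 HC).
Qed.

(** * Schwartz functions and exponents *)

Section schwartz_decay.
Context {R : realType}.
Local Notation mR := (measurableTypeR R).
Local Notation mu := (@lebesgue_measure R).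
Variable f : R -> R[i].
Hypothesis sf : schwartz f.

Lemma cmeasurable_schwartz : cmeasurable (f : mR -> R[i]).
Proof.
have [d _] := sf.
by split; apply: continuous_measurable_fun => x; apply: differentiable_continuous;
  apply/derivable1_diffP; have [] := d 0 x.
Qed.

(** The bounds on |f| and x^2 |f| combine through (1 + |x|)^2 <= 2 (1 + x^2). *)
Lemma schwartz_decay : exists2 M : R, 0 <= M &
  forall x, normc (f x) <= M * (1 + `|x|) `^ (- (1 + 1)).
Proof.
have [_ b] := sf; have [M0 h0] := b 0 0; have [M2 h2] := b 2 0.
have e x : cderiv1n 0 f x = f x by exact: complexP.
have {}h0 x : normc (f x) <= M0 by have := h0 x; rewrite expr0 mul1r e.
have {}h2 x : x ^+ 2 * normc (f x) <= M2 by have := h2 x; rewrite real_normK ?num_real// e.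
have Mx x : normc (f x) * (1 + `|x|) ^+ 2 <= 2 * (M0 + M2).
  have := h0 x; have := h2 x; have := normc_ge0 (f x).
  have := sqr_ge0 (1 - `|x|); rewrite -[x ^+ 2]real_normK ?num_real//.
  move: (normc (f x)) (`|x|) => y z; nra.
exists (2 * (M0 + M2)).
  by apply: le_trans (Mx 0); rewrite mulr_ge0 ?normc_ge0 ?sqr_ge0.
move=> x; have x0 : 0 < 1 + `|x| by rewrite ltr_pwDl.
have -> : - (1 + 1) = - 2%:R :> R by ring.
by rewrite powRN powR_mulrn ?(ltW x0)// ler_pdivlMr ?exprn_gt0.
Qed.

Lemma schwartz_powR (q : R) : 1 <= q ->
  [/\ measurable_fun setT (fun x : mR => normc (f x) `^ q),
      mu.-integrable setT (EFin \o (fun x => normc (f x) `^ q)) &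
      exists B, forall x, normc (f x) `^ q <= B].
Proof.
move=> q1; have q0 : 0 < q by lra.
have [M M0 hM] := schwartz_decay.
have mn : measurable_fun setT (fun x : mR => normc (f x)).
  exact: measurable_normc cmeasurable_schwartz.
have mq : measurable_fun setT (fun x : mR => normc (f x) `^ q) by meas.
have H x : normc (f x) `^ q <= M `^ q * (1 + `|x|) `^ (- (1 + 1)).
  have x1 : 1 <= 1 + `|x| by rewrite lerDl.
  apply: (le_trans (powR_homo (ltW q0) (normc_ge0 _) (hM x))).
  rewrite powRM ?powR_ge0// ler_wpM2l ?powR_ge0// -powRrM.
  by apply: ler_powR => //; nra.
split => //.
  apply: (integrable_decay_bound ltr01 mq) => x.
  by rewrite ger0_norm ?powR_ge0//; exact: H.
exists (M `^ q) => x; apply: le_trans (H x) _.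
rewrite ler_piMr ?powR_ge0//.
have x1 : 1 <= 1 + `|x| by rewrite lerDl.
apply: (@le_trans _ _ ((1 + `|x|) `^ 0)); last by rewrite powRr0.
by apply: ler_powR => //; lra.
Qed.

End schwartz_decay.

(** * Admissible exponents *)

Section exponents.
Context {R : realType}.

(** Any two distinct indices can serve as i0 and i1, here the first two: all other weights w_i are
    at least 1/2, so the sum is at least m/2 - 1 + w_i0 + w_i1. With m >= 4 this also yields alpha >
    1. *)
Lemma exponent_choice (m : nat) (alpha : R) (ps : 'I_m -> R) : (4 <= m)%N ->
  (forall i, 1 < ps i) ->
  \sum_i Num.max (ps i)^-1 2^-1 - 1 < alpha ->
  1 < alpha /\ exists (i0 i1 : 'I_m) (qs : 'I_m -> R),
  [/\ i0 != i1, forall i, 1 <= qs i <= 2, forall i, qs i < ps i,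
      forall i, i != i0 -> i != i1 -> qs i = 1 &
      m%:R / 2 - 2 + (qs i0)^-1 + (qs i1)^-1 < alpha].
Proof.
move=> m4 ps1; set w := fun i => Num.max (ps i)^-1 2^-1.
rewrite -[\sum_i _]/(\sum_i w i) => ha.
have w2 i : 2^-1 <= w i by rewrite le_max lexx orbT.
have w1 i : w i < 1.
  by rewrite gt_max invf_lt1 ?ps1 ?(lt_trans ltr01)//; lra.
have wp i : (ps i)^-1 <= w i by rewrite le_max lexx.
have mR : 4 <= m%:R :> R by rewrite ler_nat.
pose i0 : 'I_m := Ordinal (leq_trans (isT : (1 <= 4)%N) m4).
pose i1 : 'I_m := Ordinal (leq_trans (isT : (2 <= 4)%N) m4).
have i01 : i1 != i0 by [].
have sw : m%:R / 2 - 1 + w i0 + w i1 <= \sum_i w i.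
  have -> : \sum_i w i = \sum_i (w i - 2^-1) + m%:R / 2.
    by rewrite sumrB sumr_const card_ord mulr_natl subrK.
  rewrite (bigD1 i0)//= (bigD1 i1)//=.
  have : 0 <= \sum_(i | (i != i0) && (i != i1)) (w i - 2^-1).
    by apply: sumr_ge0 => i _; rewrite subr_ge0.
  move: (\sum_(i | _) _) => s s0; lra.
have a1 : 1 < alpha by have := w2 i0; have := w2 i1; lra.
split => //.
pose gam := alpha - (\sum_i w i - 1).
have gam0 : 0 < gam by rewrite subr_gt0.
(* The chosen exponents are 1/v: v > w gives q < p_i and q <= 2, the cap at 1 gives q >= 1. Two
   increments gam/3 stay below the slack [gam], so the threshold remains strict. *)
pose v i := Num.min (w i + gam / 3) 1.
have v1 i : v i <= 1 by rewrite ge_min lexx orbT.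
have vw i : w i < v i by rewrite lt_min w1 andbT ltrDl divr_gt0.
have vg i : v i <= w i + gam / 3 by rewrite ge_min lexx.
have v0 i : 0 < v i by apply: le_lt_trans (vw i); apply: le_trans (w2 i).
exists i0, i1, (fun i => if (i == i0) || (i == i1) then (v i)^-1 else 1).
split => //.
- move=> i; case: ifP => _; last by rewrite lexx ler1n.
  rewrite invf_ge1// v1 -[leRHS]invrK lef_pV2 ?posrE ?invr_gt0//.
  exact: le_trans (w2 i) (ltW (vw i)).
- move=> i; case: ifP => _ //.
  rewrite -[ps i]invrK ltf_pV2 ?posrE ?invr_gt0 ?v0 ?(lt_trans ltr01 (ps1 i))//.
  exact: le_lt_trans (wp i) (vw i).
- by move=> i /negbTE -> /negbTE ->.
- rewrite /= ?eqxx ?orbT /= !invrK.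
  have := vg i0; have := vg i1; rewrite /gam; lra.
Qed.

(** The three cases share one threshold, since max(1/p_i, 1/2) is 1/p_i when p_i < 2 and 1/2
    otherwise; in the mixed case m - l indices contribute 1/2 each. *)
Lemma theorem_exponents (m : nat) (alpha p : R) (ps : 'I_m -> R) :
  (4 <= m)%N -> (forall i, 1 < ps i) -> p^-1 = \sum_(i < m) (ps i)^-1 ->
  [\/ (forall i, 2 <= ps i) /\ (m%:R - 2) / 2 < alpha,
      exists (s : {perm 'I_m}) (l : nat),
        [/\ (1 <= l <= m - 1)%N,
            forall k : 'I_m, (k < l)%N -> ps (s k) < 2,
            forall k : 'I_m, (l <= k)%N -> 2 <= ps (s k)
          & \sum_(k < m | (k < l)%N) (ps (s k))^-1
            + (m%:R - l%:R - 2) / 2 < alpha]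
    | (forall i, ps i < 2) /\ p^-1 - 1 < alpha] ->
  \sum_i Num.max (ps i)^-1 2^-1 - 1 < alpha.
Proof.
move=> m4 ps1 pE.
have p0 i : 0 < ps i := lt_trans ltr01 (ps1 i).
have wl i : ps i < 2 -> Num.max (ps i)^-1 2^-1 = (ps i)^-1.
  by move=> h; apply/max_idPl; rewrite lef_pV2 ?posrE// ltW.
have wr i : 2 <= ps i -> Num.max (ps i)^-1 2^-1 = 2^-1.
  by move=> h; apply/max_idPr; rewrite lef_pV2 ?posrE.
case=> [[h]|[s [l [/andP[l1 lm] hl hr]]]|[h]].
- under eq_bigr do rewrite wr//.
  by rewrite sumr_const card_ord -mulr_natl; lra.
- move=> ha; rewrite (reindex_inj (@perm_inj _ s))/= (bigID (fun k : 'I_m => (k < l)%N))/=.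
  rewrite (eq_bigr (fun k => (ps (s k))^-1)); last by move=> k kl; rewrite wl ?hl.
  rewrite [X in _ + X - 1](eq_bigr (fun=> 2^-1)); last first.
    by move=> k; rewrite -leqNgt => kl; rewrite wr ?hr.
  have -> : \sum_(k < m | ~~ (k < l)%N) 2^-1 = (m%:R - l%:R) / 2 :> R.
    rewrite sumr_const -[LHS]mulr_natl; congr (_ * _).
    have lm' : (l <= m)%N by apply: leq_trans lm (leq_subr _ _).
    rewrite -natrB//; congr (_%:R).
    rewrite -sum1_card (eq_bigl (fun k : 'I_m => ~~ (k < l)%N)) //.
    transitivity (\sum_(0 <= k < m | ~~ (k < l)%N) 1)%N; first by rewrite big_mkord.
    rewrite (big_cat_nat (n := l))//= big_nat_cond big1 ?add0n; last first.
      by move=> k /andP[/andP[_ ->]].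
    rewrite big_nat_cond (eq_bigl (fun k => (l <= k < m)%N && true)); last first.
      by move=> k; case/boolP: (l <= k < m)%N => //= /andP[lk _]; rewrite -leqNgt lk.
    by rewrite -big_nat_cond sum_nat_const_nat muln1.
  by move: ha; move: (\sum_(k < m | _) _) => X; lra.
- under eq_bigr do rewrite wl//.
  by rewrite -pE.
Qed.

End exponents.

(** * Products in L^p *)

Section weighted_means.
Context {R : realType}.

Lemma powR_prod (I : Type) (r : seq I) (F : I -> R) (s : R) :
  (forall i, 0 <= F i) -> (\prod_(i <- r) F i) `^ s = \prod_(i <- r) F i `^ s.
Proof.
move=> F0; elim: r => [|i r IH]; first by rewrite !big_nil powR1.
by rewrite !big_cons powRM ?IH// prodr_ge0.
Qed.

(** Weighted arithmetic-geometric means. Let S be the right side; the inequality ln x <= x - 1 at x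
    = a_i / S, summed with weights th_i, has right side 0. A vanishing a_i is set aside because of
    the logarithm. *)
Lemma prod_powR_le_sum (I : finType) (a th : I -> R) :
  (forall i, 0 <= a i) -> (forall i, 0 < th i) -> \sum_i th i = 1 ->
  \prod_i a i `^ th i <= \sum_i th i * a i.
Proof.
move=> a0 t0 t1; have s0 : 0 <= \sum_i th i * a i.
  by apply: sumr_ge0 => i _; rewrite mulr_ge0// ltW.
have [/existsP[j /eqP aj]|/existsPn an] := boolP [exists j, a j == 0].
  rewrite (bigD1 j)//= aj powR0 ?mul0r// gt_eqF//; exact: t0.
have ap i : 0 < a i by rewrite lt_neqAle eq_sym an a0.
set S := \sum_i _ in s0 *.
have Sp : 0 < S.
  rewrite lt_neqAle s0 andbT eq_sym; apply/negP => /eqP S0.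
  have /eqP := t1; rewrite big1 ?(eq_sym 0) ?oner_eq0// => i _.
  have /eqP : th i * a i = 0.
    by apply: (psumr_eq0P _ S0) => // k _; rewrite mulr_ge0// ltW.
  by rewrite mulf_eq0 !gt_eqF.
have -> : \prod_i a i `^ th i = expR (\sum_i th i * ln (a i)).
  by rewrite expR_sum; apply: eq_bigr => i _; rewrite /powR gt_eqF.
rewrite -[leRHS]lnK ?posrE// ler_expR.
have -> : ln S = \sum_i th i * ln S by rewrite -mulr_suml t1 mul1r.
rewrite -subr_ge0 -sumrB; apply: (@le_trans _ _ (\sum_i th i * (1 - a i / S))).
  under eq_bigr do rewrite mulrBr mulr1 mulrA.
  by rewrite sumrB t1 -mulr_suml -/S divff ?subrr// gt_eqF.
apply: ler_sum => i _; rewrite -mulrBr ler_wpM2l ?(ltW (t0 i))//.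
have := @le_ln1Dx R (a i / S - 1); rewrite addrCA subrr addr0 lnM ?posrE ?invr_gt0// lnV//.
have : 0 < a i / S by rewrite divr_gt0.
move: (a i / S) (ln (a i)) (ln S) => x y z x0 h; have : -1 < x - 1 by lra.
by move=> /h; lra.
Qed.

(** The estimates that divide by the bounds need them positive. If some bound is 0, it is replaced
    by a small positive one and the product tends to 0. *)
Lemma le_prod_powR_closure (m : nat) (I : \bar R) (D th : 'I_m -> R) :
  (forall i, 0 <= D i) -> (forall i, 0 < th i) ->
  (forall E, (forall i, 0 < E i) -> (forall i, D i <= E i) ->
    (I <= (\prod_i E i `^ th i)%:E)%E) ->
  (I <= (\prod_i D i `^ th i)%:E)%E.
Proof.
move=> D0 t0 H; have [/existsP[j /eqP Dj]|/existsPn Dn] := boolP [exists j, D j == 0]; last first.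
  by apply: H => // i; rewrite lt_neqAle eq_sym Dn D0.
rewrite [X in (_ <= X%:E)%E](bigD1 j)//= Dj powR0 ?mul0r ?gt_eqF ?t0//.
set K := \prod_(i | i != j) (D i + 1) `^ th i.
have K0 : 0 < K by apply: prodr_gt0 => i _; rewrite powR_gt0// ltr_wpDl.
apply/lee_addgt0Pr => e e0; rewrite add0e.
(* The value at [j] makes the product of the perturbed bounds equal to e. *)
pose E i := if i == j then (e / K) `^ (th j)^-1 else D i + 1.
have : (I <= (\prod_i E i `^ th i)%:E)%E.
  apply: H => i; rewrite /E; case: eqP => [ij|_].
  - by rewrite powR_gt0// divr_gt0.
  - by rewrite ltr_wpDl.
  - by rewrite ij Dj powR_ge0.
  - by rewrite lerDl.
rewrite (bigD1 j)//= {1}/E eqxx -powRrM mulVf ?gt_eqF ?t0// powRr1 ?divr_ge0 ?(ltW e0) ?(ltW K0)//.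
rewrite (eq_bigr (fun i => (D i + 1) `^ th i)); last by move=> i /negbTE ij; rewrite /E ij.
by rewrite -/K divfK// gt_eqF.
Qed.

End weighted_means.

Section holder_product.
Context d (T : measurableType d) {R : realType} (mu : {measure set T -> \bar R}).

(* Unlike [ge0_le_integral], this does not ask for measurability: the integral
   of a nonnegative function is a supremum over the simple functions below it. *)
Lemma ge0_le_integral_nonmeasurable (f1 f2 : T -> \bar R) :
  (forall x, (0 <= f1 x)%E) -> (forall x, (f1 x <= f2 x)%E) ->
  (\int[mu]_x f1 x <= \int[mu]_x f2 x)%E.
Proof.
move=> f10 f12; rewrite !ge0_integralTE//; last by move=> x; exact: le_trans (f12 x).
apply: ereal_sup_le => _ [h /= hf <-]; exists h => //= x.
exact: le_trans (hf x) (f12 x).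
Qed.

(** Hoelder's inequality for m functions: the arithmetic-geometric inequality applied to u_i / D_i,
    then integrated term by term. *)
Lemma le_integral_prod_powR (m : nat) (u : 'I_m -> T -> R) (D th : 'I_m -> R) :
  (forall i, measurable_fun setT (u i)) -> (forall i x, 0 <= u i x) ->
  (forall i, 0 < th i) -> \sum_i th i = 1 -> (forall i, 0 < D i) ->
  (forall i, (\int[mu]_x (u i x)%:E <= (D i)%:E)%E) ->
  (\int[mu]_x (\prod_i u i x `^ th i)%:E <= (\prod_i D i `^ th i)%:E)%E.
Proof.
move=> mu_ u0 t0 t1 D0 uD.
have K0 : 0 < \prod_i D i `^ th i by apply: prodr_gt0 => i _; exact: powR_gt0.
have c0 i : 0 <= (\prod_i D i `^ th i) * (th i / D i).
  by rewrite mulr_ge0 ?(ltW K0)// divr_ge0// ltW.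
have mc i : measurable_fun setT (fun x => (((\prod_i D i `^ th i) * (th i / D i)) * u i x)%:E).
  by apply/measurable_EFinP; apply: measurable_funM => //; exact: measurable_cst.
have uc i x : (0 <= (((\prod_i D i `^ th i) * (th i / D i)) * u i x)%:E)%E.
  by rewrite lee_fin mulr_ge0.
apply: (@le_trans _ _ (\int[mu]_x (\sum_i (((\prod_i D i `^ th i) * (th i / D i)) * u i x)%:E))%E).
  apply: ge0_le_integral_nonmeasurable => x.
    by rewrite lee_fin prodr_ge0// => i _; exact: powR_ge0.
  rewrite sumEFin lee_fin.
  have h := prod_powR_le_sum (fun i => divr_ge0 (u0 i x) (ltW (D0 i))) t0 t1.
  rewrite -(ler_pM2l K0) -big_split/= in h; apply: (le_trans (le_trans _ h)).
    rewrite le_eqVlt; apply/orP; left; apply/eqP; apply: eq_bigr => i _.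
    rewrite -powRM ?(ltW (D0 i)) ?divr_ge0 ?(ltW (D0 i))//.
    by rewrite mulrC divfK// gt_eqF ?D0.
  rewrite mulr_sumr; apply: ler_sum => i _.
  by rewrite le_eqVlt; apply/orP; left; apply/eqP; ring.
rewrite ge0_integral_sum//.
have -> : (\prod_i D i `^ th i)%:E = (\sum_i (((\prod_i D i `^ th i) * (th i / D i)) * D i)%:E)%E.
  rewrite sumEFin; congr (_%:E).
  rewrite -[LHS]mulr1 -t1 mulr_sumr; apply: eq_bigr => i _.
  by rewrite -mulrA divfK// gt_eqF.
apply: lee_sum => i _; under eq_integral do rewrite EFinM.
rewrite ge0_integralZl ?lee_fin//; [|exact/measurable_EFinP|by move=> x _; rewrite lee_fin].
by rewrite [leRHS]EFinM lee_wpmul2l// lee_fin.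
Qed.

End holder_product.

(** * From pointwise domination to the norm inequality *)

Section maximal_domination.
Context {R : realType}.
Local Notation mR := (measurableTypeR R).
Local Notation mu := (@lebesgue_measure R).

(** The bound does not depend on r, so it passes to the supremum; since A i may vanish, the estimate
    is used for all positive E >= A and closed up. *)
Lemma max_bochner_riesz_le (m : nat) (alpha C : R) (qs : 'I_m -> R)
    (f : 'I_m -> R -> R[i]) (x : R) (A : 'I_m -> R) :
  0 < C -> (forall i, 0 < qs i) -> (forall i, 0 <= A i) ->
  (forall i rho, 0 < rho ->
    (\int[mu]_(y in ball x rho) (normc (f i y) `^ qs i)%:E <= (2 * rho * A i)%:E)%E) ->
  (forall r E, 0 < r -> (forall i, 0 < E i) ->
    (forall i rho, 0 < rho ->
      (\int[mu]_(y in ball x rho) (normc (f i y) `^ qs i)%:E <= (2 * rho * E i)%:E)%E) ->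
    normc (bochner_riesz alpha r f x) <= C * \prod_i E i `^ (qs i)^-1) ->
  (max_bochner_riesz alpha f x <= (C * \prod_i A i `^ (qs i)^-1)%:E)%E.
Proof.
move=> C0 q0 A0 hA H; apply: ge_ereal_sup => _ [r + <-] => /= r0.
rewrite EFinM -lee_pdivrMl// -EFinM.
apply: le_prod_powR_closure => // [i|E E0 AE]; first by rewrite invr_gt0.
rewrite lee_fin ler_pdivrMl//; apply: H => // i rho rho0.
apply: le_trans (hA i rho rho0) _.
by rewrite lee_fin ler_wpM2l ?AE// mulr_ge0// ltW.
Qed.

Lemma max_bochner_riesz_ge0 (m : nat) (alpha : R) (f : 'I_m -> R -> R[i]) (x : R) :
  (0 <= max_bochner_riesz alpha f x)%E.
Proof.
apply: (@le_trans _ _ (normc (bochner_riesz alpha 1 f x))%:E).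
  by rewrite lee_fin normc_ge0.
by apply: ereal_sup_ubound; exists 1 => //=.
Qed.

Lemma Lnorm_powR (q : R) (F : R -> R) : 0 < q -> (forall x, 0 <= F x) ->
  mu.-integrable setT (EFin \o (fun x => F x `^ q)) ->
  Lnorm mu q%:E (fun x => (F x)%:E) =
  ((\int[mu]_x (F x `^ q))%R `^ q^-1)%:E.
Proof.
move=> q0 F0 iF; rewrite unlock -poweR_EFin; congr (poweR _ _).
rewrite /Rintegral fineK; last exact: integrable_fin_num iF.
by apply: eq_integral => x _; rewrite /= ger0_norm.
Qed.

End maximal_domination.

Theorem theorem2p5 (R : realType) (m : nat) (m_ge4 : (4 <= m)%N)
    (alpha : R) (alpha_ge0 : 0 <= alpha)
    (ps : 'I_m -> R) (ps_gt1 : forall i, 1 < ps i)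
    (p : R) (pE : p^-1 = \sum_(i < m) (ps i)^-1) :
  [\/ (* (1) *)
      (forall i, 2 <= ps i) /\ (m%:R - 2) / 2 < alpha,
      (* (2) *)
      exists (s : {perm 'I_m}) (l : nat),
        [/\ (1 <= l <= m - 1)%N,
            forall k : 'I_m, (k < l)%N -> ps (s k) < 2,
            forall k : 'I_m, (l <= k)%N -> 2 <= ps (s k)
          & \sum_(k < m | (k < l)%N) (ps (s k))^-1
            + (m%:R - l%:R - 2) / 2 < alpha]
    | (* (3) *)
      (forall i, ps i < 2) /\ p^-1 - 1 < alpha] ->
  exists2 C : R, 0 < C &
    forall f : 'I_m -> R -> R[i], (forall i, schwartz (f i)) ->
      (Lnorm (@lebesgue_measure R) p%:E (max_bochner_riesz alpha f) <=
       C%:E * \prod_(i < m)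
         Lnorm (@lebesgue_measure R) (ps i)%:E (fun x => (normc (f i x))%:E))%E.
Proof.
move=> /(theorem_exponents m_ge4 ps_gt1 pE) /(exponent_choice m_ge4 ps_gt1).
move=> [a1 [i0 [i1 [qs [i01 q12 qp qE ha]]]]].
have q1 i : 1 <= qs i by have /andP[] := q12 i.
have q2 i : qs i <= 2 by have /andP[] := q12 i.
have q0 i : 0 < qs i := lt_le_trans ltr01 (q1 i).
have p0 i : 0 < ps i := lt_trans ltr01 (ps_gt1 i).
have pp : 0 < p.
  rewrite -invr_gt0 pE (bigD1 i0)//= ltr_pwDl ?invr_gt0//.
  by apply: sumr_ge0 => i _; rewrite invr_ge0 ltW.
have [C C0 HC] := bochner_riesz_le a1 i01 q1 q2 qE ha.
have P1 i : 1 < ps i / qs i by rewrite ltr_pdivlMr ?mul1r.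
(* The Hardy-Littlewood constants depend on the exponents only and are fixed before the
   functions. *)
pose K i := s2val (cid2 (hardy_littlewood (P1 i))).
have K0 i : 0 < K i := s2valP (cid2 (hardy_littlewood (P1 i))).
have HK i := s2valP' (cid2 (hardy_littlewood (P1 i))).
exists (C * \prod_i K i `^ (ps i)^-1).
  by rewrite mulr_gt0//; apply: prodr_gt0 => i _; exact: powR_gt0.
move=> f sf.
have /choice[G HG] : forall i, exists G : R -> R,
    [/\ measurable_fun setT (G : measurableTypeR R -> R), forall x, 0 <= G x,
        forall x rho, 0 < rho ->
          (\int[@lebesgue_measure R]_(y in ball x rho) (normc (f i y) `^ qs i)%:E <=
           (2 * rho * G x)%:E)%E &
        (\int[@lebesgue_measure R]_x (G x `^ (ps i / qs i))%:E <=
         (K i)%:E * \int[@lebesgue_measure R]_x ((normc (f i x) `^ qs i) `^ (ps i / qs i))%:E)%E].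
  move=> i; have [mq iq [B hB]] := schwartz_powR (sf i) (q1 i).
  by apply: (HK i _ B) => // x; exact: powR_ge0.
have mG i : measurable_fun setT (G i : measurableTypeR R -> R) by have [] := HG i.
have G0 i x : 0 <= G i x by have [] := HG i.
pose N i : R := \int[@lebesgue_measure R]_x (normc (f i x) `^ ps i).
have N0 i : 0 <= N i by apply: Rintegral_ge0 => x _; exact: powR_ge0.
have iN i := let: And3 _ h _ := schwartz_powR (sf i) (ltW (ps_gt1 i)) in h.
have GN i : (\int[@lebesgue_measure R]_x (G i x `^ (ps i / qs i))%:E <= (K i * N i)%:E)%E.
  have [_ _ _ h] := HG i; apply: le_trans h _.
  rewrite EFinM /N /Rintegral fineK; last exact: integrable_fin_num (iN i).
  rewrite lee_wpmul2l ?lee_fin ?(ltW (K0 i))// le_eqVlt; apply/orP; left; apply/eqP.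
  by apply: eq_integral => x _; rewrite -powRrM mulrC divfK// gt_eqF.
have dom x : (max_bochner_riesz alpha f x <= (C * \prod_i G i x `^ (qs i)^-1)%:E)%E.
  apply: max_bochner_riesz_le => //.
    by move=> i; have [_ _ h _] := HG i; exact: h.
  move=> r E r0 E0 hE; apply: HC => // i; first exact: cmeasurable_schwartz.
  have [_ + _] := schwartz_powR (sf i) (lexx 1).
  by under eq_fun do rewrite powRr1 ?normc_ge0//.
have th0 i : 0 < p / ps i by rewrite divr_gt0.
have th1 : \sum_i p / ps i = 1 by rewrite -mulr_sumr -pE divff// gt_eqF.
(* Hoelder with weights p/p_i, which sum to 1, for the p-th power of the product of the G_i^(1/q_i):
   since (G_i^(1/q_i))^p = (G_i^(p_i/q_i))^(p/p_i), only integrals of p-th powers occur and p < 1 is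
   allowed. *)
have main : (\int[@lebesgue_measure R]_x
     (\prod_i (G i x `^ (ps i / qs i)) `^ (p / ps i))%:E <=
     (\prod_i (K i * N i) `^ (p / ps i))%:E)%E.
  apply: le_prod_powR_closure => // [i|E E0 hE]; first by rewrite mulr_ge0// ltW.
  apply: le_integral_prod_powR => // i.
  - by apply: measurable_fun_powR.
  - by move=> x; exact: powR_ge0.
  - by apply: le_trans (GN i) _; rewrite lee_fin.
rewrite (eq_bigr (fun i => (N i `^ (ps i)^-1)%:E)); last first.
  by move=> i _; rewrite Lnorm_powR// => x; exact: normc_ge0.
have -> : (\prod_(i < m) (N i `^ (ps i)^-1)%:E = (\prod_(i < m) N i `^ (ps i)^-1)%:E)%E.
  by rewrite (big_morph EFin EFinM (erefl _)).
rewrite -EFinM unlock.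
(* Both sides become 1/p-th powers, so that the comparison reduces to the integrals of p-th
   powers. *)
have -> : C * \prod_i K i `^ (ps i)^-1 * \prod_(i < m) N i `^ (ps i)^-1 =
    (C `^ p * \prod_i (K i * N i) `^ (p / ps i)) `^ p^-1.
  have pr (F : 'I_m -> R) : (forall i, 0 <= F i) ->
      (\prod_i F i `^ (p / ps i)) `^ p^-1 = \prod_i F i `^ (ps i)^-1.
    move=> F0; rewrite powR_prod => [|i]; last exact: powR_ge0.
    by apply: eq_bigr => i _; rewrite -powRrM mulrAC divff ?mul1r// gt_eqF.
  rewrite powRM ?powR_ge0//; last by apply: prodr_ge0 => i _; exact: powR_ge0.
  rewrite -powRrM divff ?gt_eqF// powRr1 ?(ltW C0)// pr; last first.
    by move=> i; rewrite mulr_ge0// ltW.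
  rewrite -mulrA -big_split/=; congr (_ * _); apply: eq_bigr => i _.
  by rewrite powRM// ltW.
rewrite -poweR_EFin; apply: gt0_ler_poweR; first by rewrite invr_ge0 ltW.
- rewrite in_itv/= leey andbT; apply: integral_ge0 => x _; exact: poweR_ge0.
- rewrite in_itv/= leey andbT lee_fin mulr_ge0 ?powR_ge0//.
  by apply: prodr_ge0 => i _; exact: powR_ge0.
apply: (@le_trans _ _ (\int[@lebesgue_measure R]_x ((C `^ p)%:E *
     (\prod_i (G i x `^ (ps i / qs i)) `^ (p / ps i))%:E))%E).
  apply: ge0_le_integral_nonmeasurable => x; first exact: poweR_ge0.
  rewrite gee0_abs ?max_bochner_riesz_ge0//.
  have -> : ((C `^ p)%:E * (\prod_i (G i x `^ (ps i / qs i)) `^ (p / ps i))%:E =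
      (C * \prod_i G i x `^ (qs i)^-1)%:E `^ p)%E.
    rewrite poweR_EFin -EFinM; congr (_%:E).
    rewrite powRM ?(ltW C0)//; last by apply: prodr_ge0 => i _; exact: powR_ge0.
    congr (_ * _); rewrite powR_prod => [|i]; last exact: powR_ge0.
    apply: eq_bigr => i _; rewrite -!powRrM; congr (_ `^ _).
    by field; rewrite !gt_eqF.
  apply: gt0_ler_poweR; rewrite ?in_itv/= ?leey ?andbT ?(ltW pp) ?max_bochner_riesz_ge0//.
  by apply: le_trans (dom x); exact: max_bochner_riesz_ge0.
rewrite ge0_integralZl ?lee_fin ?powR_ge0//; last 2 first.
- apply/measurable_EFinP; apply: measurable_prod => i _.
  by apply: measurable_fun_powR; apply: measurable_fun_powR.
- by move=> x _; rewrite lee_fin; apply: prodr_ge0 => i _; exact: powR_ge0.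
by rewrite EFinM lee_wpmul2l ?lee_fin ?powR_ge0.
Qed.
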